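(* Let $X$ and $Y$ be complex manifolds with $X$ compact, and let $\pi: X \to Y$ be a surjective holomorphic submersion. Assume that $Y$ has a Hermitian metric of positive holomorphic sectional curvature and that there exists a smooth family of Hermitian metrics on the fibers $\pi^{-1}(t)$, $t\in Y$, all of which have positive holomorphic sectional curvature. Then there exists a Hermitian metric on $X$ with positive holomorphic sectional curvature.
   Context: No Kähler assumption is made on any metric. A smooth family of Hermitian metrics on the fibers is a choice, for each $t\in Y$, of a Hermitian metric $G_t$ on the compact complex manifold $\pi^{-1}(t)$, varying smoothly with $t$ (i.e. together the $G_t$ form a $C^\infty$ Hermitian metric on the vertical holomorphic tangent bundle $\ker d\pi\subset TX$). Holomorphic sectional curvature: let $M$ be an $n$-dimensional complex manifold with local holomorphic coordinates $z_1,\ldots,z_n$ and a Hermitian metric $\sum_{i,j=1}^n g_{i\bar j}\,dz_i\otimes d\bar z_j$. The components of the curvature tensor of the metric (Chern) connection are $$R_{i\bar j k\bar l}=-\frac{\partial^2 g_{i\bar j}}{\partial z_k\partial\bar z_l}+\sum_{p,q=1}^n g^{p\bar q}\,\frac{\partial g_{i\bar p}}{\partial z_k}\frac{\partial g_{q\bar j}}{\partial \bar z_l},$$ where $(g^{p\bar q})$ is the inverse of the matrix $(g_{i\bar j})$. For a nonzero tangent vector $\xi=\sum_{i=1}^n\xi_i\frac{\partial}{\partial z_i}$ at $p\in M$, the holomorphic sectional curvature is $$K(\xi)=\Bigl(2\sum_{i,j,k,l=1}^n R_{i\bar jk\bar l}(p)\,\xi_i\bar\xi_j\xi_k\bar\xi_l\Bigr)\Big/\Bigl(\sum_{i,j,k,l=1}^n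 g_{i\bar j}(p)g_{k\bar l}(p)\,\xi_i\bar\xi_j\xi_k\bar\xi_l\Bigr).$$ The metric has positive holomorphic sectional curvature at $p$ if $K(\xi)>0$ for every nonzero $\xi\in T_pM$, and has positive holomorphic sectional curvature if this holds at every $p\in M$. *)

(* Defs.v *)
From HB Require Import structures.
From mathcomp Require Import all_boot all_order all_algebra.
From mathcomp Require Import complex.
From mathcomp Require Import all_classical all_reals all_analysis.
Import Order.TTheory GRing.Theory Num.Theory.
Import numFieldNormedType.Exports.

Set Implicit Arguments.
Unset Strict Implicit.
Unset Printing Implicit Defensive.

Local Open Scope classical_set_scope.
Local Open Scope ring_scope.
Local Open Scope complex_scope.

(** * Calculus on C^n *)

(* C^n as a real normed space: the pair (x, y) stands for x + i y. Tangent
   vectors, by contrast, are column vectors over R[i] (components in the frame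
   d/dz_1, ..., d/dz_n of the holomorphic tangent bundle). *)
Definition Cn (R : realType) (n : nat) : normedModType R :=
  ('rV[R]_n * 'rV[R]_n)%type.

Definition coord (R : realType) (n : nat) (k : 'I_n) (z : Cn R n) : R[i] :=
  z.1 ord0 k +i* z.2 ord0 k.

Fixpoint Ck (R : realType) (V : normedModType R) (k : nat) (U : set V)
    (f : V -> R) : Prop :=
  (forall x, U x -> {for x, continuous f}) /\
  if k is k'.+1 then
    forall v : V, (forall x, U x -> derivable f x v) /\ Ck k' U ('D_v f)
  else True.

Definition smooth (R : realType) (V : normedModType R) (U : set V)
    (f : V -> R[i]) : Prop :=
  forall k, Ck k U (fun x => complex.Re (f x)) /\
            Ck k U (fun x => complex.Im (f x)).

Definition rderive (R : realType) (V : normedModType R) (v : V)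
    (f : V -> R[i]) (x : V) : R[i] :=
  'D_v (fun y => complex.Re (f y)) x +i* 'D_v (fun y => complex.Im (f y)) x.

Definition dz (R : realType) (n : nat) (k : 'I_n) (f : Cn R n -> R[i])
    (z : Cn R n) : R[i] :=
  (rderive ((delta_mx ord0 k, 0) : Cn R n) f z
   - (0 +i* 1) * rderive ((0, delta_mx ord0 k) : Cn R n) f z) / 2%:R.

Definition dzbar (R : realType) (n : nat) (k : 'I_n) (f : Cn R n -> R[i])
    (z : Cn R n) : R[i] :=
  (rderive ((delta_mx ord0 k, 0) : Cn R n) f z
   + (0 +i* 1) * rderive ((0, delta_mx ord0 k) : Cn R n) f z) / 2%:R.

(* Holomorphic on U (meant for U open): smooth, with the Cauchy-Riemann
   equations in every variable. *)
Definition holomorphic_on (R : realType) (n m : nat) (U : set (Cn R n))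
    (F : Cn R n -> Cn R m) : Prop :=
  forall a : 'I_m, smooth U (coord a \o F) /\
    forall (k : 'I_n) z, U z -> dzbar k (coord a \o F) z = 0.

Definition jacobian (R : realType) (n m : nat) (F : Cn R n -> Cn R m)
    (z : Cn R n) : 'M[R[i]]_(m, n) :=
  \matrix_(a, k) dz k (coord a \o F) z.

(** * Complex manifolds *)

(* A homeomorphism from an open subset chart_dom of M onto an open subset of
   C^n. The values of chart_map and chart_inv outside chart_dom and its image
   are irrelevant. *)
Record chart (R : realType) (M : topologicalType) (n : nat) := Chart {
  chart_dom : set M;
  chart_map : M -> Cn R n;
  chart_inv : Cn R n -> M;
  chart_dom_open : open chart_dom;
  chart_cod_open : open (chart_map @` chart_dom);
  chart_mapK : forall p, chart_dom p -> chart_inv (chart_map p) = p;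
  chart_map_continuous :
    forall p, chart_dom p -> {for p, continuous chart_map};
  chart_inv_continuous :
    forall z, (chart_map @` chart_dom) z -> {for z, continuous chart_inv} }.

Definition chart_cod (R : realType) (M : topologicalType) (n : nat)
    (phi : chart R M n) : set (Cn R n) :=
  chart_map phi @` chart_dom phi.

(* The expression of f in the charts phi and psi, and its domain. *)
Definition local_map (R : realType) (M N : topologicalType) (n m : nat)
    (phi : chart R M n) (psi : chart R N m) (f : M -> N) : Cn R n -> Cn R m :=
  chart_map psi \o f \o chart_inv phi.

Definition local_dom (R : realType) (M N : topologicalType) (n m : nat)
    (phi : chart R M n) (psi : chart R N m) (f : M -> N) : set (Cn R n) :=
  chart_map phi @` (chart_dom phi `&` f @^-1` chart_dom psi).

Definition holomorphic_in (R : realType) (M N : topologicalType) (n m : nat)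
    (phi : chart R M n) (psi : chart R N m) (f : M -> N) : Prop :=
  holomorphic_on (local_dom phi psi f) (local_map phi psi f).

Definition compatible (R : realType) (M : topologicalType) (n : nat)
    (phi psi : chart R M n) : Prop :=
  holomorphic_in phi psi id /\ holomorphic_in psi phi id.

Record complexManifold (R : realType) (n : nat) := ComplexManifold {
  carrier :> topologicalType;
  atlas : set (chart R carrier n);
  carrier_hausdorff : hausdorff_space carrier;
  carrier_second_countable : @second_countable carrier;
  atlas_cover : forall p, exists2 phi, atlas phi & chart_dom phi p;
  atlas_compatible :
    forall phi psi, atlas phi -> atlas psi -> compatible phi psi }.

(* Local holomorphic coordinate systems: the maximal atlas. *)
Definition holo_chart (R : realType) (n : nat) (X : complexManifold R n)
    (phi : chart R X n) : Prop :=
  forall psi, atlas psi -> compatible phi psi.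

Definition holomorphic (R : realType) (n m : nat) (X : complexManifold R n)
    (Y : complexManifold R m) (f : X -> Y) : Prop :=
  continuous f /\
  forall (phi : chart R X n) (psi : chart R Y m),
    holo_chart phi -> holo_chart psi -> holomorphic_in phi psi f.

(* The holomorphic differential of f at p, in the charts phi and psi. *)
Definition differential_in (R : realType) (M N : topologicalType) (n m : nat)
    (phi : chart R M n) (psi : chart R N m) (f : M -> N) (p : M) :
    'M[R[i]]_(m, n) :=
  jacobian (local_map phi psi f) (chart_map phi p).

Definition submersion (R : realType) (n m : nat) (X : complexManifold R n)
    (Y : complexManifold R m) (f : X -> Y) : Prop :=
  forall (phi : chart R X n) (psi : chart R Y m) (p : X),
    holo_chart phi -> holo_chart psi -> chart_dom phi p ->
    chart_dom psi (f p) ->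
  forall eta : 'cV[R[i]]_m, exists xi : 'cV[R[i]]_n,
    differential_in phi psi f p *m xi = eta.

(** * Hermitian metrics *)

(* A family of linear subspaces of the holomorphic tangent spaces: E phi p is
   the subspace at p, in components with respect to the chart phi. *)
Definition subbundle (R : realType) (n : nat) (X : complexManifold R n) :=
  chart R X n -> X -> set 'cV[R[i]]_n.

Definition tangent (R : realType) (n : nat) (X : complexManifold R n) :
    subbundle X :=
  fun _ _ => setT.

Definition vertical (R : realType) (n m : nat) (X : complexManifold R n)
    (Y : complexManifold R m) (f : X -> Y) : subbundle X :=
  fun phi p => [set xi | forall psi : chart R Y m,
    holo_chart psi -> chart_dom psi (f p) ->
    differential_in phi psi f p *m xi = 0].

(* A smooth Hermitian metric on E: metric phi p xi eta is the inner product of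
   the vectors of E at p with components xi and eta in the chart phi. It is
   meaningful only for phi holomorphic, p in its domain and xi, eta in E. *)
Record hermitian_metric (R : realType) (n : nat) (X : complexManifold R n)
    (E : subbundle X) := HermitianMetric {
  metric :> chart R X n -> X -> 'cV[R[i]]_n -> 'cV[R[i]]_n -> R[i];
  metric_linear : forall phi p, holo_chart phi -> chart_dom phi p ->
    forall (a : R[i]) xi xi' eta, E phi p xi -> E phi p xi' -> E phi p eta ->
    metric phi p (a *: xi + xi') eta
      = a * metric phi p xi eta + metric phi p xi' eta;
  metric_hermitian : forall phi p, holo_chart phi -> chart_dom phi p ->
    forall xi eta, E phi p xi -> E phi p eta ->
    metric phi p eta xi = conjc (metric phi p xi eta);
  metric_positive : forall phi p, holo_chart phi -> chart_dom phi p ->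
    forall xi, E phi p xi -> xi != 0 -> 0 < metric phi p xi xi;
  metric_change : forall phi psi p, holo_chart phi -> holo_chart psi ->
    chart_dom phi p -> chart_dom psi p ->
    forall xi eta, E phi p xi -> E phi p eta ->
    metric psi p (differential_in phi psi id p *m xi)
                 (differential_in phi psi id p *m eta) = metric phi p xi eta;
  metric_smooth : forall phi, holo_chart phi ->
    forall (U : set (Cn R n)) (V W : Cn R n -> 'cV[R[i]]_n),
    open U -> U `<=` chart_cod phi ->
    (forall k, smooth U (fun z => V z k ord0)) ->
    (forall k, smooth U (fun z => W z k ord0)) ->
    (forall z, U z -> E phi (chart_inv phi z) (V z)) ->
    (forall z, U z -> E phi (chart_inv phi z) (W z)) ->
    smooth U (fun z => metric phi (chart_inv phi z) (V z) (W z)) }.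

(** * Holomorphic sectional curvature *)

Definition curvature (R : realType) (n : nat) (g : Cn R n -> 'M[R[i]]_n)
    (i j k l : 'I_n) (z : Cn R n) : R[i] :=
  - dz k (dzbar l (fun w => g w i j)) z
  + \sum_(p < n) \sum_(q < n) invmx (g z) p q
      * dz k (fun w => g w i p) z * dzbar l (fun w => g w q j) z.

Definition hol_sect_curvature (R : realType) (n : nat)
    (g : Cn R n -> 'M[R[i]]_n) (z : Cn R n) (xi : 'cV[R[i]]_n) : R[i] :=
  let x i := xi i ord0 in
  (2%:R * \sum_(i < n) \sum_(j < n) \sum_(k < n) \sum_(l < n)
     curvature g i j k l z * x i * conjc (x j) * x k * conjc (x l))
  / (\sum_(i < n) \sum_(j < n) \sum_(k < n) \sum_(l < n)
     g z i j * g z k l * x i * conjc (x j) * x k * conjc (x l)).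

Definition metric_mx (R : realType) (n : nat) (X : complexManifold R n)
    (h : hermitian_metric (@tangent R n X)) (phi : chart R X n)
    (z : Cn R n) : 'M[R[i]]_n :=
  \matrix_(i, j) h phi (chart_inv phi z) (delta_mx i ord0) (delta_mx j ord0).

(* The order of R[i] is partial: 0 < K says that K is real and positive. *)
Definition positive_hsc (R : realType) (n : nat) (X : complexManifold R n)
    (h : hermitian_metric (@tangent R n X)) : Prop :=
  forall (phi : chart R X n) (p : X), holo_chart phi -> chart_dom phi p ->
  forall xi : 'cV[R[i]]_n, xi != 0 ->
    0 < hol_sect_curvature (metric_mx h phi) (chart_map phi p) xi.

(** * Fibers *)

Definition fiber (R : realType) (n m : nat) (X : complexManifold R n)
    (Y : complexManifold R m) (f : X -> Y) (t : Y) : topologicalType :=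
  set_type (f @^-1` [set t]).

Definition fiber_incl (R : realType) (n m : nat) (X : complexManifold R n)
    (Y : complexManifold R m) (f : X -> Y) (t : Y) : fiber f t -> X :=
  fun p => set_val p.

(* Local holomorphic coordinates on the complex submanifold f^-1(t) of X: the
   charts of the topological space f^-1(t) in which the inclusion into X is a
   holomorphic immersion. *)
Definition fiber_chart (R : realType) (n m : nat) (X : complexManifold R n)
    (Y : complexManifold R m) (f : X -> Y) (t : Y) (r : nat)
    (sigma : chart R (fiber f t) r) : Prop :=
  forall phi : chart R X n, holo_chart phi ->
    holomorphic_in sigma phi (@fiber_incl R n m X Y f t) /\
    forall p : fiber f t, chart_dom sigma p -> chart_dom phi (fiber_incl p) ->
    forall xi : 'cV[R[i]]_r,
      differential_in sigma phi (@fiber_incl R n m X Y f t) p *m xi = 0 ->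
      xi = 0.

(* The matrix, in the coordinates sigma, of the metric induced by G on the
   fiber: G evaluated on the images of the coordinate vector fields under the
   inclusion. It does not depend on the chart phi of X used to express these
   images, but only makes sense at points of the domain of phi. *)
Definition fiber_metric_mx (R : realType) (n m : nat)
    (X : complexManifold R n) (Y : complexManifold R m) (f : X -> Y)
    (G : hermitian_metric (vertical f)) (t : Y) (r : nat)
    (sigma : chart R (fiber f t) r) (phi : chart R X n)
    (w : Cn R r) : 'M[R[i]]_r :=
  let J := jacobian (local_map sigma phi (@fiber_incl R n m X Y f t)) w in
  \matrix_(i, j)
    G phi (fiber_incl (chart_inv sigma w)) (col i J) (col j J).

(* The fibers of a submersion have dimension n - m. *)
Definition fibers_positive_hsc (R : realType) (n m : nat)
    (X : complexManifold R n) (Y : complexManifold R m) (f : X -> Y)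
    (G : hermitian_metric (vertical f)) : Prop :=
  forall (t : Y) (sigma : chart R (fiber f t) (n - m)%N)
    (phi : chart R X n) (p : fiber f t),
  fiber_chart sigma -> holo_chart phi ->
  chart_dom sigma p -> chart_dom phi (fiber_incl p) ->
  forall xi : 'cV[R[i]]_(n - m)%N, xi != 0 ->
    0 < hol_sect_curvature (fiber_metric_mx G sigma phi) (chart_map sigma p) xi.

(* Main.v *)
From mathcomp Require Import all_boot all_order all_algebra.
From mathcomp Require Import complex.
From mathcomp Require Import all_classical all_reals all_analysis.
From mathcomp Require Import ring lra.
Require Import Defs.
Import Order.TTheory GRing.Theory Num.Theory.
Import numFieldNormedType.Exports.

Set Implicit Arguments.
Unset Strict Implicit.
Unset Printing Implicit Defensive.

Local Open Scope classical_set_scope.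
Local Open Scope ring_scope.
Local Open Scope complex_scope.

(** Curvature is not additive in the metric, but it is bounded below by something
    that is. For a Hermitian metric [g], a tangent vector [xi] and a test vector
    [eta], [Nform g z xi eta] is minus the mixed second derivative of the squared
    length of the velocity of a holomorphic disc through [z] with velocity [xi] and
    acceleration [- eta]. It is linear in [g], and completing the square in [eta]
    shows that the curvature numerator [curvature_form g z xi] is its maximum over
    [eta] ([Nform_optimal], [Nform_le_curvature_form]). Being defined by discs, it
    behaves well under holomorphic maps ([Nform_pullback]), so positivity of the
    curvature can be tested in any chart, passes to submanifolds in the form needed
    below, and is proved by exhibiting one good test vector.

    The metric on the total space is [H = A + s pi^* h] with [h] the metric of the
    base, [A] a nonnegative Hermitian form restricting to the given metrics on the
    fibers, and [s] a large constant. The form [A] is glued from local extensions by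
    bump functions ([fiber_metric_extension]). Around each point there is a chart in
    which [pi] is a linear map [J] ([adapted_chart], by the holomorphic inverse
    function theorem); let [B] be a right inverse of [J]. Then
    [Nform H z xi eta = Nform A z xi eta + s Nform h (J z) (J xi) (J eta)], and there
    are two kinds of directions [xi0]. If [J xi0] is not zero, let [eta = B k0] with
    [k0] the optimal test vector of [h] at [J xi0]: the second term is positive, and
    dominates for large [s]. If [xi0] is vertical, let [eta = eta0 + B k] with [eta0]
    the optimal test vector of the fiber and [k = k(z, xi)] the optimal one of [h] at
    [J xi]: near [xi0] the first term is positive by continuity, because [k] vanishes
    at [xi0], while the second one is the curvature numerator of [h] at [J xi], which
    is nonnegative. Either way the curvature is positive for all [s] beyond a bound
    which is uniform near the given point and direction ([curvature_total_near]).
    Compactness of the unit sphere and of [X] yields one [s] for all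
    ([curvature_total_gt0]).

    The analysis behind this is elementary calculus in C^n: a mean value estimate
    ([increment_bound]) gives strict differentiability of C^1 functions
    ([strictly_differentiable]), from which follow the chain rule, the symmetry of
    second derivatives and the inverse function theorem ([holomorphic_inverse]). *)

(** * Directional derivatives in real normed spaces *)

Section DirectionalDerivatives.
Variables (R : realType) (V : normedModType R).
Implicit Types (f g : V -> R) (x y v : V).

Lemma line_growth_rate f a v t :
  (fun h : R => h^-1 *: (((fun s => f (a + s *: v)) \o shift t) (h *: 1) -
                         f (a + t *: v)))
  = (fun h : R => h^-1 *: ((f \o shift (a + t *: v)) (h *: v) -
                           f (a + t *: v))).
Proof.
apply/funext => h /=; congr (_ *: (f _ - _)).
by rewrite [h *: 1]mulr1 scalerDl addrCA addrA.
Qed.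

Lemma derivable_line f a v (t : R) :
  derivable f (a + t *: v) v -> derivable (fun s : R => f (a + s *: v)) t 1.
Proof. by rewrite /derivable line_growth_rate. Qed.

Lemma derive_line f a v (t : R) :
  'D_1 (fun s : R => f (a + s *: v)) t = 'D_v f (a + t *: v).
Proof. by rewrite /derive line_growth_rate. Qed.

Lemma mean_value_direction f a v :
  (forall t : R, 0 <= t <= 1 -> derivable f (a + t *: v) v) ->
  exists2 t : R, 0 <= t <= 1 & f (a + v) - f a = 'D_v f (a + t *: v).
Proof.
move=> df; pose p := fun t : R => f (a + t *: v).
have dp (t : R) : 0 <= t <= 1 -> is_derive t 1 p ('D_v f (a + t *: v)).
  move=> t01; rewrite -derive_line; apply: derivableP.
  exact/derivable_line/df.
have [||c c01] := @MVT_segment R p (fun t => 'D_v f (a + t *: v)) 0 1 ler01.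
- by move=> t; rewrite in_itv /= => /andP[t0 t1]; apply: dp; rewrite !ltW.
- apply: derivable_within_continuous => t; rewrite in_itv /= => t01.
  by have /@ex_derive := dp t t01.
rewrite /p scale1r scale0r addr0 subr0 mulr1 => fE.
by exists c => //; move: c01; rewrite in_itv.
Qed.

Lemma is_derive_scale f x v (c : R) : derivable f x v ->
  is_derive x (c *: v) f (c * 'D_v f x).
Proof.
move=> dfv; pose p := fun s => f (x + s *: v).
have dp : derivable p (c * 0) 1.
  by apply: derivable_line; rewrite mulr0 scale0r addr0.
have cE : *%R c = c *: (@id R^o) by apply/funext.
have dcs : is_derive (0 : R^o) (1 : R^o) ( *%R c) (c *: 1).
  by rewrite cE; apply: is_deriveZ.
have [dc dcE] := dcs.
have E : (fun s => f (x + s *: (c *: v))) = p \o *%R c.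
  by apply/funext => s /=; rewrite /p scalerA mulrC.
have dpc : derivable (p \o *%R c) 0 1.
  apply/derivable1_diffP; apply: differentiable_comp.
    exact/derivable1_diffP.
  exact/derivable1_diffP.
split.
  apply/derivable1P.
  suff -> : (fun h : R => f (h *: (c *: v) + x)) = p \o *%R c by [].
  by rewrite -E; apply/funext => s; rewrite addrC.
have := derive1_comp dc dp.
rewrite !derive1E -E derive_line !mulr0 !scale0r !addr0 => ->.
by rewrite dcE derive_line scale0r addr0 mulrC; congr (_ * _); rewrite [_ *: _]mulr1.
Qed.

Lemma derivable_scale f x v (c : R) :
  derivable f x v -> derivable f x (c *: v).
Proof. by move=> /(is_derive_scale c) []. Qed.

Lemma derive_scale f x v (c : R) :
  derivable f x v -> 'D_(c *: v) f x = c * 'D_v f x.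
Proof. by move=> /(is_derive_scale c) []. Qed.

(** Continuity of the derivatives along the vectors [e i] at the single point
    [y] controls the increment of [f] between any two nearby points that
    differ by a combination of them: the mean value theorem is applied along
    one vector at a time. *)
Lemma increment_bound (I : eqType) (e : I -> V) (s : seq I) f y (eps d : R) :
  (forall x, `|x - y| < d -> forall i, i \in s ->
     derivable f x (e i) /\ `|'D_(e i) f x - 'D_(e i) f y| <= eps) ->
  forall a (c : I -> R), `|a - y| + \sum_(i <- s) `|c i| * `|e i| < d ->
  `|f (a + \sum_(i <- s) c i *: e i) - f a - \sum_(i <- s) c i * 'D_(e i) f y|
    <= eps * \sum_(i <- s) `|c i|.
Proof.
move=> H a c; elim: s a H => [|i s IH] a H.
  by rewrite !big_nil !addr0 subrr subr0 normr0 mulr0.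
rewrite !big_cons => lt_d.
set a' := a + c i *: e i.
have S0 : 0 <= \sum_(j <- s) `|c j| * `|e j|.
  by apply: sumr_ge0 => j _; rewrite mulr_ge0.
have normce : `|c i *: e i| = `|c i| * `|e i| by rewrite normrZ.
have {}IH : `|f (a' + \sum_(i <- s) c i *: e i) - f a' -
    \sum_(i <- s) c i * 'D_(e i) f y| <= eps * \sum_(i <- s) `|c i|.
  apply: IH => [x xy j js|]; first by apply: H => //; rewrite inE js orbT.
  apply: le_lt_trans lt_d; rewrite addrA lerD2r /a' addrAC -normce.
  exact: ler_normD.
have near_a (t : R) : 0 <= t <= 1 -> `|a + t *: (c i *: e i) - y| < d.
  move=> /andP[t0 t1]; apply: le_lt_trans lt_d.
  rewrite addrAC; apply: le_trans (ler_normD _ _) _.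
  rewrite lerD2l normrZ normce (ger0_norm t0).
  apply: le_trans (_ : `|c i| * `|e i| <= _); last by rewrite lerDl.
  by rewrite ler_piMl // mulr_ge0.
have [|t t01 Et] := @mean_value_direction f a (c i *: e i).
  move=> t t01; apply: derivable_scale.
    by have [] := H _ (near_a t t01) i (mem_head _ _).
have [dt bt] := H _ (near_a t t01) i (mem_head _ _).
move: Et; rewrite (derive_scale _ dt) -/a' => Et.
have -> : f (a + (c i *: e i + \sum_(j <- s) c j *: e j)) - f a -
    (c i * 'D_(e i) f y + \sum_(j <- s) c j * 'D_(e j) f y)
  = (f (a' + \sum_(j <- s) c j *: e j) - f a' -
     \sum_(j <- s) c j * 'D_(e j) f y) +
    c i * ('D_(e i) f (a + t *: (c i *: e i)) - 'D_(e i) f y).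
  by rewrite mulrBr -Et addrA /a'; ring.
apply: le_trans (ler_normD _ _) _; rewrite [leRHS]mulrDr [leRHS]addrC; apply: lerD => //.
by rewrite normrM mulrC; apply: ler_wpM2r.
Qed.

End DirectionalDerivatives.

(** * Functions of class C^k *)

Section ClassCk.
Variables (R : realType) (V : normedModType R).
Implicit Types (f g : V -> R) (U W : set V) (x v : V) (k : nat).

Lemma Ck_continuous k U f x : Ck k U f -> U x -> {for x, continuous f}.
Proof. by case: k => [|k] [cf _]; exact: cf. Qed.

Lemma Ck_derivable k U f x v : Ck k.+1 U f -> U x -> derivable f x v.
Proof. by move=> [_ /(_ v)[df _]]; exact: df. Qed.

Lemma Ck_derive k U f v : Ck k.+1 U f -> Ck k U ('D_v f).
Proof. by move=> [_ /(_ v)[]]. Qed.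

Lemma CkS k U f : Ck k.+1 U f -> Ck k U f.
Proof.
elim: k f => [|k IH] f [cf df]; first by split.
by split=> // v; have [? /IH] := df v.
Qed.

Lemma Ck_sub k U W f : W `<=` U -> Ck k U f -> Ck k W f.
Proof.
move=> WU; elim: k f => [|k IH] f [cf df].
  by split=> // x /WU/cf.
split=> [x /WU/cf//|v].
by have [dfv Dfv] := df v; split=> [x /WU/dfv//|]; apply: IH.
Qed.

(** Continuity and derivatives at a point depend on germs only. *)
Lemma Ck_local k U f :
  (forall x, U x -> exists g W, [/\ open W, W x, {in W, f =1 g} & Ck k W g]) ->
  Ck k U f.
Proof.
elim: k f => [|k IH] f loc.
  split=> // x Ux; have [g [W [oW Wx fg [cg _]]]] := loc x Ux.
  have nfg : \near x, g x = f x.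
    apply: filterS (open_nbhs_nbhs (conj oW Wx)) => z Wz.
    by rewrite fg // inE.
  rewrite /prop_for /continuous_at fg ?inE //.
  apply: cvg_trans (cg x Wx); exact: near_eq_cvg.
split=> [x Ux|v].
  have [g [W [oW Wx fg [cg _]]]] := loc x Ux.
  have nfg : \near x, g x = f x.
    apply: filterS (open_nbhs_nbhs (conj oW Wx)) => z Wz.
    by rewrite fg // inE.
  rewrite /prop_for /continuous_at fg ?inE //.
  apply: cvg_trans (cg x Wx); exact: near_eq_cvg.
split=> [x Ux|].
  have [g [W [oW Wx fg Cg]]] := loc x Ux.
  apply: (@near_eq_derivable _ _ _ g); last exact: Ck_derivable Cg Wx.
  apply: filterS (open_nbhs_nbhs (conj oW Wx)) => z Wz.
  by rewrite fg // inE.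
apply: IH => x Ux; have [g [W [oW Wx fg Cg]]] := loc x Ux.
exists ('D_v g), W; split=> //; last exact: Ck_derive.
move=> z /set_mem Wz; apply: near_eq_derive.
apply: filterS (open_nbhs_nbhs (conj oW Wz)) => t Wt.
by rewrite fg // inE.
Qed.

Lemma eq_Ck k U f g : open U -> {in U, f =1 g} -> Ck k U g -> Ck k U f.
Proof. by move=> oU fg Cg; apply: Ck_local => x Ux; exists g, U. Qed.

Lemma Ck_cst k U (c : R) : Ck k U (cst c).
Proof.
elim: k c => [|k IH] c.
  by split=> // x _; exact: cvg_cst.
split=> [x _|v]; first exact: cvg_cst.
split=> [x _|]; first exact: derivable_cst.
suff -> : 'D_v (cst c) = cst (0 : R) by exact: IH.
by apply/funext => x; rewrite derive_cst.
Qed.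

Lemma CkD k U f g : open U -> Ck k U f -> Ck k U g -> Ck k U (fun x => f x + g x).
Proof.
move=> oU; elim: k f g => [|k IH] f g Cf Cg.
  split=> // x Ux; apply: continuousD; [exact: Ck_continuous Cf Ux|].
  exact: Ck_continuous Cg Ux.
split=> [x Ux|v].
  by apply: continuousD; [exact: Ck_continuous Cf Ux|exact: Ck_continuous Cg Ux].
split=> [x Ux|].
  by apply: derivableD; [exact: Ck_derivable Cf Ux|exact: Ck_derivable Cg Ux].
apply: eq_Ck (IH _ _ (Ck_derive v Cf) (Ck_derive v Cg)) => // x /set_mem Ux.
by apply: deriveD; [exact: Ck_derivable Cf Ux|exact: Ck_derivable Cg Ux].
Qed.

Lemma CkM k U f g : open U -> Ck k U f -> Ck k U g -> Ck k U (fun x => f x * g x).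
Proof.
move=> oU; elim: k f g => [|k IH] f g Cf Cg.
  split=> // x Ux; apply: continuousM; [exact: Ck_continuous Cf Ux|].
  exact: Ck_continuous Cg Ux.
split=> [x Ux|v].
  by apply: continuousM; [exact: Ck_continuous Cf Ux|exact: Ck_continuous Cg Ux].
split=> [x Ux|].
  by apply: derivableM; [exact: Ck_derivable Cf Ux|exact: Ck_derivable Cg Ux].
have C := CkD oU (IH _ _ (CkS Cf) (Ck_derive v Cg))
                 (IH _ _ (CkS Cg) (Ck_derive v Cf)).
apply: eq_Ck C => // x /set_mem Ux.
by apply: deriveM; [exact: Ck_derivable Cf Ux|exact: Ck_derivable Cg Ux].
Qed.

Lemma CkN k U f : open U -> Ck k U f -> Ck k U (fun x => - f x).
Proof.
move=> oU Cf; apply: eq_Ck (CkM oU (Ck_cst k U (-1)) Cf) => // x _.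
by rewrite /= mulN1r.
Qed.

Lemma CkV k U f : open U -> Ck k U f -> (forall x, U x -> f x != 0) ->
  Ck k U (fun x => (f x)^-1).
Proof.
move=> oU Cf f0; elim: k Cf => [|k IH] Cf.
  by split=> // x Ux; apply: continuousV; [exact: f0|exact: Ck_continuous Cf Ux].
split=> [x Ux|v].
  by apply: continuousV; [exact: f0|exact: Ck_continuous Cf Ux].
split=> [x Ux|].
  by apply: derivableV; [exact: f0|exact: Ck_derivable Cf Ux].
have Ci := IH (CkS Cf).
have C := CkM oU (CkN oU (CkM oU Ci Ci)) (Ck_derive v Cf).
apply: eq_Ck C => // x /set_mem Ux.
rewrite deriveV; [|exact: f0|exact: Ck_derivable Cf Ux].
by rewrite /= -exprVn expr2.
Qed.

End ClassCk.

(** * Calculus in real coordinates of C^n *)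

Section RealCoordinates.
Variables (R : realType) (n : nat).

Definition rbasis (i : 'I_n + 'I_n) : Cn R n :=
  match i with
  | inl k => (delta_mx ord0 k, 0)
  | inr k => (0, delta_mx ord0 k)
  end.

Definition rcoord (i : 'I_n + 'I_n) (z : Cn R n) : R :=
  match i with inl k => z.1 ord0 k | inr k => z.2 ord0 k end.

Lemma rcoordD i x y : rcoord i (x + y) = rcoord i x + rcoord i y.
Proof. by case: i => k; rewrite /= mxE. Qed.

Lemma rcoordZ i (c : R) x : rcoord i (c *: x) = c * rcoord i x.
Proof. by case: i => k; rewrite /= mxE. Qed.

Lemma rcoordN i x : rcoord i (- x) = - rcoord i x.
Proof. by case: i => k; rewrite /= mxE. Qed.

Lemma rcoordB i x y : rcoord i (x - y) = rcoord i x - rcoord i y.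
Proof. by rewrite rcoordD rcoordN. Qed.

Lemma rcoord_sum (I : Type) (r : seq I) (F : I -> Cn R n) i :
  rcoord i (\sum_(j <- r) F j) = \sum_(j <- r) rcoord i (F j).
Proof.
elim: r => [|j r IH]; last by rewrite !big_cons rcoordD IH.
by rewrite !big_nil; case: i => k; rewrite /= mxE.
Qed.

Lemma rcoord_basis i j : rcoord i (rbasis j) = (i == j)%:R.
Proof. by case: i j => k [] l; rewrite /= mxE ?eqxx. Qed.

Lemma eq_rcoord x y : (forall i, rcoord i x = rcoord i y) -> x = y.
Proof.
case: x y => [x1 x2] [y1 y2] E; congr (_, _); apply/rowP => k.
  exact: (E (inl k)).
exact: (E (inr k)).
Qed.

Lemma rcoord_decomp x : x = \sum_i rcoord i x *: rbasis i.
Proof.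
apply: eq_rcoord => j; rewrite rcoord_sum (bigD1 j) //= big1 => [|i ij].
  by rewrite addr0 rcoordZ rcoord_basis eqxx mulr1.
by rewrite rcoordZ rcoord_basis eq_sym (negbTE ij) mulr0.
Qed.

Lemma rcoord_le_norm i x : `|rcoord i x| <= `|x|.
Proof.
have le_mx (v : 'rV[R]_n) k : `|v ord0 k| <= `|v|.
  by rewrite [leRHS]mx_normrE; apply: (@le_bigmax _ _ _ 0 (fun ij => `|v ij.1 ij.2|) (ord0, k)).
rewrite prod_normE le_max; case: i => k /=; rewrite le_mx ?orbT //.
Qed.

Lemma norm_le_rcoord x (c : R) : 0 <= c -> (forall i, `|rcoord i x| <= c) ->
  `|x| <= c.
Proof.
move=> c0 H; have le_mx (v : 'rV[R]_n) :
    (forall k, `|v ord0 k| <= c) -> `|v| <= c.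
  move=> vc; rewrite [leLHS]mx_normrE; apply: bigmax_le => // -[a k] _ /=.
  by rewrite (ord1 a).
rewrite prod_normE ge_max; apply/andP; split; apply: le_mx => k.
  exact: (H (inl k)).
exact: (H (inr k)).
Qed.

Lemma norm_rbasis_le1 i : `|rbasis i| <= 1.
Proof.
by apply: norm_le_rcoord => // j; rewrite rcoord_basis; case: eqP; rewrite ?normr1 ?normr0.
Qed.

Lemma norm_le_sum_rcoord x : `|x| <= \sum_i `|rcoord i x|.
Proof.
apply: norm_le_rcoord => [|i]; first by apply: sumr_ge0.
by rewrite (bigD1 i) //= lerDl sumr_ge0.
Qed.

Lemma rcoord_continuous i : continuous (rcoord i).
Proof.
move=> x; apply/cvgrPdist_lt => /= e e0; near=> y.
rewrite -rcoordB; apply: le_lt_trans (rcoord_le_norm _ _) _.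
by near: y; exact: (@cvgr_dist_lt _ _ _ (nbhs x) _ id).
Unshelve. all: by end_near. Qed.

Lemma continuous_rcoords (T : topologicalType) (F : T -> Cn R n) x :
  (forall i, {for x, continuous (rcoord i \o F)}) -> {for x, continuous F}.
Proof.
move=> cF; apply/cvgrPdist_lt => /= e e0.
have H : \forall t \near x, forall i, i \in index_enum ('I_n + 'I_n)%type ->
    `|rcoord i (F x - F t)| <= e / 2.
  elim: (index_enum _) => [|i s IH]; first by near=> t.
  near=> t => j; rewrite inE => /orP[/eqP->|]; last by move: j; near: t.
  rewrite rcoordB ltW //; near: t.
  by have /cvgrPdist_lt := cF i; apply; rewrite divr_gt0.
apply: filterS H => t H; apply: (@le_lt_trans _ _ (e / 2)).
  apply: norm_le_rcoord => [|i]; first by rewrite divr_ge0 // ltW.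
  by apply: H; rewrite mem_index_enum.
by rewrite ltr_pdivrMr // ltr_pMr // ltr1n.
Unshelve. all: by end_near. Qed.

End RealCoordinates.

Section StrictDerivative.
Variables (R : realType) (n : nat).
Implicit Types (f : Cn R n -> R) (U : set (Cn R n)).

Definition grad f x v := \sum_i rcoord i v * 'D_(rbasis R i) f x.

(** A C^1 function is strictly differentiable: unlike in the definition of
    the differential at [x], both ends of the increment may move. This one
    estimate yields the chain rule, the symmetry of second derivatives and the
    contraction used to invert a map locally. *)
Lemma strictly_differentiable f U x : open U -> Ck 1 U f -> U x ->
  forall eps : R, 0 < eps -> exists2 d : R, 0 < d & forall a b,
    `|a - x| < d -> `|b - x| < d ->
    `|f b - f a - grad f x (b - a)| <= eps * `|b - a|.
Proof.
move=> oU Cf Ux eps eps0.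
(* one more than the number of real coordinates, to be positive also for n = 0 *)
pose N : R := #|{: 'I_n + 'I_n}|%:R + 1.
have N1 : 1 <= N by rewrite /N lerDr.
have N0 : 0 < N by exact: lt_le_trans N1.
have [d d0 Hd] : exists2 d : R, 0 < d & forall y, `|y - x| < d ->
    forall i, i \in index_enum ('I_n + 'I_n)%type ->
    derivable f y (rbasis R i) /\
    `|'D_(rbasis R i) f y - 'D_(rbasis R i) f x| <= eps / N.
  have : \forall y \near x, forall i, i \in index_enum ('I_n + 'I_n)%type ->
    derivable f y (rbasis R i) /\
    `|'D_(rbasis R i) f y - 'D_(rbasis R i) f x| <= eps / N.
    elim: (index_enum _) => [|i s IH]; first by near=> y.
    have ci : {for x, continuous ('D_(rbasis R i) f)}.
      exact: Ck_continuous (Ck_derive _ Cf) Ux.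
    near=> y => j; rewrite inE => /orP[/eqP ->|]; last by move: j; near: y.
    split.
      apply: Ck_derivable Cf _; near: y.
      exact: open_nbhs_nbhs.
    rewrite distrC ltW //; near: y.
    by apply: cvgr_dist_lt ci _ _; rewrite divr_gt0.
  move=> /nbhs_normP[d /= d0 Hd]; exists d => // y yx.
  by apply: Hd; rewrite /= distrC.
exists (d / (2 * N)); first by rewrite divr_gt0 // mulr_gt0.
move=> a b ax bx.
have ab : `|b - a| < d / N.
  have -> : b - a = (b - x) - (a - x) by rewrite opprB addrA subrK.
  apply: le_lt_trans (ler_normB _ _) _.
  have -> : d / N = d / (2 * N) + d / (2 * N) by field; rewrite gt_eqF.
  exact: ltrD.
have sum_le (c : 'I_n + 'I_n -> R) : (forall i, c i <= `|b - a|) ->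
    \sum_i c i <= (N - 1) * `|b - a|.
  move=> H; rewrite /N addrK; apply: le_trans (ler_sum _ (fun i _ => H i)) _.
  by rewrite sumr_const mulr_natl.
have := increment_bound Hd (a := a) (c := fun i => rcoord i (b - a)).
rewrite -rcoord_decomp subrKC => /(_ _)/le_trans; apply.
- have : \sum_i `|rcoord i (b - a)| * `|rbasis R i| <= (N - 1) * `|b - a|.
    apply: sum_le => i; rewrite -[leRHS]mulr1; apply: ler_pM => //.
      exact: rcoord_le_norm.
    exact: norm_rbasis_le1.
  move=> le1.
  have : (N - 1) * `|b - a| <= (N - 1) * (d / N).
    by rewrite ler_wpM2l ?subr_ge0 // ltW.
  move=> /(le_trans le1) le2.
  apply: lt_le_trans (ltr_leD ax le2) _.
  rewrite -subr_ge0.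
  have -> : d - (d / (2 * N) + (N - 1) * (d / N)) = d / (2 * N).
    by field; rewrite gt_eqF.
  by rewrite divr_ge0 ?mulr_ge0 // ltW.
- rewrite -mulrA; apply: ler_wpM2l; first exact: ltW.
  rewrite ler_pdivrMl //.
  apply: le_trans (sum_le _ (fun i => rcoord_le_norm i _)) _.
  by rewrite ler_wpM2r // gerBl.
Unshelve. all: by end_near. Qed.

Lemma cvg_sum_seq (T I : Type) (F : set_system T) (FF : Filter F) (s : seq I)
    (q : I -> T -> R) (l : I -> R) : (forall i, q i h @[h --> F] --> l i) ->
  (\sum_(i <- s) q i h) @[h --> F] --> \sum_(i <- s) l i.
Proof.
move=> ql; elim: s => [|i s IH].
  by under eq_fun do rewrite big_nil; rewrite big_nil; exact: cvg_cst.
by under eq_fun do rewrite big_cons; rewrite big_cons; exact: cvgD.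
Qed.

(** Chain rule along an arbitrary map [p] into C^n, of which only the derivatives
    of the coordinates in the direction [v] are used. *)
Lemma is_derive_comp (V : normedModType R) f U (p : V -> Cn R n) (y v : V)
    (w : 'I_n + 'I_n -> R) :
  open U -> Ck 1 U f -> U (p y) ->
  (forall i, is_derive y v (rcoord i \o p) (w i)) ->
  is_derive y v (f \o p) (\sum_i w i * 'D_(rbasis R i) f (p y)).
Proof.
move=> oU Cf Up dp.
pose q i (h : R) := h^-1 * (rcoord i (p (h *: v + y)) - rcoord i (p y)).
have qw i : q i h @[h --> 0^'] --> w i.
  by have [dpi <-] := dp i; exact: dpi.
pose L := \sum_i w i * 'D_(rbasis R i) f (p y).
pose C : R := \sum_i `|w i| + 1.
have C0 : 0 < C by rewrite ltr_wpDl // sumr_ge0.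
have Sq : (\sum_i `|q i h|) @[h --> 0^'] --> \sum_i `|w i|.
  by apply: cvg_sum_seq => i; exact: cvg_norm.
have SL : (\sum_i q i h * 'D_(rbasis R i) f (p y)) @[h --> 0^'] --> L.
  by apply: cvg_sum_seq => i; apply: cvgM => //; exact: cvg_cst.
have cvL : h^-1 *: (((f \o p) \o shift y) (h *: v) - (f \o p) y)
    @[h --> 0^'] --> L.
  suff /(cvgD SL) : h^-1 *: (((f \o p) \o shift y) (h *: v) - (f \o p) y)
     - (\sum_i q i h * 'D_(rbasis R i) f (p y)) @[h --> 0^'] --> (0 : R).
    rewrite addr0; apply: cvg_trans; apply: near_eq_cvg.
    by apply: nearW => h /=; rewrite addrC subrK.
  apply/cvgrPdist_lt => /= e e0.
  have [d d0 Hd] := strictly_differentiable oU Cf Up (divr_gt0 e0 C0).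
  near=> h; rewrite sub0r normrN.
  have h0 : h != 0 by near: h; exact: nbhs_dnbhs_neq.
  have qC : \sum_i `|q i h| < C.
    near: h; apply: (cvgr_lt _ Sq); by rewrite /C ltrDl.
  have pE i : rcoord i (p (h *: v + y) - p y) = h * q i h.
    by rewrite rcoordB /q mulrA mulfV // mul1r.
  have pn : `|p (h *: v + y) - p y| <= `|h| * \sum_i `|q i h|.
    apply: le_trans (norm_le_sum_rcoord _) _.
    by rewrite mulr_sumr ler_sum // => i _; rewrite pE normrM.
  have hd : `|h| < d / C.
    near: h; apply: dnbhs0_lt; exact: divr_gt0.
  have pd : `|p (h *: v + y) - p y| < d.
    apply: le_lt_trans pn _; rewrite -(divfK (lt0r_neq0 C0) d).
    apply: (@le_lt_trans _ _ (`|h| * C)); first by rewrite ler_wpM2l // ltW.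
    by rewrite ltr_pM2r.
  have := Hd (p y) (p (h *: v + y)); rewrite subrr normr0 => /(_ d0 pd) Hf.
  have gE : grad f (p y) (p (h *: v + y) - p y)
      = h * \sum_i q i h * 'D_(rbasis R i) f (p y).
    rewrite mulr_sumr; apply: eq_bigr => i _.
    by rewrite pE -mulrA.
  rewrite gE in Hf.
  rewrite /= -[X in _ - X](mulKf h0) -[_ *: _]/(_ * _) -mulrBr normrM normfV.
  rewrite ltr_pdivrMl ?normr_gt0 //.
  apply: le_lt_trans Hf _.
  apply: (@le_lt_trans _ _ (e / C * (`|h| * \sum_i `|q i h|))).
    by rewrite ler_wpM2l // ltW // divr_gt0.
  rewrite mulrCA ltr_pM2l ?normr_gt0 //.
  by rewrite mulrAC ltr_pdivrMr // ltr_pM2l.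
split; first by apply/cvg_ex; exists L.
exact: cvg_lim cvL.
Unshelve. all: by end_near. Qed.

Lemma is_derive_rcoord i (x v : Cn R n) : is_derive x v (rcoord i) (rcoord i v).
Proof.
have cvL : h^-1 *: (((rcoord i) \o shift x) (h *: v) - rcoord i x)
    @[h --> 0^'] --> rcoord i v.
  apply: cvg_near_cst; near=> h.
  rewrite /= rcoordD addrK rcoordZ [_ *: _]mulrA mulVf ?mul1r //.
  by near: h; exact: nbhs_dnbhs_neq.
split; first by apply/cvg_ex; exists (rcoord i v).
exact: cvg_lim cvL.
Unshelve. all: by end_near. Qed.

Lemma derive_grad f U x v : open U -> Ck 1 U f -> U x -> 'D_v f x = grad f x v.
Proof.
move=> oU Cf Ux; have [] // := @is_derive_comp _ f U id x v
  (fun i => rcoord i v) oU Cf Ux.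
by move=> i; exact: is_derive_rcoord.
Qed.

Lemma shift_growth_rate (V : normedModType R) (f : V -> R) c x v :
  (fun h : R => h^-1 *: (((fun z => f (z + c)) \o shift x) (h *: v) - f (x + c)))
  = (fun h : R => h^-1 *: ((f \o shift (x + c)) (h *: v) - f (x + c))).
Proof. by apply/funext => h /=; rewrite addrA. Qed.

(** The second difference is symmetric in [u] and [v], and tends to the derivative
    in which [v] is applied first: the symmetry of second derivatives. *)
Lemma second_difference f U x u v : open U -> Ck 2 U f -> U x ->
  forall eps : R, 0 < eps -> exists2 d : R, 0 < d & forall s : R,
    0 < s < d ->
    `|s ^- 2 * (f (x + s *: u + s *: v) - f (x + s *: u) - f (x + s *: v) + f x)
      - 'D_u ('D_v f) x| <= eps.
Proof.
move=> oU Cf Ux eps eps0.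
pose M : R := `|u| + `|v| + 1.
have M0 : 0 < M by rewrite ltr_wpDl // addr_ge0.
have Mu : `|u| <= M by rewrite /M -addrA lerDl addr_ge0.
have [d0 d00 Hd0] := strictly_differentiable oU (Ck_derive v Cf) Ux
  (divr_gt0 eps0 M0).
have [d1 /= d10 Hd1] : exists2 d : R, 0 < d & forall y, `|y - x| < d -> U y.
  have /nbhs_normP[d /= d1 H] : nbhs x U by exact: open_nbhs_nbhs.
  by exists d => // y; rewrite distrC => /H.
exists (Num.min d0 d1 / M); first by rewrite divr_gt0 // lt_min d00.
move=> s /andP[s0]; rewrite ltr_pdivlMr // => sM.
pose g := fun z => f (z + s *: u) - f z.
have nearx (a b : R) : 0 <= a <= 1 -> 0 <= b <= 1 ->
   `|x + (a * s) *: u + (b * s) *: v - x| < Num.min d0 d1.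
  move=> /andP[a0 a1] /andP[b0 b1]; apply: le_lt_trans sM.
  rewrite addrC addrA addKr; apply: le_trans (ler_normD _ _) _.
  rewrite !normrZ ?normrM !ger0_norm // ?(ltW s0) //.
  rewrite /M !mulrDr mulr1.
  apply: ler_wpDr; first exact: ltW.
  by apply: lerD; rewrite ler_wpM2r // ler_piMl // ltW.
have dg z : U z -> U (z + s *: u) -> is_derive z v g ('D_v f (z + s *: u) - 'D_v f z).
  move=> Uz Uzs.
  have df1 : is_derive z v (fun z => f (z + s *: u)) ('D_v f (z + s *: u)).
    have : derivable f (z + s *: u) v by exact: Ck_derivable Cf Uzs.
    rewrite /derivable /derive => d; split.
      by rewrite /derivable shift_growth_rate.
    by rewrite /derive shift_growth_rate.
  have df2 : is_derive z v f ('D_v f z).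
    by apply: derivableP; exact: Ck_derivable Cf Uz.
  exact: is_deriveB.
have gE : f (x + s *: u + s *: v) - f (x + s *: u) - f (x + s *: v) + f x =
    g (x + s *: v) - g x.
  by rewrite /g [x + s *: v + s *: u]addrAC; ring.
have Uab (a b : R) : 0 <= a <= 1 -> 0 <= b <= 1 ->
    U (x + (a * s) *: u + (b * s) *: v).
  move=> a01 b01; apply: Hd1; apply: lt_le_trans (nearx a b a01 b01) _.
  by rewrite ge_min lexx orbT.
have i0 : 0 <= (0 : R) <= 1 by rewrite lexx ler01.
have i1 : 0 <= (1 : R) <= 1 by rewrite lexx ler01.
have dgt (t : R) : 0 <= t <= 1 -> is_derive (x + t *: (s *: v)) v g
  ('D_v f (x + t *: (s *: v) + s *: u) - 'D_v f (x + t *: (s *: v))).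
  move=> t01; apply: dg.
    have := Uab 0 t i0 t01; by rewrite mul0r scale0r addr0 scalerA.
  by have := Uab 1 t i1 t01; rewrite mul1r scalerA addrAC.
have [|t t01 Et] := @mean_value_direction _ _ g x (s *: v).
  move=> t t01; apply: derivable_scale.
  by have [] := dgt t t01.
rewrite gE Et derive_scale; last by have [] := dgt t t01.
have [_ ->] := dgt t t01.
set a := x + t *: (s *: v).
have ax : `|a - x| < d0.
  have := nearx 0 t i0 t01; rewrite mul0r scale0r addr0 -scalerA.
  by rewrite lt_min => /andP[].
have bx : `|a + s *: u - x| < d0.
  have -> : a + s *: u = x + s *: u + t *: (s *: v) by rewrite /a addrAC.
  have := nearx 1 t i1 t01; rewrite mul1r -scalerA.
  by rewrite lt_min => /andP[].
have := Hd0 _ _ ax bx.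
have -> : a + s *: u - a = s *: u by rewrite addrAC subrr add0r.
rewrite -(derive_grad _ oU (Ck_derive v Cf) Ux) derive_scale; last first.
  exact: Ck_derivable (Ck_derive v Cf) Ux.
move=> H.
have sn0 : s != 0 by rewrite gt_eqF.
have -> : s ^- 2 * (s * ('D_v f (a + s *: u) - 'D_v f a)) - 'D_u ('D_v f) x
  = s^-1 * ('D_v f (a + s *: u) - 'D_v f a - s * 'D_u ('D_v f) x).
  by field.
rewrite normrM normfV (gtr0_norm s0) ler_pdivrMl //.
apply: le_trans H _; rewrite normrZ (gtr0_norm s0) mulrCA.
rewrite ler_pM2l // -mulrA ler_piMr ?(ltW eps0) //.
by rewrite mulrC ler_pdivrMr // mul1r.
Qed.

Lemma derive_derive_sym f U x u v : open U -> Ck 2 U f -> U x ->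
  'D_u ('D_v f) x = 'D_v ('D_u f) x.
Proof.
move=> oU Cf Ux; apply/eqP; rewrite -subr_eq0 -normr_le0.
suff le_e (e : R) : 0 < e -> `|'D_u ('D_v f) x - 'D_v ('D_u f) x| <= e.
  by apply/ler_addgt0Pl => e e0; rewrite addr0; exact: le_e.
move=> e0.
have e20 : 0 < e / 2 by rewrite divr_gt0.
have [d1 d10 H1] := @second_difference f U x u v oU Cf Ux _ e20.
have [d2 d20 H2] := @second_difference f U x v u oU Cf Ux _ e20.
pose s := Num.min d1 d2 / 2.
have m0 : 0 < Num.min d1 d2 by rewrite lt_min d10.
have s0 : 0 < s by rewrite divr_gt0.
have sm : s < Num.min d1 d2 by rewrite /s ltr_pdivrMr // ltr_pMr // ltr1n.
have := H1 s; have := H2 s; move: sm; rewrite lt_min => /andP[-> ->].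
rewrite s0 => /(_ isT) + /(_ isT).
rewrite [x + s *: v + s *: u]addrAC.
set A := f _; set B := f (_ + _ *: v); set C := f (_ + _ *: u).
have -> : A - B - C + f x = A - C - B + f x by ring.
set T := _ * (A - C - B + f x) => h2 h1.
have shiftT (a b t : R) : a - b = (t - b) - (t - a) by ring.
rewrite (shiftT _ _ T).
apply: le_trans (ler_normB _ _) _.
by apply: le_trans (lerD h2 h1) _; rewrite -splitr.
Qed.

Lemma Ck_comp m k f U (W : set (Cn R m)) (p : Cn R m -> Cn R n) :
  open U -> open W -> (forall y, W y -> U (p y)) ->
  (forall i, Ck k W (rcoord i \o p)) -> Ck k U f -> Ck k W (f \o p).
Proof.
move=> oU oW pU; elim: k f => [|k IH] f Cp Cf.
  split=> // y Wy; apply: continuous_comp; last exact: Ck_continuous Cf (pU y Wy).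
  by apply: continuous_rcoords => i; exact: Ck_continuous (Cp i) Wy.
have C1 k' g (X : set (Cn R n)) : Ck k'.+1 X g -> Ck 1 X g.
  move=> Cg; split; first by move=> ? ?; exact: Ck_continuous Cg _.
  move=> v; split; first by move=> ? ?; exact: Ck_derivable Cg _.
  by split=> // ? ?; apply: Ck_continuous (Ck_derive v Cg) _.
have dfp y v : W y -> is_derive y v (f \o p)
    (\sum_i 'D_v (rcoord i \o p) y * 'D_(rbasis R i) f (p y)).
  move=> Wy; apply: is_derive_comp oU (C1 _ _ _ Cf) (pU y Wy) _ => i.
  by apply: derivableP; exact: Ck_derivable (Cp i) Wy.
have C0 := IH f (fun i => CkS (Cp i)) (CkS Cf).
split=> [y Wy|v]; first exact: Ck_continuous C0 Wy.
split=> [y Wy|]; first by have [] := dfp y v Wy.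
apply: (@eq_Ck _ _ _ _ _ (fun y => \sum_i 'D_v (rcoord i \o p) y * ('D_(rbasis R i) f \o p) y)) => //.
  by move=> y /set_mem Wy; have [_ ->] := dfp y v Wy.
elim: (index_enum _) => [|i s IHs].
  suff -> : (fun y => \sum_(i <- [::]) 'D_v (rcoord i \o p) y * ('D_(rbasis R i) f \o p) y)
    = cst (0 : R) by exact: Ck_cst.
  by apply/funext => y; rewrite big_nil.
under eq_fun do rewrite big_cons.
apply: CkD => //; apply: CkM => //; first exact: Ck_derive (Cp i).
by apply: IH => [j|]; [exact: CkS (Cp j)|exact: Ck_derive Cf].
Qed.

Lemma Ck_rcoord k U i : open U -> Ck k U (@rcoord R n i).
Proof.
move=> oU; case: k => [|k]; first by split=> // x _; exact: rcoord_continuous.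
split=> [x _|v]; first exact: rcoord_continuous.
split=> [x _|]; first by have [] := is_derive_rcoord i x v.
suff -> : 'D_v (@rcoord R n i) = cst (rcoord i v) by exact: Ck_cst.
by apply/funext => x; have [] := is_derive_rcoord i x v.
Qed.

End StrictDerivative.

(** * Wirtinger calculus on C^n *)

Arguments conjc : simpl never.
Arguments rderive : simpl never.
Arguments dz : simpl never.
Arguments dzbar : simpl never.
Arguments coord : simpl never.

Section ComplexDerivative.
Variables (R : realType) (V : normedModType R).
Implicit Types (f g : V -> R[i]) (x v : V) (c d : R[i]).

Lemma ReM (c d : R[i]) :
  complex.Re (c * d) = complex.Re c * complex.Re d - complex.Im c * complex.Im d.
Proof. by case: c d => [a b] [a' b']. Qed.

Lemma ImM (c d : R[i]) :
  complex.Im (c * d) = complex.Re c * complex.Im d + complex.Im c * complex.Re d.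
Proof. by case: c d => [a b] [a' b']. Qed.

Lemma ReD (c d : R[i]) : complex.Re (c + d) = complex.Re c + complex.Re d.
Proof. by case: c d => [a b] [a' b']. Qed.

Lemma ImD (c d : R[i]) : complex.Im (c + d) = complex.Im c + complex.Im d.
Proof. by case: c d => [a b] [a' b']. Qed.

Lemma ReJ (c : R[i]) : complex.Re (conjc c) = complex.Re c.
Proof. by case: c. Qed.

Lemma ImJ (c : R[i]) : complex.Im (conjc c) = - complex.Im c.
Proof. by case: c. Qed.

Lemma conjcD : {morph @conjc R : c d / c + d}.
Proof. by move=> c d; rewrite rmorphD. Qed.

Lemma conjcM : {morph @conjc R : c d / c * d}.
Proof. by move=> c d; rewrite rmorphM. Qed.

Lemma conjc_sum (I : Type) (r : seq I) (P : pred I) (F : I -> R[i]) :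
  conjc (\sum_(i <- r | P i) F i) = \sum_(i <- r | P i) conjc (F i).
Proof. by rewrite rmorph_sum. Qed.

Lemma conjcN (c : R[i]) : conjc (- c) = - conjc c.
Proof. by rewrite rmorphN. Qed.

Lemma conjcB (c d : R[i]) : conjc (c - d) = conjc c - conjc d.
Proof. by rewrite rmorphB. Qed.

Lemma eq_ReIm c d :
  complex.Re c = complex.Re d -> complex.Im c = complex.Im d -> c = d.
Proof. by case: c d => [a b] [a' b'] /= -> ->. Qed.

Definition is_rderive f x v d :=
  is_derive x v (fun y => complex.Re (f y)) (complex.Re d) /\
  is_derive x v (fun y => complex.Im (f y)) (complex.Im d).

Lemma is_rderiveE f x v d : is_rderive f x v d -> rderive v f x = d.
Proof. by case: d => a b [[_ /= Ea] [_ /= Eb]]; rewrite /rderive Ea Eb. Qed.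

Lemma is_rderive_cst c x v : is_rderive (fun=> c) x v 0.
Proof. by split; exact: is_derive_cst. Qed.

Lemma is_rderiveD f g x v c d : is_rderive f x v c -> is_rderive g x v d ->
  is_rderive (fun y => f y + g y) x v (c + d).
Proof.
move=> [f1 f2] [g1 g2]; split.
  by under eq_fun do rewrite ReD; rewrite ReD; exact: is_deriveD.
by under eq_fun do rewrite ImD; rewrite ImD; exact: is_deriveD.
Qed.

Lemma is_rderiveM f g x v c d : is_rderive f x v c -> is_rderive g x v d ->
  is_rderive (fun y => f y * g y) x v (c * g x + f x * d).
Proof.
move=> [f1 f2] [g1 g2]; split.
  under eq_fun do rewrite ReM.
  apply: is_derive_eq (is_deriveB (is_deriveM f1 g1) (is_deriveM f2 g2)) _.
  rewrite ReD !ReM /GRing.scale /=; ring.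
under eq_fun do rewrite ImM.
apply: is_derive_eq (is_deriveD (is_deriveM f1 g2) (is_deriveM f2 g1)) _.
by rewrite ImD !ImM /GRing.scale /=; ring.
Qed.

Lemma is_rderiveJ f x v c : is_rderive f x v c ->
  is_rderive (fun y => conjc (f y)) x v (conjc c).
Proof.
move=> [f1 f2]; split.
  by under eq_fun do rewrite ReJ; rewrite ReJ.
by under eq_fun do rewrite ImJ; rewrite ImJ; exact: is_deriveN.
Qed.

Lemma near_eq_rderive f g x v : (\near x, f x = g x) ->
  rderive v f x = rderive v g x.
Proof.
move=> fg; rewrite /rderive.
have E1 : 'D_v (fun y => complex.Re (f y)) x = 'D_v (fun y => complex.Re (g y)) x.
  by apply: near_eq_derive; apply: filterS fg => z ->.
have E2 : 'D_v (fun y => complex.Im (f y)) x = 'D_v (fun y => complex.Im (g y)) x.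
  by apply: near_eq_derive; apply: filterS fg => z ->.
by rewrite E1 E2.
Qed.

(** Class C^k for complex-valued functions; [smooth] is all of these. *)
Definition CCk k (U : set V) f :=
  Ck k U (fun y => complex.Re (f y)) /\ Ck k U (fun y => complex.Im (f y)).

Lemma CCk_sub k (U W : set V) f : W `<=` U -> CCk k U f -> CCk k W f.
Proof. by move=> WU [f1 f2]; split; apply: Ck_sub WU _. Qed.

Lemma CCkS k (U : set V) f : CCk k.+1 U f -> CCk k U f.
Proof. by move=> [f1 f2]; split; exact: CkS. Qed.

Lemma CCk_rderivable k (U : set V) f x v : CCk k.+1 U f -> U x ->
  is_rderive f x v (rderive v f x).
Proof.
move=> [f1 f2] Ux; split; apply: derivableP.
  exact: Ck_derivable f1 Ux.
exact: Ck_derivable f2 Ux.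
Qed.

Lemma CCk_rderive k (U : set V) f v : CCk k.+1 U f -> CCk k U (rderive v f).
Proof. by move=> [f1 f2]; split; [exact: Ck_derive f1|exact: Ck_derive f2]. Qed.

Lemma eq_CCk k (U : set V) f g : open U -> {in U, f =1 g} ->
  CCk k U g -> CCk k U f.
Proof.
by move=> oU fg [g1 g2]; split; [move: g1|move: g2]; apply: eq_Ck => // x /fg ->.
Qed.

Lemma CCk_local k (U : set V) f :
  (forall x, U x -> exists g W, [/\ open W, W x, {in W, f =1 g} & CCk k W g]) ->
  CCk k U f.
Proof.
move=> H; split; apply: Ck_local => x /H[g [W [oW Wx fg [g1 g2]]]].
  by exists (fun y => complex.Re (g y)), W; split=> // z /fg ->.
by exists (fun y => complex.Im (g y)), W; split=> // z /fg ->.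
Qed.

Lemma CCk_cst k (U : set V) c : CCk k U (fun=> c).
Proof. by split; exact: Ck_cst. Qed.

Lemma CCkD k (U : set V) f g : open U -> CCk k U f -> CCk k U g ->
  CCk k U (fun y => f y + g y).
Proof.
move=> oU [f1 f2] [g1 g2]; split.
  by under eq_fun do rewrite ReD; exact: CkD.
by under eq_fun do rewrite ImD; exact: CkD.
Qed.

Lemma CCkM k (U : set V) f g : open U -> CCk k U f -> CCk k U g ->
  CCk k U (fun y => f y * g y).
Proof.
move=> oU [f1 f2] [g1 g2]; split.
  under eq_fun do rewrite ReM.
  by apply: CkD => //; [exact: CkM|apply: CkN => //; exact: CkM].
by under eq_fun do rewrite ImM; apply: CkD => //; exact: CkM.
Qed.

Lemma CCkJ k (U : set V) f : open U -> CCk k U f ->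
  CCk k U (fun y => conjc (f y)).
Proof.
move=> oU [f1 f2]; split.
  by under eq_fun do rewrite ReJ.
by under eq_fun do rewrite ImJ; exact: CkN.
Qed.

Lemma CCkN k (U : set V) f : open U -> CCk k U f -> CCk k U (fun y => - f y).
Proof.
move=> oU Cf; under eq_fun do rewrite -mulN1r.
by apply: CCkM => //; exact: CCk_cst.
Qed.

Lemma CCkB k (U : set V) f g : open U -> CCk k U f -> CCk k U g ->
  CCk k U (fun y => f y - g y).
Proof. by move=> oU Cf Cg; apply: CCkD => //; exact: CCkN. Qed.

Lemma CCkV k (U : set V) f : open U -> CCk k U f ->
  (forall x, U x -> f x != 0) -> CCk k U (fun y => (f y)^-1).
Proof.
move=> oU [f1 f2] f0.
have Cn2 : Ck k U (fun y => (complex.Re (f y) * complex.Re (f y) +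
    complex.Im (f y) * complex.Im (f y))^-1).
  apply: CkV => // [|x /f0]; first by apply: CkD => //; apply: CkM.
  apply: contra; rewrite -!expr2 paddr_eq0 ?sqr_ge0 // !sqrf_eq0.
  by rewrite eq_complex.
have C1 := CkM oU f1 Cn2.
have C2 := CkM oU (CkN oU f2) Cn2.
split; apply: eq_Ck oU _ (_ : Ck k U _).
- by move=> x _; exact: (erefl (complex.Re (f x)^-1)).
- have -> : (fun y => complex.Re (f y)^-1) = (fun y => complex.Re (f y) *
     (complex.Re (f y) * complex.Re (f y) + complex.Im (f y) * complex.Im (f y))^-1).
    by apply/funext => y; case: (f y) => a b; rewrite /= -!expr2.
  exact: C1.
- by move=> x _; exact: (erefl (complex.Im (f x)^-1)).
- have -> : (fun y => complex.Im (f y)^-1) = (fun y => - complex.Im (f y) *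
     (complex.Re (f y) * complex.Re (f y) + complex.Im (f y) * complex.Im (f y))^-1).
    by apply/funext => y; case: (f y) => a b; rewrite /= -!expr2 mulNr.
  exact: C2.
Qed.

Lemma CCk_sum k (U : set V) (I : Type) (r : seq I) (F : I -> V -> R[i]) :
  open U -> (forall i, CCk k U (F i)) -> CCk k U (fun y => \sum_(i <- r) F i y).
Proof.
move=> oU CF; elim: r => [|i r IH].
  by under eq_fun do rewrite big_nil; exact: CCk_cst.
by under eq_fun do rewrite big_cons; exact: CCkD.
Qed.

End ComplexDerivative.

Section Wirtinger.
Variables (R : realType) (n : nat).
Implicit Types (f g : Cn R n -> R[i]) (U : set (Cn R n)) (x z v : Cn R n).

Local Notation I := (0 +i* 1 : R[i]).

Lemma ImulI : I * I = -1.
Proof. by apply: eq_ReIm; rewrite /= ?mul0r ?mulr0 ?mulr1 ?sub0r ?addr0 ?oppr0. Qed.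

Definition e1 (k : 'I_n) : Cn R n := (delta_mx ord0 k, 0).
Definition e2 (k : 'I_n) : Cn R n := (0, delta_mx ord0 k).

Lemma dzE k f z : dz k f z = (rderive (e1 k) f z - I * rderive (e2 k) f z) / 2%:R.
Proof. by []. Qed.

Lemma dzbarE k f z :
  dzbar k f z = (rderive (e1 k) f z + I * rderive (e2 k) f z) / 2%:R.
Proof. by []. Qed.

Lemma conjcI : conjc I = - I.
Proof. by apply: eq_ReIm; rewrite /= ?oppr0. Qed.

Lemma conjc_dzbarE k f z : conjc (dzbar k f z) =
  (conjc (rderive (e1 k) f z) - I * conjc (rderive (e2 k) f z)) / 2%:R.
Proof.
by rewrite dzbarE conjcM conjcD (conjcM I) conjcI mulNr conjc_inv conjc_nat.
Qed.

Lemma conjc_dzE k f z : conjc (dz k f z) =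
  (conjc (rderive (e1 k) f z) + I * conjc (rderive (e2 k) f z)) / 2%:R.
Proof.
by rewrite dzE conjcM conjcB (conjcM I) conjcI mulNr opprK conjc_inv conjc_nat.
Qed.

Lemma two_neq0 : 2%:R != 0 :> R[i].
Proof. by rewrite pnatr_eq0. Qed.

Lemma near_eq_dz k f g z : (\near z, f z = g z) -> dz k f z = dz k g z.
Proof. by move=> fg; rewrite !dzE !(near_eq_rderive _ fg). Qed.

Lemma near_eq_dzbar k f g z : (\near z, f z = g z) -> dzbar k f z = dzbar k g z.
Proof. by move=> fg; rewrite !dzbarE !(near_eq_rderive _ fg). Qed.

Lemma CCk_dz k j U f : open U -> CCk k.+1 U f -> CCk k U (dz j f).
Proof.
move=> oU Cf; rewrite /dz; apply: CCkM => //; last exact: CCk_cst.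
apply: CCkB => //; first exact: CCk_rderive.
by apply: CCkM; [|exact: CCk_cst|exact: CCk_rderive].
Qed.

Lemma CCk_dzbar k j U f : open U -> CCk k.+1 U f -> CCk k U (dzbar j f).
Proof.
move=> oU Cf; rewrite /dzbar; apply: CCkM => //; last exact: CCk_cst.
apply: CCkD => //; first exact: CCk_rderive.
by apply: CCkM; [|exact: CCk_cst|exact: CCk_rderive].
Qed.

Section OneStar.
Variables (U : set (Cn R n)) (z : Cn R n).
Hypotheses (oU : open U) (Uz : U z).

Let C1r f v : CCk 1 U f -> is_rderive f z v (rderive v f z).
Proof. by move=> Cf; exact: CCk_rderivable Cf Uz. Qed.

Lemma rderive_cst c v : rderive v (fun=> c) z = 0 :> R[i].
Proof. exact: is_rderiveE (is_rderive_cst c z v). Qed.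

Lemma dz_cst k (c : R[i]) : dz k (fun=> c) z = 0.
Proof. by rewrite dzE !rderive_cst mulr0 subr0 mul0r. Qed.

Lemma dzbar_cst k (c : R[i]) : dzbar k (fun=> c) z = 0.
Proof. by rewrite dzbarE !rderive_cst mulr0 addr0 mul0r. Qed.

Lemma dzD k f g : CCk 1 U f -> CCk 1 U g ->
  dz k (fun y => f y + g y) z = dz k f z + dz k g z.
Proof using oU Uz.
move=> Cf Cg.
rewrite !dzE !(is_rderiveE (is_rderiveD (C1r _ Cf) (C1r _ Cg))).
move: (rderive (e1 k) f z) (rderive (e2 k) f z) (rderive (e1 k) g z) (rderive (e2 k) g z) (f z) (g z) => *; ring.
Qed.

Lemma dzbarD k f g : CCk 1 U f -> CCk 1 U g ->
  dzbar k (fun y => f y + g y) z = dzbar k f z + dzbar k g z.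
Proof using oU Uz.
move=> Cf Cg.
rewrite !dzbarE !(is_rderiveE (is_rderiveD (C1r _ Cf) (C1r _ Cg))).
move: (rderive (e1 k) f z) (rderive (e2 k) f z) (rderive (e1 k) g z) (rderive (e2 k) g z) (f z) (g z) => *; ring.
Qed.

Lemma dzM k f g : CCk 1 U f -> CCk 1 U g ->
  dz k (fun y => f y * g y) z = dz k f z * g z + f z * dz k g z.
Proof using oU Uz.
move=> Cf Cg.
rewrite !dzE !(is_rderiveE (is_rderiveM (C1r _ Cf) (C1r _ Cg))).
move: (rderive (e1 k) f z) (rderive (e2 k) f z) (rderive (e1 k) g z) (rderive (e2 k) g z) (f z) (g z) => *; ring.
Qed.

Lemma dzbarM k f g : CCk 1 U f -> CCk 1 U g ->
  dzbar k (fun y => f y * g y) z = dzbar k f z * g z + f z * dzbar k g z.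
Proof using oU Uz.
move=> Cf Cg.
rewrite !dzbarE !(is_rderiveE (is_rderiveM (C1r _ Cf) (C1r _ Cg))).
move: (rderive (e1 k) f z) (rderive (e2 k) f z) (rderive (e1 k) g z) (rderive (e2 k) g z) (f z) (g z) => *; ring.
Qed.

Lemma dzJ k f : CCk 1 U f -> dz k (fun y => conjc (f y)) z = conjc (dzbar k f z).
Proof using oU Uz.
by move=> Cf; rewrite conjc_dzbarE dzE !(is_rderiveE (is_rderiveJ (C1r _ Cf))).
Qed.

Lemma dzbarJ k f : CCk 1 U f -> dzbar k (fun y => conjc (f y)) z = conjc (dz k f z).
Proof using oU Uz.
by move=> Cf; rewrite conjc_dzE dzbarE !(is_rderiveE (is_rderiveJ (C1r _ Cf))).
Qed.

Lemma dz_sum k (J : Type) (r : seq J) (F : J -> Cn R n -> R[i]) :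
  (forall j, CCk 1 U (F j)) ->
  dz k (fun y => \sum_(j <- r) F j y) z = \sum_(j <- r) dz k (F j) z.
Proof using oU Uz.
move=> CF; elim: r => [|j r IH].
  by rewrite big_nil; under eq_fun do rewrite big_nil; exact: dz_cst.
by rewrite big_cons; under eq_fun do rewrite big_cons; rewrite dzD ?IH //; exact: CCk_sum.
Qed.

Lemma dzbar_sum k (J : Type) (r : seq J) (F : J -> Cn R n -> R[i]) :
  (forall j, CCk 1 U (F j)) ->
  dzbar k (fun y => \sum_(j <- r) F j y) z = \sum_(j <- r) dzbar k (F j) z.
Proof using oU Uz.
move=> CF; elim: r => [|j r IH].
  by rewrite big_nil; under eq_fun do rewrite big_nil; exact: dzbar_cst.
by rewrite big_cons; under eq_fun do rewrite big_cons; rewrite dzbarD ?IH //; exact: CCk_sum.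
Qed.

Lemma rderive_sym f v w : CCk 2 U f ->
  rderive v (rderive w f) z = rderive w (rderive v f) z.
Proof using oU Uz.
move=> [f1 f2]; apply: eq_ReIm.
  exact: (derive_derive_sym v w oU f1 Uz).
exact: (derive_derive_sym v w oU f2 Uz).
Qed.

Let dz_dzbar_alg (a b c d a' b' c' d' j h : R[i]) :
  a = a' -> b = b' -> c = c' -> d = d' ->
  ((a + j * b) * h - j * ((c + j * d) * h)) * h =
  ((a' + - j * c') * h + j * ((b' + - j * d') * h)) * h.
Proof. by move=> -> -> -> ->; ring. Qed.

Lemma dz_dzbar k l f : CCk 2 U f -> dz k (dzbar l f) z = dzbar l (dz k f) z.
Proof using oU Uz.
move=> Cf; have Cr v : CCk 1 U (rderive v f) by exact: CCk_rderive.
have Ccst (c : R[i]) : CCk 1 U (fun=> c) by exact: CCk_cst.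
have lin (c : R[i]) v w u : rderive u (fun y => (rderive v f y + c * rderive w f y) / 2%:R) z =
   (rderive u (rderive v f) z + c * rderive u (rderive w f) z) / 2%:R.
  have H := is_rderiveM (is_rderiveD (C1r u (Cr v))
    (is_rderiveM (C1r u (Ccst c)) (C1r u (Cr w)))) (C1r u (Ccst (2%:R^-1))).
  by rewrite (is_rderiveE H) !rderive_cst mulr0 addr0 mul0r add0r.
have E1 : dzbar l f = fun y => (rderive (e1 l) f y + I * rderive (e2 l) f y) / 2%:R by [].
have E2 : dz k f = fun y => (rderive (e1 k) f y + (- I) * rderive (e2 k) f y) / 2%:R.
  by apply/funext => y; rewrite dzE mulNr.
rewrite dzE E1 dzbarE E2 !lin.
by apply: dz_dzbar_alg; exact: rderive_sym.
Qed.

End OneStar.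

Lemma is_rderive_coord (a : 'I_n) z v : is_rderive (coord a) z v (coord a v).
Proof.
split; first exact: (is_derive_rcoord (inl a)).
exact: (is_derive_rcoord (inr a)).
Qed.

Lemma CCk_coord k (a : 'I_n) U : open U -> CCk k U (@coord R n a).
Proof.
by move=> oU; split; [exact: (Ck_rcoord k (inl a) oU)|exact: (Ck_rcoord k (inr a) oU)].
Qed.

Lemma dz_coord k a z : dz k (coord a) z = (k == a)%:R.
Proof.
rewrite dzE !(is_rderiveE (is_rderive_coord _ _ _)) /coord /e1 /e2 /= !mxE !eqxx /=.
rewrite eq_sym; case: eqP => _ /=.
  have -> : 1 +i* 0 - I * (0 +i* 1) = 2%:R :> R[i].
    by rewrite ImulI opprK; apply: eq_ReIm; rewrite /= ?addr0.
  by rewrite divff // two_neq0.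
by rewrite -[0 +i* 0]/(0 : R[i]) mulr0 ?subr0 ?addr0 mul0r.
Qed.

Lemma dzbar_coord k a z : dzbar k (coord a) z = 0.
Proof.
rewrite dzbarE !(is_rderiveE (is_rderive_coord _ _ _)) /coord /e1 /e2 /= !mxE !eqxx /=.
rewrite eq_sym; case: eqP => _ /=.
  by rewrite ImulI -[1 +i* 0]/(1 : R[i]) subrr mul0r.
by rewrite -[0 +i* 0]/(0 : R[i]) mulr0 ?subr0 ?addr0 mul0r.
Qed.

End Wirtinger.

Section ComplexChainRule.
Variables (R : realType) (n m : nat).
Implicit Types (G : Cn R n -> R[i]) (U : set (Cn R n)) (W : set (Cn R m)).
Implicit Types (F : Cn R m -> Cn R n).

Lemma CCk_comp k G U W F : open U -> open W -> (forall y, W y -> U (F y)) ->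
  (forall a, CCk k W (fun y => coord a (F y))) -> CCk k U G ->
  CCk k W (fun y => G (F y)).
Proof.
move=> oU oW FU CF [G1 G2].
have CrF i : Ck k W (rcoord i \o F).
  by case: i => a; have [F1 F2] := CF a.
by split; [exact: (Ck_comp oU oW FU CrF G1)|exact: (Ck_comp oU oW FU CrF G2)].
Qed.

Let wirtinger_comp_alg (A B u v cu cv c h : R[i]) :
  (A * u + B * cu - c * (A * v + B * cv)) * h =
  A * ((u - c * v) * h) + B * ((cu - c * cv) * h).
Proof. by ring. Qed.

Let wirtinger_comp_alg' (A B u v cu cv c h : R[i]) :
  (A * u + B * cu + c * (A * v + B * cv)) * h =
  A * ((u + c * v) * h) + B * ((cu + c * cv) * h).
Proof. by ring. Qed.

Let wirtinger_real_alg (p q : R) (c d : R[i]) :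
  (p * complex.Re c + q * complex.Re d) +i* (p * complex.Im c + q * complex.Im d)
  = (c - (0 +i* 1) * d) / 2%:R * (p +i* q) +
    (c + (0 +i* 1) * d) / 2%:R * conjc (p +i* q).
Proof.
case: c d => [a1 b1] [a2 b2] /=.
have -> : conjc (p +i* q) = p -i* q by [].
have -> : (a1 +i* b1 - (0 +i* 1) * (a2 +i* b2)) / 2%:R * (p +i* q) +
  (a1 +i* b1 + (0 +i* 1) * (a2 +i* b2)) / 2%:R * (p -i* q)
  = (a1 +i* b1) * ((p +i* q) + (p -i* q)) / 2%:R -
    (0 +i* 1) * (a2 +i* b2) * ((p +i* q) - (p -i* q)) / 2%:R by ring.
have -> : (p +i* q) + (p -i* q) = (p +i* 0) * 2%:R :> R[i].
  by apply: eq_ReIm => /=; ring.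
have -> : (p +i* q) - (p -i* q) = (0 +i* q) * 2%:R :> R[i].
  by apply: eq_ReIm => /=; ring.
rewrite !mulrA !mulfK ?two_neq0 //.
by apply: eq_ReIm => /=; ring.
Qed.

(** The differential of [G], a real linear map, is the sum of a complex linear one
    with coefficients [dz a G] and a conjugate linear one with coefficients
    [dzbar a G]. *)
Lemma rderive_comp G U W F y v : open U -> open W -> (forall y, W y -> U (F y)) ->
  (forall a, CCk 1 W (fun y => coord a (F y))) -> CCk 1 U G -> W y ->
  rderive v (fun y => G (F y)) y =
  \sum_a (dz a G (F y) * rderive v (fun y => coord a (F y)) y +
          dzbar a G (F y) * conjc (rderive v (fun y => coord a (F y)) y)).
Proof.
move=> oU oW FU CF CG Wy.
pose w (i : 'I_n + 'I_n) := 'D_v (rcoord i \o F) y.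
have dF i : is_derive y v (rcoord i \o F) (w i).
  apply: derivableP; case: i => a; have [F1 F2] := CF a.
    exact: Ck_derivable F1 Wy.
  exact: Ck_derivable F2 Wy.
have [G1 G2] := CG.
have [_ E1] := is_derive_comp oU G1 (FU _ Wy) dF.
have [_ E2] := is_derive_comp oU G2 (FU _ Wy) dF.
rewrite {1}/rderive [X in X +i* _]E1 [X in _ +i* X]E2 {E1 E2}.
rewrite !big_sumType /=.
have sumRI (p q : 'I_n -> R) : (\sum_a p a) +i* (\sum_a q a) = \sum_a (p a +i* q a).
  by apply: eq_ReIm => /=; elim/big_rec2: _ => [//|a x y' _ ->]; rewrite ?ReD ?ImD.
rewrite -!big_split sumRI; apply: eq_bigr => a _.
change (rderive v (fun y => coord a (F y)) y) with (w (inl a) +i* w (inr a)).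
rewrite dzE dzbarE.
set x1 := rderive (e1 _ a) G _; set x2 := rderive (e2 _ a) G _.
exact: wirtinger_real_alg (w (inl a)) (w (inr a)) x1 x2.
Qed.

Lemma dz_comp G U W F y k : open U -> open W -> (forall y, W y -> U (F y)) ->
  (forall a, CCk 1 W (fun y => coord a (F y))) -> CCk 1 U G -> W y ->
  dz k (fun y => G (F y)) y =
  \sum_a (dz a G (F y) * dz k (fun y => coord a (F y)) y +
          dzbar a G (F y) * conjc (dzbar k (fun y => coord a (F y)) y)).
Proof.
move=> oU oW FU CF CG Wy.
rewrite dzE !(rderive_comp _ oU oW FU CF CG Wy) mulr_sumr -sumrB mulr_suml.
apply: eq_bigr => a _.
rewrite conjc_dzbarE [X in _ = _ * X + _]dzE; exact: wirtinger_comp_alg.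
Qed.

Lemma dzbar_comp G U W F y k : open U -> open W -> (forall y, W y -> U (F y)) ->
  (forall a, CCk 1 W (fun y => coord a (F y))) -> CCk 1 U G -> W y ->
  dzbar k (fun y => G (F y)) y =
  \sum_a (dz a G (F y) * dzbar k (fun y => coord a (F y)) y +
          dzbar a G (F y) * conjc (dz k (fun y => coord a (F y)) y)).
Proof.
move=> oU oW FU CF CG Wy.
rewrite dzbarE !(rderive_comp _ oU oW FU CF CG Wy) mulr_sumr -big_split mulr_suml.
apply: eq_bigr => a _.
rewrite conjc_dzE [X in _ = _ * X + _]dzbarE; exact: wirtinger_comp_alg'.
Qed.

End ComplexChainRule.

(** * Matrices of C^k functions *)

(** [P] stands for a class of functions closed under the ring operations. *)
Section MatrixClosure.
Variables (R : realType) (T : Type) (P : (T -> R[i]) -> Prop).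
Hypothesis Pcst : forall c, P (fun=> c).
Hypothesis PD : forall f g, P f -> P g -> P (fun y => f y + g y).
Hypothesis PM : forall f g, P f -> P g -> P (fun y => f y * g y).

Lemma closed_sum (I : Type) (r : seq I) (F : I -> T -> R[i]) :
  (forall i, P (F i)) -> P (fun y => \sum_(i <- r) F i y).
Proof.
move=> PF; elim: r => [|i r IH].
  by under eq_fun do rewrite big_nil.
by under eq_fun do rewrite big_cons; exact: PD.
Qed.

Lemma closed_prod (I : Type) (r : seq I) (F : I -> T -> R[i]) :
  (forall i, P (F i)) -> P (fun y => \prod_(i <- r) F i y).
Proof.
move=> PF; elim: r => [|i r IH].
  by under eq_fun do rewrite big_nil.
by under eq_fun do rewrite big_cons; exact: PM.
Qed.

Lemma closed_det n (M : T -> 'M[R[i]]_n) :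
  (forall i j, P (fun y => M y i j)) -> P (fun y => \det (M y)).
Proof.
by move=> PMM; apply: closed_sum => s; apply: PM => //; exact: closed_prod.
Qed.

Lemma closed_adj n (M : T -> 'M[R[i]]_n) i j :
  (forall i j, P (fun y => M y i j)) -> P (fun y => \adj (M y) i j).
Proof.
move=> PMM; under eq_fun do rewrite mxE.
apply: PM => //; apply: closed_det => k l.
by under eq_fun do rewrite !mxE.
Qed.

End MatrixClosure.

Section SmoothMatrices.
Variables (R : realType) (V : normedModType R) (k : nat) (U : set V).
Hypothesis oU : open U.

Lemma CCk_det n (M : V -> 'M[R[i]]_n) :
  (forall i j, CCk k U (fun y => M y i j)) -> CCk k U (fun y => \det (M y)).
Proof.
apply: (closed_det (P := CCk k U)) => [c|f g|f g].
- exact: CCk_cst.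
- exact: CCkD.
- exact: CCkM.
Qed.

Lemma CCk_invmx n (M : V -> 'M[R[i]]_n) i j :
  (forall y, U y -> M y \in unitmx) ->
  (forall i j, CCk k U (fun y => M y i j)) ->
  CCk k U (fun y => invmx (M y) i j).
Proof.
move=> uM CM.
have C1 : CCk k U (fun y => (\det (M y))^-1 * \adj (M y) i j).
  apply: CCkM => //.
    by apply: CCkV oU (CCk_det CM) _ => y /uM; rewrite unitmxE unitfE.
  apply: (closed_adj (P := CCk k U)) => // [c|f g|f g].
  - exact: CCk_cst.
  - exact: CCkD.
  - exact: CCkM.
apply: eq_CCk oU _ C1 => y /set_mem Uy.
by rewrite /invmx uM // mxE.
Qed.

End SmoothMatrices.

(** * Complex linear maps *)

Section ComplexLinear.
Variable (R : realType).

Definition cvec n (z : Cn R n) : 'cV[R[i]]_n := \col_k coord k z.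

Definition rvec n (v : 'cV[R[i]]_n) : Cn R n :=
  (\row_k complex.Re (v k ord0), \row_k complex.Im (v k ord0)).

Definition clin n m (A : 'M[R[i]]_(m, n)) (z : Cn R n) : Cn R m :=
  rvec (A *m cvec z).

Lemma coord_rvec n (v : 'cV[R[i]]_n) k : coord k (rvec v) = v k ord0.
Proof. by rewrite /coord /rvec /= !mxE; case: (v k ord0). Qed.

Lemma rvecK n : cancel (@rvec n) (@cvec n).
Proof.
by move=> v; apply/matrixP => k j; rewrite mxE coord_rvec (ord1 j).
Qed.

Lemma eq_coord n (x y : Cn R n) : (forall k, coord k x = coord k y) -> x = y.
Proof.
case: x y => [x1 x2] [y1 y2] E; congr (_, _); apply/rowP => k.
  by have := congr1 (@complex.Re R) (E k).
by have := congr1 (@complex.Im R) (E k).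
Qed.

Lemma cvecK n : cancel (@cvec n) (@rvec n).
Proof. by move=> z; apply: eq_coord => k; rewrite coord_rvec mxE. Qed.

Lemma rvec0 n : rvec (0 : 'cV[R[i]]_n) = 0.
Proof. by apply: eq_coord => k; rewrite coord_rvec mxE; apply: eq_ReIm; rewrite /coord /= mxE. Qed.

Lemma coordD n k (x y : Cn R n) : coord k (x + y) = coord k x + coord k y.
Proof. by apply: eq_ReIm; rewrite /coord /= mxE. Qed.

Lemma coordN n k (x : Cn R n) : coord k (- x) = - coord k x.
Proof. by apply: eq_ReIm; rewrite /coord /= mxE. Qed.

Lemma coordB n k (x y : Cn R n) : coord k (x - y) = coord k x - coord k y.
Proof. by rewrite coordD coordN. Qed.

Lemma coordZ n k (c : R) (x : Cn R n) : coord k (c *: x) = c%:C * coord k x.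
Proof. by apply: eq_ReIm; rewrite /coord /= mxE; ring. Qed.

Lemma cvecD n (x y : Cn R n) : cvec (x + y) = cvec x + cvec y.
Proof. by apply/matrixP => k j; rewrite !mxE coordD. Qed.

Lemma cvecB n (x y : Cn R n) : cvec (x - y) = cvec x - cvec y.
Proof. by apply/matrixP => k j; rewrite !mxE coordB. Qed.

Lemma cvecZ n (c : R) (x : Cn R n) : cvec (c *: x) = c%:C *: cvec x.
Proof. by apply/matrixP => k j; rewrite !mxE coordZ. Qed.

Lemma coord_clin n m (A : 'M[R[i]]_(m, n)) z a :
  coord a (clin A z) = \sum_k A a k * coord k z.
Proof. by rewrite coord_rvec mxE; apply: eq_bigr => k _; rewrite mxE. Qed.

Lemma clinD n m (A : 'M[R[i]]_(m, n)) x y : clin A (x + y) = clin A x + clin A y.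
Proof.
by apply: eq_coord => a; rewrite coordD !coord_rvec cvecD mulmxDr mxE.
Qed.

Lemma clinB n m (A : 'M[R[i]]_(m, n)) x y : clin A (x - y) = clin A x - clin A y.
Proof.
by apply: eq_coord => a; rewrite coordB !coord_rvec cvecB mulmxBr !mxE.
Qed.

Lemma clinZ n m (A : 'M[R[i]]_(m, n)) (c : R) x : clin A (c *: x) = c *: clin A x.
Proof.
by apply: eq_coord => a; rewrite coordZ !coord_rvec cvecZ -scalemxAr mxE.
Qed.

Lemma clinM n m p (A : 'M[R[i]]_(m, n)) (B : 'M[R[i]]_(p, m)) z :
  clin B (clin A z) = clin (B *m A) z.
Proof. by rewrite /clin rvecK mulmxA. Qed.

Lemma clin1 n (z : Cn R n) : clin 1%:M z = z.
Proof. by rewrite /clin mul1mx cvecK. Qed.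

Lemma CCk_clin n m (A : 'M[R[i]]_(m, n)) k (U : set (Cn R n)) a : open U ->
  CCk k U (fun z => coord a (clin A z)).
Proof.
move=> oU; under eq_fun do rewrite coord_clin.
by apply: CCk_sum => // j; apply: CCkM => //; [exact: CCk_cst|exact: CCk_coord].
Qed.

Lemma dz_clin n m (A : 'M[R[i]]_(m, n)) z a k :
  dz k (fun z => coord a (clin A z)) z = A a k.
Proof.
under eq_fun do rewrite coord_clin.
have oT : open [set: Cn R n] by exact: openT.
have Cc j : CCk 1 [set: Cn R n] (coord j) by exact: CCk_coord.
rewrite (dz_sum oT I) => [|j]; last by apply: CCkM => //; exact: CCk_cst.
rewrite (bigD1 k) //= big1 => [|j jk].
  rewrite addr0 (dzM oT I) //; last exact: CCk_cst.
  by rewrite dz_cst mul0r add0r dz_coord eqxx mulr1.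
rewrite (dzM oT I) //; last exact: CCk_cst.
by rewrite dz_cst mul0r add0r dz_coord eq_sym (negbTE jk) mulr0.
Qed.

Lemma dzbar_clin n m (A : 'M[R[i]]_(m, n)) z a k :
  dzbar k (fun z => coord a (clin A z)) z = 0.
Proof.
under eq_fun do rewrite coord_clin.
have oT : open [set: Cn R n] by exact: openT.
have Cc j : CCk 1 [set: Cn R n] (coord j) by exact: CCk_coord.
rewrite (dzbar_sum oT I) => [|j]; last by apply: CCkM => //; exact: CCk_cst.
rewrite big1 // => j _.
rewrite (dzbarM oT I) //; last exact: CCk_cst.
by rewrite dzbar_cst mul0r add0r dzbar_coord mulr0.
Qed.

Lemma clin_holomorphic n m (A : 'M[R[i]]_(m, n)) (U : set (Cn R n)) :
  open U -> holomorphic_on U (clin A).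
Proof.
move=> oU a; split=> [k|k z _]; first exact: CCk_clin.
exact: dzbar_clin.
Qed.

Lemma holomorphic_continuous n m (F : Cn R n -> Cn R m) (W : set (Cn R n)) z :
  holomorphic_on W F -> W z -> {for z, continuous F}.
Proof.
move=> hF Wz; apply: continuous_rcoords => -[] a; have [sF _] := hF a.
  by have [C _] := sF 0%N; exact: Ck_continuous C Wz.
by have [_ C] := sF 0%N; exact: Ck_continuous C Wz.
Qed.

Lemma jacobian_clin n m (A : 'M[R[i]]_(m, n)) z : jacobian (clin A) z = A.
Proof. by apply/matrixP => a k; rewrite mxE -(dz_clin A z a k). Qed.

End ComplexLinear.

(** * The holomorphic inverse function theorem *)

Section InverseFunction.
Variables (R : realType).

Lemma positive_min (I : finType) (P : I -> R -> Prop) :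
  (forall i d d', 0 < d' -> d' <= d -> P i d -> P i d') ->
  (forall i, exists2 d, 0 < d & P i d) ->
  exists2 d, 0 < d & forall i, P i d.
Proof.
move=> Pmono Pex.
suff [d d0 Hd] : exists2 d, 0 < d & forall i, i \in index_enum I -> P i d.
  by exists d => // i; apply: Hd; rewrite mem_index_enum.
elim: (index_enum I) => [|i s [d d0 Hd]]; first by exists 1.
have [d' d'0 Hd'] := Pex i.
have m0 : 0 < Num.min d d' by rewrite lt_min d0.
exists (Num.min d d') => // j; rewrite inE => /orP[/eqP ->|js].
  by apply: Pmono m0 _ Hd'; rewrite ge_min lexx orbT.
by apply: Pmono m0 _ (Hd _ js); rewrite ge_min lexx.
Qed.

Lemma rderive_lin n (f : Cn R n -> R[i]) U x v : open U -> CCk 1 U f -> U x ->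
  rderive v f x =
  \sum_a (dz a f x * coord a v + dzbar a f x * conjc (coord a v)).
Proof.
move=> oU Cf Ux; have -> : rderive v f x = rderive v (fun y => f (id y)) x by [].
rewrite (rderive_comp v oU oU (fun _ => id) _ Cf Ux) => [|a]; last exact: CCk_coord.
apply: eq_bigr => a _; rewrite (_ : (fun y => coord a (id y)) = coord a) //.
by rewrite (is_rderiveE (is_rderive_coord a x v)).
Qed.

Variables (n : nat).

Lemma holomorphic_rderive m (F : Cn R n -> Cn R m) W z v a : open W ->
  holomorphic_on W F -> W z ->
  rderive v (fun y => coord a (F y)) z = coord a (clin (jacobian F z) v).
Proof.
move=> oW hF Wz; have [sF dF] := hF a.
rewrite (rderive_lin v oW (sF 1%N) Wz) coord_clin; apply: eq_bigr => k _.
by rewrite mxE (dF k z Wz) mul0r addr0.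
Qed.

Lemma sub_swap (V : zmodType) (x y z t : V) : (x - y) - (z - t) = (x - z) - (y - t).
Proof. by rewrite !opprD !opprK addrACA. Qed.

Lemma near_norm_lt (V : normedModType R) (z : V) (e : R) : 0 < e ->
  \forall t \near z, `|z - t| < e.
Proof. by move=> e0; apply/nbhs_normP; exists e. Qed.

Lemma holomorphic_strict m (F : Cn R n -> Cn R m) W z : open W ->
  holomorphic_on W F -> W z -> forall eps : R, 0 < eps ->
  exists2 d : R, 0 < d & forall a b, `|a - z| < d -> `|b - z| < d ->
    `|F b - F a - clin (jacobian F z) (b - a)| <= eps * `|b - a|.
Proof.
move=> oW hF Wz eps eps0.
have [|i|d d0 Hd] := @positive_min ('I_m + 'I_m)%type (fun i d => forall a b,
    `|a - z| < d -> `|b - z| < d ->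
    `|rcoord i (F b - F a - clin (jacobian F z) (b - a))| <= eps * `|b - a|).
- by move=> i d d' _ d'd H a b az bz; apply: H; exact: lt_le_trans d'd.
- have [C gE] : Ck 1 W (rcoord i \o F) /\ forall v,
      grad (rcoord i \o F) z v = rcoord i (clin (jacobian F z) v).
    case: i => a; have [sF dF] := hF a; have [C1 C2] := sF 1%N; split=> // v.
      rewrite -(derive_grad v oW C1 Wz).
      exact: (congr1 (@complex.Re R) (holomorphic_rderive v a oW hF Wz)).
    rewrite -(derive_grad v oW C2 Wz).
    exact: (congr1 (@complex.Im R) (holomorphic_rderive v a oW hF Wz)).
  have [d d0 Hd] := strictly_differentiable oW C Wz eps0.
  exists d => // a b az bz; rewrite !rcoordB -gE; exact: Hd.
- exists d => // a b az bz; apply: norm_le_rcoord => [|i]; last exact: Hd.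
  by rewrite mulr_ge0 // ltW.
Qed.

Lemma compact_ball (z0 : Cn R n) (r : R) : 0 < r ->
  compact [set z : Cn R n | `|z0 - z| <= r].
Proof.
move=> r0.
have cpt (v0 : 'rV[R]_n) : compact [set v | `|v0 - v| <= r].
  apply: bounded_closed_compact.
    rewrite /bounded_near /=; near=> M => v /= vr.
    apply: (@le_trans _ _ (`|v0| + r)); last by near: M; apply: nbhs_pinfty_ge; exact: num_real.
    have -> : v = v0 - (v0 - v) by rewrite opprB addrC subrK.
    by apply: le_trans (ler_normB _ _) _; rewrite lerD2l.
  have -> : [set v | `|v0 - v| <= r] = closed_ball v0 r by rewrite closed_ballE.
  exact: closed_ball_closed.
have -> : [set z : Cn R n | `|z0 - z| <= r] =
    [set v | `|z0.1 - v| <= r] `*` [set v | `|z0.2 - v| <= r].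
  apply/seteqP; split=> z /=.
    by rewrite prod_normE ge_max => /andP[].
  by move=> [z1 z2]; rewrite prod_normE ge_max; apply/andP.
exact: compact_setX.
Unshelve. all: by end_near. Qed.

(** A perturbation of the identity by a 1/2-Lipschitz map is onto. Iterating is
    avoided: the displacement [|y - F z|] attains its minimum on the closed ball,
    and one step of the contraction would halve it. *)
Lemma perturbation_onto (F : Cn R n -> Cn R n) z0 (d r : R) :
  0 < r -> r < d ->
  (forall a b, `|a - z0| < d -> `|b - z0| < d ->
     `|(F b - b) - (F a - a)| <= 2^-1 * `|b - a|) ->
  forall y, `|y - F z0| < r / 2 -> exists2 z, `|z - z0| < r & F z = y.
Proof.
move=> r0 rd HF y yr.
pose K := [set z : Cn R n | `|z0 - z| <= r].
have K0 : K !=set0 by exists z0; rewrite /K /= subrr normr0 ltW.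
have Kd z : K z -> `|z - z0| < d.
  by rewrite /K /= distrC => zr; exact: le_lt_trans rd.
pose T z := y - (F z - z).
have TK z : K z -> `|T z - z0| < r.
  move=> Kz; have -> : T z - z0 = (y - F z0) - ((F z - z) - (F z0 - z0)).
    rewrite /T; apply: eq_rcoord => i; rewrite !rcoordB; ring.
  apply: le_lt_trans (ler_normB _ _) _.
  rewrite [ltRHS](splitr r); apply: ltr_leD => //.
  apply: le_trans (HF _ _ _ (Kd z Kz)) _.
    by rewrite subrr normr0 (lt_trans r0).
  by rewrite mulrC ler_pM2r ?invr_gt0 // distrC.
have cF : {within K, continuous (fun z => `|y - F z|)}.
  apply: continuous_in_subspaceT => z /set_mem Kz.
  have zd : 0 < d - `|z - z0| by rewrite subr_gt0 Kd.
  apply/cvgrPdist_lt => /= e e0; near=> t.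
  apply: le_lt_trans (ler_dist_dist _ _) _.
  have -> : y - F z - (y - F t) = (F t - t) - (F z - z) + (t - z).
    apply: eq_rcoord => i; rewrite rcoordD !rcoordB; ring.
  have tz : `|t - z| < e / 2 by rewrite distrC; near: t; apply: (@near_norm_lt (Cn R n) z); rewrite divr_gt0.
  apply: le_lt_trans (ler_normD _ _) _.
  rewrite (splitr e); apply: ler_ltD => //.
  apply: le_trans (HF _ _ (Kd z Kz) _) _.
    have -> : t - z0 = (t - z) + (z - z0) by rewrite addrA subrK.
    apply: le_lt_trans (ler_normD _ _) _; rewrite -ltrBrDr distrC.
    by near: t; exact: (@near_norm_lt (Cn R n) z _ zd).
  by apply: le_trans (ltW tz); rewrite ler_piMl // invf_le1 // ler1n.
have [z /set_mem Kz zmin] := compact_EVT_min K0 (compact_ball r0) cF.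
have FzE : F z = y.
  apply/eqP; rewrite eq_sym -subr_eq0 -normr_le0 leNgt; apply/negP => pos.
  have KT : K (T z) by rewrite /K /= distrC ltW // TK.
  have := zmin (T z); rewrite inE => /(_ KT); apply/negP; rewrite -ltNge.
  have -> : y - F (T z) = (F z - z) - (F (T z) - T z).
    rewrite /T; apply: eq_rcoord => i; rewrite !rcoordB; ring.
  rewrite distrC; apply: le_lt_trans (HF _ _ (Kd z Kz) (Kd _ KT)) _.
  have -> : T z - z = y - F z.
    rewrite /T; apply: eq_rcoord => i; rewrite !rcoordB; ring.
  by rewrite gtr_pMl // invf_lt1 // ltr1n.
exists z => //; have := TK z Kz.
by rewrite /T FzE subKr.
Unshelve. all: by end_near. Qed.

(** Near [z0] the map is within 1/2-Lipschitz distance of the identity, hence a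
    homeomorphism onto a ball. The derivative of the inverse [G] is the inverse
    matrix of the derivative of [F] at [G]; this formula shows that [G] gains one
    order of differentiability after another, and that it is holomorphic. *)
Theorem holomorphic_inverse (F : Cn R n -> Cn R n) W z0 :
  open W -> W z0 -> holomorphic_on W F -> jacobian F z0 = 1%:M ->
  exists (O : set (Cn R n)) (G : Cn R n -> Cn R n),
  [/\ open O, O z0, O `<=` W & open (F @` O)] /\
  [/\ forall z, O z -> G (F z) = z,
      forall y, (F @` O) y -> {for y, continuous G} &
      holomorphic_on (F @` O) G].
Proof.
move=> oW Wz0 hF J1.
have half0 : 0 < 2^-1 :> R by rewrite invr_gt0.
have quart0 : 0 < 4^-1 :> R by rewrite invr_gt0.
have [d d0 Hd] : exists2 d : R, 0 < d & forall a b,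
    `|a - z0| < d -> `|b - z0| < d ->
    `|(F b - b) - (F a - a)| <= 2^-1 * `|b - a|.
  have [d d0 Hd] := holomorphic_strict oW hF Wz0 half0.
  exists d => // a b az bz; have := Hd a b az bz; rewrite J1 clin1.
  by rewrite sub_swap.
have [d1 /= d10 Wd1] : exists2 d : R, 0 < d & forall y, `|y - z0| < d -> W y.
  have /nbhs_normP[e /= e0 H] : nbhs z0 W by exact: open_nbhs_nbhs.
  by exists e => // y; rewrite distrC => /H.
pose m := Num.min d d1.
have m0 : 0 < m by rewrite lt_min d0.
pose r := m / 2.
have r0 : 0 < r by rewrite divr_gt0.
have rm : r < m by rewrite /r ltr_pdivrMr // ltr_pMr // ltr1n.
have rd : r < d by apply: lt_le_trans rm _; rewrite ge_min lexx.
have rW z : `|z - z0| < r -> W z.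
  move=> zr; apply: Wd1; apply: lt_trans zr _; apply: lt_le_trans rm _.
  by rewrite ge_min lexx orbT.
have lower a b : `|a - z0| < d -> `|b - z0| < d ->
    `|b - a| <= 2 * `|F b - F a|.
  move=> az bz; have := Hd a b az bz.
  have -> : F b - b - (F a - a) = (F b - F a) - (b - a).
    by rewrite sub_swap.
  move=> H; have : `|b - a| <= `|F b - F a| + 2^-1 * `|b - a|.
    rewrite -{1}(subKr (F b - F a) (b - a)).
    by apply: le_trans (ler_normB _ _) _; rewrite lerD2l.
  move: (`|b - a|) (`|F b - F a|) => x y; lra.
pose O := [set z : Cn R n | `|z - z0| < r /\ `|F z - F z0| < r / 2].
pose G y := xget z0 [set z | O z /\ F z = y].
have Od z : O z -> `|z - z0| < d by move=> [zr _]; exact: lt_trans rd.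
have GF z : O z -> G (F z) = z.
  move=> Oz; rewrite /G; apply: xget_unique => // t [Ot Ft].
  apply/eqP; rewrite -subr_eq0 -normr_le0.
  by have := lower z t (Od z Oz) (Od t Ot); rewrite Ft subrr normr0 mulr0.
have OE : F @` O = [set y | `|y - F z0| < r / 2].
  apply/seteqP; split=> y /=; first by move=> [z [_ zr] <-].
  move=> yr; have [z zr Fz] := perturbation_onto r0 rd Hd yr.
  by exists z => //; split; rewrite ?Fz.
have Wcont z : W z -> forall e : R, 0 < e -> \forall t \near z, `|F t - F z| < e.
  move=> Wz e e0; have /cvgrPdist_lt/(_ e e0) := holomorphic_continuous hF Wz.
  by apply: filterS => t; rewrite distrC.
have oball (c : Cn R n) (e : R) : open [set z | `|z - c| < e].
  have -> : [set z | `|z - c| < e] = ball c e.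
    by apply/seteqP; split=> z /=; rewrite -ball_normE /= distrC.
  exact: ball_open.
have oO : open O.
  rewrite openE => z [zr Fzr]; rewrite /interior.
  have e0 : 0 < r / 2 - `|F z - F z0| by rewrite subr_gt0.
  near=> t; split.
    by near: t; exact: (open_nbhs_nbhs (conj (oball z0 r) zr)).
  have -> : F t - F z0 = (F t - F z) + (F z - F z0) by rewrite addrA subrK.
  apply: le_lt_trans (ler_normD _ _) _; rewrite -ltrBrDr.
  by near: t; exact: (Wcont z (rW z zr) _ e0).
have Oz0 : O z0 by split; rewrite subrr normr0 // divr_gt0.
have oFO : open (F @` O) by rewrite OE.
have OW : O `<=` W by move=> z [zr _]; exact: rW.
have OG y : (F @` O) y -> O (G y) /\ F (G y) = y.
  by move=> [z Oz <-]; rewrite GF.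
have Glip y y' : (F @` O) y -> (F @` O) y' -> `|G y' - G y| <= 2 * `|y' - y|.
  move=> /OG[Oy Fy] /OG[Oy' Fy'].
  by have := lower _ _ (Od _ Oy) (Od _ Oy'); rewrite Fy Fy'.
have Gcont y : (F @` O) y -> {for y, continuous G}.
  move=> Fy; apply/cvgrPdist_lt => /= e e0; near=> t.
  rewrite distrC; apply: le_lt_trans (Glip y t Fy _) _.
    by near: t; exact: (open_nbhs_nbhs (conj oFO Fy)).
  rewrite -ltr_pdivlMl // mulrC distrC; near: t.
  by apply: (@near_norm_lt (Cn R n) y); rewrite divr_gt0.
(* The lower Lipschitz bound passes to the differential, which is thus injective. *)
have Jlower z x : O z -> `|x| <= 4 * `|clin (jacobian F z) x|.
  move=> Oz; have [d' d'0 Hd'] := holomorphic_strict oW hF (OW z Oz) quart0.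
  have /nbhs_normP[d2 /= d20 Od2] : nbhs z O by exact: open_nbhs_nbhs.
  pose t := Num.min d' d2 / (`|x| + 1).
  have md : 0 < Num.min d' d2 by rewrite lt_min d'0.
  have x10 : 0 < `|x| + 1 by rewrite ltr_wpDl.
  have t0 : 0 < t by rewrite divr_gt0.
  have tx : `|t *: x| < Num.min d' d2.
    rewrite normrZ gtr0_norm // /t mulrAC ltr_pdivrMr // ltr_pM2l //.
    by rewrite ltrDl.
  have zx : z + t *: x - z = t *: x by rewrite addrC addKr.
  have Otx : O (z + t *: x).
    apply: Od2; rewrite /= opprD addrA subrr sub0r normrN.
    by apply: lt_le_trans tx _; rewrite ge_min lexx orbT.
  have := lower _ _ (Od z Oz) (Od _ Otx); rewrite zx.
  have := Hd' z (z + t *: x); rewrite zx subrr normr0 clinZ !normrZ !gtr0_norm //.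
  move=> /(_ d'0) H1.
  have {}H1 := H1 _.
  have txd : t * `|x| < d'.
    by move: tx; rewrite normrZ gtr0_norm // lt_min => /andP[].
  move: (H1 txd) => {}H1 H2.
  have H3 : `|F (z + t *: x) - F z| <= 4^-1 * (t * `|x|) +
      t * `|clin (jacobian F z) x|.
    rewrite -[F _ - _](subrK (t *: clin (jacobian F z) x)).
    apply: le_trans (ler_normD _ _) _; rewrite normrZ (gtr0_norm t0).
    by rewrite lerD2r.
  have : t * `|x| <= t * (4 * `|clin (jacobian F z) x|).
    rewrite mulrCA; move: H2 H3.
    move: (t * `|x|) (`|F (z + t *: x) - F z|) (t * _) => u v w; lra.
  by rewrite ler_pM2l.
have Junit z : O z -> jacobian F z \in unitmx.
  move=> Oz; rewrite unitmxE unitfE -det_tr; apply/negP => /det0P[v v0 vJ].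
  have Jv : jacobian F z *m v^T = 0.
    by rewrite -[jacobian F z]trmxK -trmx_mul vJ trmx0.
  have := Jlower z (rvec v^T) Oz; rewrite /clin rvecK Jv.
  rewrite rvec0 normr0 mulr0 normr_le0 => /eqP E.
  move/negP: v0; apply; apply/eqP/rowP => k.
  have := congr1 (@coord R n k) E; rewrite coord_rvec mxE => ->.
  by rewrite mxE; apply: eq_ReIm; rewrite /coord /= mxE.
have Gder y v a : (F @` O) y -> is_rderive (fun y => coord a (G y)) y v
    (coord a (clin (invmx (jacobian F (G y))) v)).
  move=> Fy; have [Oz Fz] := OG y Fy; set z := G y in Oz Fz *.
  set w := clin _ v.
  have Jw : clin (jacobian F z) w = v by rewrite clinM mulmxV ?clin1 // Junit.
  have lim_i i : is_derive y v (rcoord i \o G) (rcoord i w).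
    have cvL : h^-1 *: (((rcoord i \o G) \o shift y) (h *: v) - (rcoord i \o G) y)
        @[h --> 0^'] --> rcoord i w.
      apply/cvgrPdist_lt => /= e e0.
      (* [8 = 4 * 2]: the losses in [Jlower] and in [Glip] *)
      pose C := 8 * (`|v| + 1).
      have C0 : 0 < C by rewrite mulr_gt0 // ltr_wpDl.
      have [d' d'0 Hd'] := holomorphic_strict oW hF (OW z Oz) (divr_gt0 e0 C0).
      have V0 : 0 < 2 * (`|v| + 1) by rewrite mulr_gt0 // ltr_wpDl.
      have nFO : \forall h \near 0^', (F @` O) (h *: v + y).
        have /nbhs_normP[c /= c0 Hc] := open_nbhs_nbhs (conj oFO Fy).
        have v10 : 0 < `|v| + 1 by rewrite ltr_wpDl.
        near=> h; apply: Hc; rewrite /= opprD addrCA subrr addr0 normrN normrZ.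
        apply: (@le_lt_trans _ _ (`|h| * (`|v| + 1))).
          by rewrite ler_wpM2l // lerDl.
        rewrite -ltr_pdivlMr //; near: h; apply: dnbhs0_lt.
        by rewrite divr_gt0.
      near=> h.
      have h0 : h != 0 by near: h; exact: nbhs_dnbhs_neq.
      have nh0 : 0 < `|h| by rewrite normr_gt0.
      have Fyh : (F @` O) (h *: v + y) by near: h.
      have [Oyh FGyh] := OG _ Fyh.
      set b := G (h *: v + y) in Oyh FGyh *.
      have bz : `|b - z| <= 2 * (`|h| * `|v|).
        have := Glip _ _ Fy Fyh; rewrite -/b -/z.
        by rewrite addrK normrZ.
      have hd : 2 * (`|h| * `|v|) < d'.
        apply: (@le_lt_trans _ _ (`|h| * (2 * (`|v| + 1)))).
          by rewrite mulrCA ler_wpM2l // ler_wpM2l // lerDl.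
        rewrite -ltr_pdivlMr //; near: h; apply: dnbhs0_lt.
        by rewrite divr_gt0.
      have := Hd' z b; rewrite subrr normr0 => /(_ d'0 (le_lt_trans bz hd)).
      rewrite FGyh Fz addrK => Hh.
      have key : `|h *: w - (b - z)| < e * `|h|.
        apply: le_lt_trans (Jlower z _ Oz) _.
        rewrite clinB clinZ Jw.
        apply: (@le_lt_trans _ _ (4 * (e / C * (2 * (`|h| * `|v|))))).
          rewrite ler_pM2l //; apply: le_trans Hh _.
          by rewrite ler_wpM2l // ltW // divr_gt0.
        have -> : 4 * (e / C * (2 * (`|h| * `|v|))) = (e * `|h|) * (8 * `|v| / C).
          by field; rewrite gt_eqF.
        rewrite gtr_pMr ?mulr_gt0 // ltr_pdivrMr // mul1r /C.
        by rewrite ltr_pM2l // ltrDl.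
      have -> : rcoord i w - h^-1 *: (rcoord i b - rcoord i z)
          = h^-1 * rcoord i (h *: w - (b - z)).
        by rewrite !rcoordB rcoordZ [RHS]mulrBr mulKf.
      rewrite normrM normfV ltr_pdivrMl // mulrC.
      exact: le_lt_trans (rcoord_le_norm _ _) key.
    split; first by apply/cvg_ex; exists (rcoord i w).
    exact: cvg_lim cvL.
  by split; [exact: (lim_i (inl a))|exact: (lim_i (inr a))].
have GC k : forall a, CCk k (F @` O) (fun y => coord a (G y)).
  elim: k => [|k IH] a.
    have cc (i : 'I_n + 'I_n) y : (F @` O) y -> {for y, continuous (rcoord i \o G)}.
      move=> Fy; apply: continuous_comp; first exact: Gcont.
      exact: rcoord_continuous.
    split; split=> // y Fy; [exact: (cc (inl a))|exact: (cc (inr a))].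
  have Cinv v : CCk k (F @` O)
      (fun y => coord a (clin (invmx (jacobian F (G y))) v)).
    under eq_fun do rewrite coord_clin.
    apply: CCk_sum => // j; apply: CCkM => //; last exact: CCk_cst.
    apply: CCk_invmx => // [y /OG[Oz _]|p q]; first exact: Junit.
    have CJ : CCk k W (fun z => jacobian F z p q).
      under eq_fun do rewrite mxE; apply: CCk_dz => //.
      by have [sF _] := hF p; exact: sF.
    exact: (CCk_comp (F := G) oW oFO (fun y Fy => OW _ (OG y Fy).1) IH CJ).
  have rE v : {in F @` O, rderive v (fun y => coord a (G y)) =1
      (fun y => coord a (clin (invmx (jacobian F (G y))) v))}.
    by move=> y /set_mem Fy; exact: is_rderiveE (Gder y v a Fy).
  have CD v := eq_CCk oFO (rE v) (Cinv v).
  have [c1 c2] := IH a.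
  split.
    split=> [y Fy|v]; first exact: Ck_continuous c1 Fy.
    split=> [y Fy|]; first by have [[]] := Gder y v a Fy.
    by have [] := CD v.
  split=> [y Fy|v]; first exact: Ck_continuous c2 Fy.
  split=> [y Fy|]; first by have [_ []] := Gder y v a Fy.
  by have [] := CD v.
exists O, G; split; first by split.
split=> // a; split=> [k|k y Fy]; first exact: GC.
rewrite (_ : coord a \o G = fun y => coord a (G y)) // dzbarE.
rewrite !(is_rderiveE (Gder y _ a Fy)) !coord_clin mulr_sumr -big_split /=.
rewrite big1 ?mul0r // => j _; rewrite mulrCA -mulrDr.
rewrite (_ : coord j (e1 R k) + _ = 0) ?mulr0 //.
rewrite /coord /e1 /e2 /= !mxE eqxx /=.
by case: eqP => _; apply: eq_ReIm => /=; ring.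
Unshelve. all: by try end_near. Qed.

End InverseFunction.

(** * Derivatives along a complex vector *)

Section VectorDerivatives.
Variables (R : realType) (n : nat).
Implicit Types (f g : Cn R n -> R[i]) (U : set (Cn R n)) (xi : 'cV[R[i]]_n).

Definition dvec xi f z := \sum_k xi k ord0 * dz k f z.
Definition dvecb xi f z := \sum_k conjc (xi k ord0) * dzbar k f z.

Lemma CCk_dvec k xi U f : open U -> CCk k.+1 U f -> CCk k U (dvec xi f).
Proof.
move=> oU Cf; apply: CCk_sum => // j; apply: CCkM => //; first exact: CCk_cst.
exact: CCk_dz.
Qed.

Lemma CCk_dvecb k xi U f : open U -> CCk k.+1 U f -> CCk k U (dvecb xi f).
Proof.
move=> oU Cf; apply: CCk_sum => // j; apply: CCkM => //; first exact: CCk_cst.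
exact: CCk_dzbar.
Qed.

Lemma near_eq_dvec xi f g z : (\near z, f z = g z) -> dvec xi f z = dvec xi g z.
Proof. by move=> fg; apply: eq_bigr => k _; rewrite (near_eq_dz k fg). Qed.

Lemma near_eq_dvecb xi f g z : (\near z, f z = g z) -> dvecb xi f z = dvecb xi g z.
Proof. by move=> fg; apply: eq_bigr => k _; rewrite (near_eq_dzbar k fg). Qed.

Lemma eq_dvec xi f g U : open U -> (forall z, U z -> f z = g z) ->
  forall z, U z -> dvec xi f z = dvec xi g z.
Proof.
move=> oU fg z Uz; apply: near_eq_dvec.
by apply: filterS (open_nbhs_nbhs (conj oU Uz)) => y; exact: fg.
Qed.

Lemma eq_dvecb xi f g U : open U -> (forall z, U z -> f z = g z) ->
  forall z, U z -> dvecb xi f z = dvecb xi g z.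
Proof.
move=> oU fg z Uz; apply: near_eq_dvecb.
by apply: filterS (open_nbhs_nbhs (conj oU Uz)) => y; exact: fg.
Qed.

Lemma dvec_cst xi (c : R[i]) z : dvec xi (fun=> c) z = 0.
Proof. by rewrite /dvec big1 // => k _; rewrite dz_cst mulr0. Qed.

Lemma dvecb_cst xi (c : R[i]) z : dvecb xi (fun=> c) z = 0.
Proof. by rewrite /dvecb big1 // => k _; rewrite dzbar_cst mulr0. Qed.

Section AtPoint.
Variables (U : set (Cn R n)) (z : Cn R n).
Hypotheses (oU : open U) (Uz : U z).

Lemma dvecD xi f g : CCk 1 U f -> CCk 1 U g ->
  dvec xi (fun y => f y + g y) z = dvec xi f z + dvec xi g z.
Proof.
move=> Cf Cg; rewrite /dvec -big_split; apply: eq_bigr => k _.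
by rewrite (dzD oU Uz k Cf Cg) mulrDr.
Qed.

Lemma dvecbD xi f g : CCk 1 U f -> CCk 1 U g ->
  dvecb xi (fun y => f y + g y) z = dvecb xi f z + dvecb xi g z.
Proof.
move=> Cf Cg; rewrite /dvecb -big_split; apply: eq_bigr => k _.
by rewrite (dzbarD oU Uz k Cf Cg) mulrDr.
Qed.

Lemma dvecM xi f g : CCk 1 U f -> CCk 1 U g ->
  dvec xi (fun y => f y * g y) z = dvec xi f z * g z + f z * dvec xi g z.
Proof.
move=> Cf Cg; rewrite /dvec mulr_suml mulr_sumr -big_split; apply: eq_bigr => k _.
by rewrite (dzM oU Uz k Cf Cg) mulrDr mulrA [in X in _ + X]mulrCA.
Qed.

Lemma dvecbM xi f g : CCk 1 U f -> CCk 1 U g ->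
  dvecb xi (fun y => f y * g y) z = dvecb xi f z * g z + f z * dvecb xi g z.
Proof.
move=> Cf Cg; rewrite /dvecb mulr_suml mulr_sumr -big_split; apply: eq_bigr => k _.
by rewrite (dzbarM oU Uz k Cf Cg) mulrDr mulrA [in X in _ + X]mulrCA.
Qed.

Lemma dvecZr xi f (c : R[i]) : CCk 1 U f ->
  dvec xi (fun y => f y * c) z = dvec xi f z * c.
Proof. by move=> Cf; rewrite (dvecM xi Cf (CCk_cst _ _ _)) dvec_cst mulr0 addr0. Qed.

Lemma dvecbZr xi f (c : R[i]) : CCk 1 U f ->
  dvecb xi (fun y => f y * c) z = dvecb xi f z * c.
Proof. by move=> Cf; rewrite (dvecbM xi Cf (CCk_cst _ _ _)) dvecb_cst mulr0 addr0. Qed.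

Lemma dvec_sum xi (J : Type) (r : seq J) (F : J -> Cn R n -> R[i]) :
  (forall j, CCk 1 U (F j)) ->
  dvec xi (fun y => \sum_(j <- r) F j y) z = \sum_(j <- r) dvec xi (F j) z.
Proof.
move=> CF; elim: r => [|j r IH].
  by rewrite big_nil; under eq_fun do rewrite big_nil; exact: dvec_cst.
rewrite big_cons; under eq_fun do rewrite big_cons.
rewrite dvecD ?IH //; exact: CCk_sum.
Qed.

Lemma dvecb_sum xi (J : Type) (r : seq J) (F : J -> Cn R n -> R[i]) :
  (forall j, CCk 1 U (F j)) ->
  dvecb xi (fun y => \sum_(j <- r) F j y) z = \sum_(j <- r) dvecb xi (F j) z.
Proof.
move=> CF; elim: r => [|j r IH].
  by rewrite big_nil; under eq_fun do rewrite big_nil; exact: dvecb_cst.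
rewrite big_cons; under eq_fun do rewrite big_cons.
rewrite dvecbD ?IH //; exact: CCk_sum.
Qed.

Lemma dvecJ xi f : CCk 1 U f ->
  dvec xi (fun y => conjc (f y)) z = conjc (dvecb xi f z).
Proof.
move=> Cf; rewrite /dvecb conjc_sum; apply: eq_bigr => k _.
by rewrite (dzJ oU Uz k Cf) conjcM conjcK.
Qed.

Lemma dvecbJ xi f : CCk 1 U f ->
  dvecb xi (fun y => conjc (f y)) z = conjc (dvec xi f z).
Proof.
move=> Cf; rewrite /dvec conjc_sum; apply: eq_bigr => k _.
by rewrite (dzbarJ oU Uz k Cf) conjcM.
Qed.

Lemma dz_dvecb k eta f : CCk 2 U f ->
  dz k (dvecb eta f) z = dvecb eta (dz k f) z.
Proof.
move=> Cf; have Cb l : CCk 1 U (dzbar l f) by exact: CCk_dzbar.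
have Cc (c : R[i]) : CCk 1 U (fun=> c) by exact: CCk_cst.
rewrite /dvecb (dz_sum oU Uz) => [|l]; last exact: CCkM.
apply: eq_bigr => l _.
by rewrite (dzM oU Uz k (Cc _) (Cb l)) dz_cst mul0r add0r (dz_dzbar oU Uz k l Cf).
Qed.

Lemma dvec_dvecb xi eta f : CCk 2 U f ->
  dvec xi (dvecb eta f) z = dvecb eta (dvec xi f) z.
Proof.
move=> Cf; have Ca k : CCk 1 U (dz k f) by exact: CCk_dz.
have Cc (c : R[i]) : CCk 1 U (fun=> c) by exact: CCk_cst.
rewrite {2}/dvec dvecb_sum => [|k]; last exact: CCkM.
apply: eq_bigr => k _.
by rewrite (dvecbM eta (Cc _) (Ca k)) dvecb_cst mul0r add0r dz_dvecb.
Qed.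

End AtPoint.

End VectorDerivatives.

(** * Hermitian forms and the holomorphic sectional curvature *)

Section Sesquilinear.
Variables (R : realType) (n : nat).
Implicit Types (A : 'M[R[i]]_n) (xi eta v w : 'cV[R[i]]_n) (c : R[i]).

Definition sesq A v w : R[i] :=
  \sum_i \sum_j A i j * v i ord0 * conjc (w j ord0).

Definition hermitian_mx A := forall i j, A j i = conjc (A i j).

Lemma sesqDl A v v' w : sesq A (v + v') w = sesq A v w + sesq A v' w.
Proof.
rewrite /sesq -big_split; apply: eq_bigr => i _.
rewrite -big_split; apply: eq_bigr => j _.
by rewrite !mxE mulrDr mulrDl.
Qed.

Lemma sesqZl A c v w : sesq A (c *: v) w = c * sesq A v w.
Proof.
rewrite /sesq mulr_sumr; apply: eq_bigr => i _.
rewrite mulr_sumr; apply: eq_bigr => j _.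
by rewrite !mxE !mulrA (mulrC c).
Qed.

Lemma sesqNl A v w : sesq A (- v) w = - sesq A v w.
Proof. by rewrite -scaleN1r sesqZl mulN1r. Qed.

Lemma sesqBl A v v' w : sesq A (v - v') w = sesq A v w - sesq A v' w.
Proof. by rewrite sesqDl sesqNl. Qed.

Lemma sesq0l A w : sesq A 0 w = 0.
Proof. by rewrite -[X in sesq A X](scale0r 0) sesqZl mul0r. Qed.

Lemma sesqDr A v w w' : sesq A v (w + w') = sesq A v w + sesq A v w'.
Proof.
rewrite /sesq -big_split; apply: eq_bigr => i _.
rewrite -big_split; apply: eq_bigr => j _.
by rewrite !mxE conjcD mulrDr.
Qed.

Lemma sesqZr A c v w : sesq A v (c *: w) = conjc c * sesq A v w.
Proof.
rewrite /sesq mulr_sumr; apply: eq_bigr => i _.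
rewrite mulr_sumr; apply: eq_bigr => j _.
by rewrite !mxE conjcM mulrCA.
Qed.

Lemma sesqNr A v w : sesq A v (- w) = - sesq A v w.
Proof. by rewrite -scaleN1r sesqZr conjcN conjc1 mulN1r. Qed.

Lemma sesqBr A v w w' : sesq A v (w - w') = sesq A v w - sesq A v w'.
Proof. by rewrite sesqDr sesqNr. Qed.

Lemma sesq_delta A i j : sesq A (delta_mx i ord0) (delta_mx j ord0) = A i j.
Proof.
rewrite /sesq (bigD1 i) //= [X in _ + X]big1 => [|k ki]; last first.
  by rewrite big1 // => l _; rewrite !mxE (negbTE ki) /= mulr0 mul0r.
rewrite addr0 (bigD1 j) //= [X in _ + X]big1 => [|l lj]; last first.
  by rewrite !mxE (negbTE lj) /= conjc0 mulr0.
by rewrite addr0 !mxE !eqxx /= conjc1 !mulr1.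
Qed.

Lemma sesq_herm A v w : hermitian_mx A -> sesq A w v = conjc (sesq A v w).
Proof.
move=> hA; rewrite /sesq conjc_sum exchange_big; apply: eq_bigr => j _ /=.
rewrite conjc_sum; apply: eq_bigr => i _.
by rewrite !conjcM conjcK -hA mulrAC.
Qed.

Lemma sesqDm A B v w : sesq (A + B) v w = sesq A v w + sesq B v w.
Proof.
rewrite /sesq -big_split; apply: eq_bigr => i _.
rewrite -big_split; apply: eq_bigr => j _.
by rewrite !mxE !mulrDl.
Qed.

Lemma sesq0m v w : sesq 0 v w = 0.
Proof. by rewrite /sesq big1 // => i _; rewrite big1 // => j _; rewrite mxE !mul0r. Qed.

Lemma sesqZm A c v w : sesq (c *: A) v w = c * sesq A v w.
Proof.
rewrite /sesq mulr_sumr; apply: eq_bigr => i _.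
by rewrite mulr_sumr; apply: eq_bigr => j _; rewrite !mxE !mulrA.
Qed.

Lemma colv_delta (v : 'cV[R[i]]_n) : v = \sum_i v i ord0 *: delta_mx i ord0.
Proof. by rewrite {1}[v]matrix_sum_delta; apply: eq_bigr => i _; rewrite big_ord1. Qed.

(** Turns metrics, which are given as forms, into fields of matrices. *)
Lemma sesq_mx (b : 'cV[R[i]]_n -> 'cV[R[i]]_n -> R[i]) v w :
  (forall c x y z, b (c *: x + y) z = c * b x z + b y z) ->
  (forall x y, b y x = conjc (b x y)) ->
  sesq (\matrix_(i, j) b (delta_mx i ord0) (delta_mx j ord0)) v w = b v w.
Proof.
move=> lin herm.
have b0 z : b 0 z = 0.
  by have := lin (-1) 0 0 z; rewrite scaler0 addr0 mulN1r addNr.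
have suml (I : Type) (r : seq I) (c : I -> R[i]) (x : I -> 'cV_n) z :
    b (\sum_(i <- r) c i *: x i) z = \sum_(i <- r) c i * b (x i) z.
  elim: r => [|i r IH]; first by rewrite !big_nil.
  by rewrite !big_cons lin IH.
have sumr (I : Type) (r : seq I) (c : I -> R[i]) (x : I -> 'cV_n) z :
    b z (\sum_(i <- r) c i *: x i) = \sum_(i <- r) conjc (c i) * b z (x i).
  rewrite herm suml conjc_sum; apply: eq_bigr => i _.
  by rewrite conjcM -herm.
rewrite {2}[v]colv_delta {2}[w]colv_delta suml /sesq; apply: eq_bigr => i _.
rewrite sumr mulr_sumr; apply: eq_bigr => j _.
by rewrite mxE -mulrA mulrC -mulrA.
Qed.

Definition posdef_mx A := forall v, v != 0 -> 0 < sesq A v v.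

Lemma sesq_trmul A v w : sesq A v w = \sum_j (A^T *m v) j ord0 * conjc (w j ord0).
Proof.
rewrite /sesq exchange_big; apply: eq_bigr => j _ /=.
by rewrite mxE mulr_suml; apply: eq_bigr => i _; rewrite mxE.
Qed.

Lemma posdef_unitmx A : posdef_mx A -> A \in unitmx.
Proof.
move=> pA; rewrite -unitmx_tr unitmxE unitfE -det_tr; apply/negP => /det0P[v v0 vA].
rewrite trmxK in vA.
have /pA : v^T != 0 by rewrite -(inj_eq trmx_inj) trmxK trmx0.
rewrite sesq_trmul -trmx_mul vA trmx0.
by rewrite big1 ?ltxx // => j _; rewrite mxE mul0r.
Qed.

End Sesquilinear.

Section CurvatureForm.
Variables (R : realType) (n : nat).
Implicit Types (g : Cn R n -> 'M[R[i]]_n) (xi eta : 'cV[R[i]]_n).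
Implicit Types (U : set (Cn R n)).

(** For a holomorphic curve [f] with [f 0 = z], [f' 0 = xi], [f'' 0 = - eta],
    this is the value at [0] of [- d dbar |f'|^2]. Contrary to the curvature it
    is linear in the metric [g]. *)
Definition Nform g z xi eta : R[i] :=
  - dvec xi (dvecb xi (fun y => sesq (g y) xi xi)) z
  + dvec xi (fun y => sesq (g y) xi eta) z
  + dvecb xi (fun y => sesq (g y) eta xi) z
  - sesq (g z) eta eta.

Definition curvature_form g z xi : R[i] :=
  \sum_i \sum_j \sum_k \sum_l curvature g i j k l z * xi i ord0
     * conjc (xi j ord0) * xi k ord0 * conjc (xi l ord0).

(** The first order part of the metric paired with [xi] twice, and the vector
    it represents: the value of [eta] at which [Nform] is largest. *)
Definition dmetric g z xi : 'cV[R[i]]_n :=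
  \col_p dvec xi (fun y => \sum_i g y i p * xi i ord0) z.

Definition optimal g z xi : 'cV[R[i]]_n := (invmx (g z))^T *m dmetric g z xi.

Definition smooth_mx U g := forall i j, smooth U (fun z => g z i j).

Lemma smooth_mx_CCk k U g i j : smooth_mx U g -> CCk k U (fun z => g z i j).
Proof. by move=> sg; exact: sg. Qed.

Lemma CCk_sesq k U g (v w : Cn R n -> 'cV[R[i]]_n) : open U -> smooth_mx U g ->
  (forall i, CCk k U (fun y => v y i ord0)) ->
  (forall i, CCk k U (fun y => w y i ord0)) ->
  CCk k U (fun y => sesq (g y) (v y) (w y)).
Proof.
move=> oU sg Cv Cw; do 2!apply: CCk_sum => // ?.
apply: CCkM => //; last exact: CCkJ.
by apply: CCkM => //; exact: smooth_mx_CCk.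
Qed.

Lemma CCk_sesq_term k U g i j (a b : R[i]) : open U -> smooth_mx U g ->
  CCk k U (fun y => g y i j * a * b).
Proof.
move=> oU sg; have Cc c : CCk k U (fun=> c) by exact: CCk_cst.
exact: (CCkM oU (CCkM oU (smooth_mx_CCk k i j sg) (Cc a)) (Cc b)).
Qed.

Section AtPoint.
Variables (U : set (Cn R n)) (z : Cn R n).
Hypotheses (oU : open U) (Uz : U z).

Lemma dvec_sesq g xi v w : smooth_mx U g ->
  dvec xi (fun y => sesq (g y) v w) z =
  \sum_i \sum_j dvec xi (fun y => g y i j) z * v i ord0 * conjc (w j ord0).
Proof using oU Uz.
move=> sg; rewrite (dvec_sum oU Uz) => [|i]; last first.
  by apply: CCk_sum oU _ => j; exact: CCk_sesq_term.
apply: eq_bigr => i _; rewrite (dvec_sum oU Uz) => [|j]; last first.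
  exact: CCk_sesq_term.
apply: eq_bigr => j _; rewrite (dvecZr oU Uz); last first.
  exact: (CCkM oU (smooth_mx_CCk 1 i j sg) (CCk_cst _ _ _)).
by rewrite (dvecZr oU Uz) //; exact: smooth_mx_CCk.
Qed.

Lemma dvecb_sesq g xi v w : smooth_mx U g ->
  dvecb xi (fun y => sesq (g y) v w) z =
  \sum_i \sum_j dvecb xi (fun y => g y i j) z * v i ord0 * conjc (w j ord0).
Proof using oU Uz.
move=> sg; rewrite (dvecb_sum oU Uz) => [|i]; last first.
  by apply: CCk_sum oU _ => j; exact: CCk_sesq_term.
apply: eq_bigr => i _; rewrite (dvecb_sum oU Uz) => [|j]; last first.
  exact: CCk_sesq_term.
apply: eq_bigr => j _; rewrite (dvecbZr oU Uz); last first.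
  exact: (CCkM oU (smooth_mx_CCk 1 i j sg) (CCk_cst _ _ _)).
by rewrite (dvecbZr oU Uz) //; exact: smooth_mx_CCk.
Qed.

End AtPoint.

Lemma smooth_mx_dvecb U g xi : open U -> smooth_mx U g ->
  smooth_mx U (fun z => \matrix_(i, j) dvecb xi (fun y => g y i j) z).
Proof.
move=> oU sg i j k.
have C := CCk_dvecb xi oU (smooth_mx_CCk k.+1 i j sg).
suff E : (fun z => (\matrix_(i, j) dvecb xi (fun y => g y i j) z) i j) =
    dvecb xi (fun y => g y i j) by rewrite -E in C; exact: C.
by apply/funext => y; rewrite mxE.
Qed.

Lemma smooth_mx_dzbar U g l : open U -> smooth_mx U g ->
  smooth_mx U (fun z => \matrix_(i, j) dzbar l (fun y => g y i j) z).
Proof.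
move=> oU sg i j k.
have C := CCk_dzbar l oU (smooth_mx_CCk k.+1 i j sg).
suff E : (fun z => (\matrix_(i, j) dzbar l (fun y => g y i j) z) i j) =
    dzbar l (fun y => g y i j) by rewrite -E in C; exact: C.
by apply/funext => y; rewrite mxE.
Qed.

Section CurvatureNform.
Variables (U : set (Cn R n)) (z : Cn R n).
Hypotheses (oU : open U) (Uz : U z).

Lemma dvec_dvecb_sesq g xi eta v w : smooth_mx U g ->
  dvec xi (dvecb eta (fun y => sesq (g y) v w)) z =
  \sum_i \sum_j \sum_k \sum_l dz k (dzbar l (fun y => g y i j)) z
     * xi k ord0 * conjc (eta l ord0) * v i ord0 * conjc (w j ord0).
Proof using oU Uz.
move=> sg; pose h y := \matrix_(i, j) dvecb eta (fun y => g y i j) y.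
have E : forall y, U y -> dvecb eta (fun y => sesq (g y) v w) y = sesq (h y) v w.
  move=> y Uy; rewrite (dvecb_sesq oU Uy) //.
  by apply: eq_bigr => i _; apply: eq_bigr => j _; rewrite mxE.
rewrite (eq_dvec xi oU E Uz) (dvec_sesq oU Uz); last exact: smooth_mx_dvecb.
apply: eq_bigr => i _; apply: eq_bigr => j _.
have -> : (fun y => h y i j) = dvecb eta (fun y => g y i j).
  by apply/funext => y; rewrite mxE.
rewrite /dvec !mulr_suml; apply: eq_bigr => k _.
rewrite (dz_dvecb oU Uz) /dvecb; last exact: smooth_mx_CCk.
rewrite mulr_sumr !mulr_suml; apply: eq_bigr => l _.
rewrite (dz_dzbar oU Uz); last exact: smooth_mx_CCk.
by rewrite [conjc _ * dzbar _ _ _]mulrC mulrCA mulrA.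
Qed.

Lemma dmetricP g xi eta : smooth_mx U g ->
  dvec xi (fun y => sesq (g y) xi eta) z =
  \sum_p dmetric g z xi p ord0 * conjc (eta p ord0).
Proof using oU Uz.
move=> sg; rewrite (dvec_sesq oU Uz) // exchange_big; apply: eq_bigr => p _ /=.
rewrite mxE (dvec_sum oU Uz) => [|i]; last first.
  by apply: CCkM => //; [exact: smooth_mx_CCk|exact: CCk_cst].
rewrite mulr_suml; apply: eq_bigr => i _.
by rewrite (dvecZr oU Uz) //; exact: smooth_mx_CCk.
Qed.

Lemma dmetricE g xi p : smooth_mx U g -> dmetric g z xi p ord0 =
  \sum_i \sum_k dz k (fun y => g y i p) z * xi k ord0 * xi i ord0.
Proof using oU Uz.
move=> sg; rewrite mxE (dvec_sum oU Uz) => [|i]; last first.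
  by apply: CCkM => //; [exact: smooth_mx_CCk|exact: CCk_cst].
apply: eq_bigr => i _; rewrite (dvecZr oU Uz); last exact: smooth_mx_CCk.
by rewrite mulr_suml; apply: eq_bigr => k _; rewrite [_ * dz _ _ _]mulrC.
Qed.

Variable (g : Cn R n -> 'M[R[i]]_n).
Hypotheses (sg : smooth_mx U g) (hg : forall y, U y -> hermitian_mx (g y)).

Lemma dvecb_herm xi v w : dvecb xi (fun y => sesq (g y) w v) z =
  conjc (dvec xi (fun y => sesq (g y) v w) z).
Proof using oU Uz sg hg.
rewrite -(dvecbJ oU Uz); last by apply: CCk_sesq => // i; exact: CCk_cst.
by apply: eq_dvecb oU _ _ Uz => y Uy; apply: sesq_herm; exact: hg.
Qed.

Lemma curvature_formE xi : curvature_form g z xi =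
  - dvec xi (dvecb xi (fun y => sesq (g y) xi xi)) z +
  \sum_p \sum_q invmx (g z) p q * dmetric g z xi p ord0
                * conjc (dmetric g z xi q ord0).
Proof using oU Uz sg hg.
pose x i := xi i ord0.
rewrite dvec_dvecb_sesq // /curvature_form -sumrN.
have aE p := dmetricE xi p sg.
have bE q : conjc (dmetric g z xi q ord0) =
    \sum_j \sum_l dzbar l (fun y => g y q j) z * conjc (x l) * conjc (x j).
  rewrite aE conjc_sum; apply: eq_bigr => j _.
  rewrite conjc_sum; apply: eq_bigr => l _.
  rewrite 2!conjcM; congr (_ * _ * _).
  rewrite -(dzbarJ oU Uz l (smooth_mx_CCk 1 j q sg)); apply: near_eq_dzbar.
  apply: filterS (open_nbhs_nbhs (conj oU Uz)) => y Uy.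
  by rewrite (hg Uy j q).
have -> : \sum_p \sum_q invmx (g z) p q * dmetric g z xi p ord0
                * conjc (dmetric g z xi q ord0) =
  \sum_i \sum_j \sum_k \sum_l (\sum_p \sum_q invmx (g z) p q *
     dz k (fun w => g w i p) z * dzbar l (fun w => g w q j) z)
     * x i * conjc (x j) * x k * conjc (x l).
  under eq_bigr do under eq_bigr do rewrite aE bE.
  pose T i j k l (u : 'I_n * 'I_n) := invmx (g z) u.1 u.2 *
    (dz k (fun y => g y i u.1) z * x k * x i) *
    (dzbar l (fun y => g y u.2 j) z * conjc (x l) * conjc (x j)).
  transitivity (\sum_u \sum_i \sum_j \sum_k \sum_l T i j k l u).
    rewrite pair_bigA; apply: eq_bigr => -[p q] _ /=.
    rewrite -mulrA mulr_suml mulr_sumr; apply: eq_bigr => i _.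
    rewrite !mulr_sumr; apply: eq_bigr => j _.
    rewrite mulr_suml mulr_sumr; apply: eq_bigr => k _.
    by rewrite !mulr_sumr; apply: eq_bigr => l _; rewrite /T /= mulrA.
  do 4!(rewrite exchange_big /=; apply: eq_bigr => ? _).
  rewrite pair_bigA !mulr_suml; apply: eq_bigr => -[p q] _.
  rewrite /T /=; move: (dz _ _ _) (dzbar _ _ _) (invmx _ _ _) => *; ring.
rewrite -big_split; apply: eq_bigr => i _ /=.
rewrite -sumrN -big_split; apply: eq_bigr => j _ /=.
rewrite -sumrN -big_split; apply: eq_bigr => k _ /=.
rewrite -sumrN -big_split; apply: eq_bigr => l _ /=.
rewrite /curvature !mulrDl; congr (_ + _).
by rewrite !mulNr; congr (- _); rewrite /x; ring.
Qed.

Lemma sesq_optimal xi eta : g z \in unitmx ->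
  sesq (g z) (optimal g z xi) eta =
  \sum_p dmetric g z xi p ord0 * conjc (eta p ord0).
Proof.
move=> ug; rewrite sesq_trmul; apply: eq_bigr => j _; congr (_ * _).
by rewrite /optimal mulmxA -trmx_mul mulVmx // trmx1 mul1mx.
Qed.

(** Completing the square in [eta]. *)
Lemma curvature_form_Nform xi eta : g z \in unitmx ->
  curvature_form g z xi = Nform g z xi eta +
    sesq (g z) (eta - optimal g z xi) (eta - optimal g z xi).
Proof using oU Uz sg hg.
move=> ug; rewrite curvature_formE /Nform dvecb_herm (dmetricP xi eta sg).
rewrite sesqBl !sesqBr !(sesq_optimal xi _ ug).
rewrite (sesq_herm (optimal g z xi) eta (hg Uz)) (sesq_optimal xi _ ug).
have -> : \sum_p \sum_q invmx (g z) p q * dmetric g z xi p ord0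
     * conjc (dmetric g z xi q ord0) =
   \sum_p dmetric g z xi p ord0 * conjc (optimal g z xi p ord0).
  have <- : sesq (g z) (optimal g z xi) (optimal g z xi) =
      \sum_p dmetric g z xi p ord0 * conjc (optimal g z xi p ord0).
    exact: sesq_optimal.
  rewrite (sesq_herm (optimal g z xi) _ (hg Uz)) (sesq_optimal xi _ ug).
  rewrite conjc_sum exchange_big; apply: eq_bigr => q _ /=.
  rewrite conjcM conjcK [RHS]mulrC [optimal g z xi q ord0]mxE mulr_suml; apply: eq_bigr => p _.
  by rewrite [_^T _ _]mxE.
ring.
Qed.

Lemma Nform_optimal xi : g z \in unitmx ->
  curvature_form g z xi = Nform g z xi (optimal g z xi).
Proof using oU Uz sg hg.
move=> ug; rewrite (curvature_form_Nform xi (optimal g z xi) ug) subrr.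
by rewrite sesq0l addr0.
Qed.

(** Every test vector [eta] bounds the curvature below: this is how positivity is
    proved throughout. *)
Lemma Nform_le_curvature_form xi eta : posdef_mx (g z) ->
  Nform g z xi eta <= curvature_form g z xi.
Proof using oU Uz sg hg.
move=> pg; rewrite (curvature_form_Nform xi eta (posdef_unitmx pg)).
rewrite lerDl; have [->|d0] := eqVneq (eta - optimal g z xi) 0.
  by rewrite sesq0l.
by rewrite ltW // pg.
Qed.

Lemma Nform_real xi eta : conjc (Nform g z xi eta) = Nform g z xi eta.
Proof using oU Uz sg hg.
have C2 : CCk 2 U (fun y => sesq (g y) xi xi).
  by apply: CCk_sesq => // i; exact: CCk_cst.
rewrite /Nform dvecb_herm conjcB !conjcD conjcN conjcK.
rewrite -(sesq_herm _ _ (hg Uz)) -(dvecbJ oU Uz xi (CCk_dvecb xi oU C2)).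
have -> : dvecb xi (fun y => conjc (dvecb xi (fun y => sesq (g y) xi xi) y)) z =
    dvecb xi (dvec xi (fun y => sesq (g y) xi xi)) z.
  apply: eq_dvecb oU _ _ Uz => y Uy; rewrite -(dvecJ oU Uy); last exact: CCkS.
  by apply: eq_dvec oU _ _ Uy => t Ut; rewrite -(sesq_herm _ _ (hg Ut)).
rewrite (dvec_dvecb oU Uz) //; ring.
Qed.

End CurvatureNform.

End CurvatureForm.

(** * Behaviour of the curvature under holomorphic maps *)

Section HolomorphicChainRule.
Variables (R : realType) (n m : nat).
Variables (F : Cn R m -> Cn R n) (U : set (Cn R n)) (W : set (Cn R m)).
Hypotheses (oU : open U) (oW : open W) (FU : forall y, W y -> U (F y)).
Hypothesis (hF : holomorphic_on W F).
Implicit Types (xi eta : 'cV[R[i]]_m) (w y : Cn R m).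

Lemma holomorphic_CCk k a : CCk k W (fun y => coord a (F y)).
Proof. by have [sF _] := hF a; exact: sF. Qed.

Lemma holomorphic_dzbar k a y : W y -> dzbar k (fun y => coord a (F y)) y = 0.
Proof. by have [_ dF] := hF a; exact: dF. Qed.

Lemma dvec_comp xi G y : CCk 1 U G -> W y ->
  dvec xi (fun y => G (F y)) y = dvec (jacobian F y *m xi) G (F y).
Proof using oU oW FU hF.
move=> CG Wy; pose d k := dz_comp k oU oW FU (holomorphic_CCk 1) CG Wy.
rewrite /dvec; under eq_bigr do rewrite d mulr_sumr.
rewrite exchange_big; apply: eq_bigr => a _ /=.
rewrite mxE mulr_suml; apply: eq_bigr => k _.
rewrite holomorphic_dzbar // conjc0 mulr0 addr0 [jacobian F y a k]mxE.
by rewrite mulrCA mulrC (mulrC (xi k ord0)).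
Qed.

Lemma dvecb_comp xi G y : CCk 1 U G -> W y ->
  dvecb xi (fun y => G (F y)) y = dvecb (jacobian F y *m xi) G (F y).
Proof using oU oW FU hF.
move=> CG Wy; pose d k := dzbar_comp k oU oW FU (holomorphic_CCk 1) CG Wy.
rewrite /dvecb; under eq_bigr do rewrite d mulr_sumr.
rewrite exchange_big; apply: eq_bigr => a _ /=.
rewrite mxE conjc_sum mulr_suml; apply: eq_bigr => k _.
rewrite holomorphic_dzbar // mulr0 add0r conjcM mxE.
by rewrite mulrCA mulrC (mulrC (conjc (xi k ord0))).
Qed.

Definition pushfwd xi y : 'cV[R[i]]_n := jacobian F y *m xi.

Lemma pushfwdE xi a :
  (fun y => pushfwd xi y a ord0) = dvec xi (fun y => coord a (F y)).
Proof.
by apply/funext => y; rewrite mxE; apply: eq_bigr => k _; rewrite mxE mulrC.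
Qed.

Lemma CCk_pushfwd k xi a : CCk k W (fun y => pushfwd xi y a ord0).
Proof using oW hF. by rewrite pushfwdE; exact: CCk_dvec oW (holomorphic_CCk k.+1 a). Qed.

Lemma dvecb_dvec_holomorphic xi eta f : CCk 2 W f ->
  (forall y, W y -> dvecb xi f y = 0) ->
  forall y, W y -> dvecb xi (dvec eta f) y = 0.
Proof using oW.
move=> Cf f0 y Wy; rewrite -(dvec_dvecb oW Wy _ _ Cf).
by rewrite (eq_dvec eta oW f0 Wy) dvec_cst.
Qed.

Lemma dvecb_pushfwd xi eta a y : W y ->
  dvecb xi (fun y => pushfwd eta y a ord0) y = 0.
Proof using oW hF.
move=> Wy; rewrite pushfwdE.
apply: (dvecb_dvec_holomorphic eta (holomorphic_CCk 2 a)) => // t Wt.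
by rewrite /dvecb big1 // => k _; rewrite holomorphic_dzbar ?mulr0.
Qed.

Variables (g : Cn R n -> 'M[R[i]]_n).
Hypothesis (sg : smooth_mx U g).

Lemma CCk_metric_comp k i j : CCk k W (fun y => g (F y) i j).
Proof using oU oW FU hF sg.
exact: (CCk_comp oU oW FU (holomorphic_CCk k) (smooth_mx_CCk k i j sg)).
Qed.

Lemma CCk_sesq_comp k (A B : Cn R m -> 'cV[R[i]]_n) :
  (forall i, CCk k W (fun y => A y i ord0)) ->
  (forall i, CCk k W (fun y => B y i ord0)) ->
  CCk k W (fun y => sesq (g (F y)) (A y) (B y)).
Proof using oU oW FU hF sg.
move=> CA CB; apply: CCk_sum oW _ => i; apply: CCk_sum oW _ => j.
exact: (CCkM oW (CCkM oW (CCk_metric_comp k i j) (CA i)) (CCkJ oW (CB j))).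
Qed.

Lemma dvec_sesq_comp xi (A B : Cn R m -> 'cV[R[i]]_n) w : W w ->
  (forall i, CCk 1 W (fun y => A y i ord0)) ->
  (forall i, CCk 1 W (fun y => B y i ord0)) ->
  (forall i, dvecb xi (fun y => B y i ord0) w = 0) ->
  dvec xi (fun y => sesq (g (F y)) (A y) (B y)) w =
  dvec (pushfwd xi w) (fun z => sesq (g z) (A w) (B w)) (F w) +
  sesq (g (F w)) (\col_i dvec xi (fun y => A y i ord0) w) (B w).
Proof using oU oW FU hF sg.
move=> Ww CA CB B0.
have C1 i j := CCkM oW (CCk_metric_comp 1 i j) (CA i).
have C2 i j := CCkM oW (C1 i j) (CCkJ oW (CB j)).
rewrite (dvec_sum oW Ww) => [|i]; last by apply: CCk_sum oW _ => j; exact: C2.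
rewrite (dvec_sesq oU (FU Ww)) // -big_split; apply: eq_bigr => i _.
rewrite (dvec_sum oW Ww) => [|j]; last exact: C2.
rewrite -big_split; apply: eq_bigr => j _.
rewrite (dvecM oW Ww _ (C1 i j) (CCkJ oW (CB j))) (dvecJ oW Ww _ (CB j)) B0.
rewrite conjc0 mulr0 addr0 (dvecM oW Ww _ (CCk_metric_comp 1 i j) (CA i)).
by rewrite (dvec_comp xi (smooth_mx_CCk 1 i j sg) Ww) mxE mulrDl.
Qed.

Lemma dvecb_sesq_comp xi (A B : Cn R m -> 'cV[R[i]]_n) w : W w ->
  (forall i, CCk 1 W (fun y => A y i ord0)) ->
  (forall i, CCk 1 W (fun y => B y i ord0)) ->
  (forall i, dvecb xi (fun y => A y i ord0) w = 0) ->
  dvecb xi (fun y => sesq (g (F y)) (A y) (B y)) w =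
  dvecb (pushfwd xi w) (fun z => sesq (g z) (A w) (B w)) (F w) +
  sesq (g (F w)) (A w) (\col_i dvec xi (fun y => B y i ord0) w).
Proof using oU oW FU hF sg.
move=> Ww CA CB A0.
have C1 i j := CCkM oW (CCk_metric_comp 1 i j) (CA i).
have C2 i j := CCkM oW (C1 i j) (CCkJ oW (CB j)).
rewrite (dvecb_sum oW Ww) => [|i]; last by apply: CCk_sum oW _ => j; exact: C2.
rewrite (dvecb_sesq oU (FU Ww)) // -big_split; apply: eq_bigr => i _.
rewrite (dvecb_sum oW Ww) => [|j]; last exact: C2.
rewrite -big_split; apply: eq_bigr => j _.
rewrite (dvecbM oW Ww _ (C1 i j) (CCkJ oW (CB j))) (dvecbJ oW Ww _ (CB j)).
rewrite (dvecbM oW Ww _ (CCk_metric_comp 1 i j) (CA i)) A0 mulr0 addr0.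
by rewrite (dvecb_comp xi (smooth_mx_CCk 1 i j sg) Ww) mxE.
Qed.

End HolomorphicChainRule.

Section Pullback.
Variables (R : realType) (n m : nat).
Variables (F : Cn R m -> Cn R n) (U : set (Cn R n)) (W : set (Cn R m)).
Hypotheses (oU : open U) (oW : open W) (FU : forall y, W y -> U (F y)).
Hypothesis (hF : holomorphic_on W F).
Variables (g : Cn R n -> 'M[R[i]]_n) (g' : Cn R m -> 'M[R[i]]_m).
Hypothesis (sg : smooth_mx U g).
Hypothesis (g'E : forall y, W y -> forall xi eta,
  sesq (g' y) xi eta = sesq (g (F y)) (jacobian F y *m xi) (jacobian F y *m eta)).

Definition hessian xi w : 'cV[R[i]]_n :=
  \col_a dvec xi (fun y => (jacobian F y *m xi) a ord0) w.

(** Both sides are the same derivative of the length of a holomorphic curve,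
    measured before or after applying [F]: velocities are pushed forward by the
    differential, accelerations pick up the second derivative of [F]. *)
Lemma Nform_pullback w xi eta : W w ->
  Nform g' w xi eta =
  Nform g (F w) (jacobian F w *m xi) (jacobian F w *m eta - hessian xi w).
Proof using oU oW FU hF sg g'E.
move=> Ww; pose V := pushfwd F xi; pose E := pushfwd F eta.
pose D y : 'cV[R[i]]_n := \col_a dvec xi (fun y => V y a ord0) y.
have CV k a : CCk k W (fun y => V y a ord0) by exact: (CCk_pushfwd oW hF).
have CE k a : CCk k W (fun y => E y a ord0) by exact: (CCk_pushfwd oW hF).
have DE a : (fun y => D y a ord0) = dvec xi (fun y => V y a ord0).
  by apply/funext => y; rewrite mxE.
have CD k a : CCk k W (fun y => D y a ord0).
  by rewrite DE; exact: CCk_dvec oW (CV k.+1 a).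
have V0 a y : W y -> dvecb xi (fun y => V y a ord0) y = 0.
  exact: (dvecb_pushfwd oW hF).
have E0 a y : W y -> dvecb xi (fun y => E y a ord0) y = 0.
  exact: (dvecb_pushfwd oW hF).
have D0 a y : W y -> dvecb xi (fun y => D y a ord0) y = 0.
  move=> Wy; rewrite DE.
  exact: (dvecb_dvec_holomorphic oW xi (CV 2%N a) (fun t => V0 a t)).
have VE : jacobian F w *m xi = V w by [].
have EE : jacobian F w *m eta = E w by [].
have HE : hessian xi w = D w by [].
rewrite VE EE HE.
have T4 : sesq (g' w) eta eta = sesq (g (F w)) (E w) (E w) by rewrite g'E.
have T2 : dvec xi (fun y => sesq (g' y) xi eta) w =
    dvec (V w) (fun z => sesq (g z) (V w) (E w)) (F w) + sesq (g (F w)) (D w) (E w).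
  rewrite (eq_dvec xi oW (fun y Wy => g'E Wy xi eta) Ww).
  exact: (dvec_sesq_comp oU oW FU hF sg Ww (CV 1%N) (CE 1%N) (fun i => E0 i w Ww)).
have T3 : dvecb xi (fun y => sesq (g' y) eta xi) w =
    dvecb (V w) (fun z => sesq (g z) (E w) (V w)) (F w) + sesq (g (F w)) (E w) (D w).
  rewrite (eq_dvecb xi oW (fun y Wy => g'E Wy eta xi) Ww).
  exact: (dvecb_sesq_comp oU oW FU hF sg Ww (CE 1%N) (CV 1%N) (fun i => E0 i w Ww)).
pose gz l z := \matrix_(i, j) dzbar l (fun y => g y i j) z.
have sgz l : smooth_mx U (gz l) by exact: smooth_mx_dzbar.
have dvecbE v a b z : U z -> dvecb v (fun z => sesq (g z) a b) z =
    \sum_l conjc (v l ord0) * sesq (gz l z) a b.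
  move=> Uz; rewrite (dvecb_sesq oU Uz) //.
  under [RHS]eq_bigr do rewrite /sesq mulr_sumr.
  rewrite [RHS]exchange_big; apply: eq_bigr => i _ /=.
  under [RHS]eq_bigr do rewrite mulr_sumr.
  rewrite [RHS]exchange_big; apply: eq_bigr => j _ /=.
  rewrite /dvecb !mulr_suml; apply: eq_bigr => l _.
  by rewrite mxE !mulrA.
have T1a : forall y, W y -> dvecb xi (fun y => sesq (g' y) xi xi) y =
    (\sum_l conjc (V y l ord0) * sesq (gz l (F y)) (V y) (V y)) +
    sesq (g (F y)) (V y) (D y).
  move=> y Wy; rewrite (eq_dvecb xi oW (fun y Wy => g'E Wy xi xi) Wy).
  rewrite -dvecbE; last exact: FU.
  exact: (dvecb_sesq_comp oU oW FU hF sg Wy (CV 1%N) (CV 1%N) (fun i => V0 i y Wy)).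
have T1 : dvec xi (dvecb xi (fun y => sesq (g' y) xi xi)) w =
    dvec (V w) (dvecb (V w) (fun z => sesq (g z) (V w) (V w))) (F w) +
    dvecb (V w) (fun z => sesq (g z) (D w) (V w)) (F w) +
    dvec (V w) (fun z => sesq (g z) (V w) (D w)) (F w) +
    sesq (g (F w)) (D w) (D w).
  rewrite (eq_dvec xi oW T1a Ww).
  have Cs l := CCk_sesq_comp oU oW FU hF (sgz l) (CV 1%N) (CV 1%N).
  have Ct l := CCkM oW (CCkJ oW (CV 1%N l)) (Cs l).
  rewrite (dvecD oW Ww); first last.
  - exact: (CCk_sesq_comp oU oW FU hF sg (CV 1%N) (CD 1%N)).
  - exact: CCk_sum oW Ct.
  rewrite (dvec_sesq_comp oU oW FU hF sg Ww (CV 1%N) (CD 1%N) (fun i => D0 i w Ww)).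
  rewrite addrA -/(D w); congr (_ + _ + _).
  rewrite (dvec_sum oW Ww) // (eq_dvec _ oU (fun z Uz => dvecbE (V w) (V w) (V w) z Uz) (FU Ww)).
  have Cg l : CCk 1 U (fun z => sesq (gz l z) (V w) (V w)).
    by apply: CCk_sesq => // i; exact: CCk_cst.
  rewrite (dvec_sum oU (FU Ww)) => [|l]; last first.
    exact: (CCkM oU (CCk_cst _ _ _) (Cg l)).
  rewrite (dvecbE _ _ _ _ (FU Ww)) -big_split; apply: eq_bigr => l _ /=.
  rewrite (dvecM oW Ww _ (CCkJ oW (CV 1%N l)) (Cs l)) (dvecJ oW Ww _ (CV 1%N l)).
  rewrite V0 // conjc0 mul0r add0r.
  rewrite (dvec_sesq_comp oU oW FU hF (sgz l) Ww (CV 1%N) (CV 1%N) (fun i => V0 i w Ww)).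
  rewrite (dvecM oU (FU Ww) _ (CCk_cst _ _ _) (Cg l)) dvec_cst mul0r add0r.
  by rewrite mulrDr.
rewrite /Nform T1 T2 T3 T4.
have lin2 a b : dvec (V w) (fun z => sesq (g z) (V w) (a - b)) (F w) =
   dvec (V w) (fun z => sesq (g z) (V w) a) (F w) -
   dvec (V w) (fun z => sesq (g z) (V w) b) (F w).
  rewrite !(dvec_sesq oU (FU Ww)) // -sumrB; apply: eq_bigr => i _.
  by rewrite -sumrB; apply: eq_bigr => j _; rewrite !mxE conjcB mulrBr.
have lin3 a b : dvecb (V w) (fun z => sesq (g z) (a - b) (V w)) (F w) =
   dvecb (V w) (fun z => sesq (g z) a (V w)) (F w) -
   dvecb (V w) (fun z => sesq (g z) b (V w)) (F w).
  rewrite !(dvecb_sesq oU (FU Ww)) // -sumrB; apply: eq_bigr => i _.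
  by rewrite -sumrB; apply: eq_bigr => j _; rewrite !mxE mulrBr mulrBl.
rewrite lin2 lin3 sesqBl !sesqBr.
move: (dvec _ _ _) (dvec _ _ _) (dvec _ _ _) (dvecb _ _ _) (dvecb _ _ _).
move: (sesq _ _ _) (sesq _ _ _) (sesq _ _ _) (sesq _ _ _) => *; ring.
Qed.

End Pullback.

Section NformLinear.
Variables (R : realType) (n : nat).
Implicit Types (g : Cn R n -> 'M[R[i]]_n) (xi eta : 'cV[R[i]]_n).

Lemma Nform_add g g' U z xi eta (s : R[i]) : open U -> U z ->
  smooth_mx U g -> smooth_mx U g' ->
  Nform (fun y => g y + s *: g' y) z xi eta =
  Nform g z xi eta + s * Nform g' z xi eta.
Proof.
move=> oU Uz sg sg'; have Cs k h v w : smooth_mx U h -> CCk k U (fun y => sesq (h y) v w).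
  by move=> sh; apply: CCk_sesq => // i; exact: CCk_cst.
have E v w y : sesq (g y + s *: g' y) v w = sesq (g y) v w + sesq (g' y) v w * s.
  by rewrite sesqDm sesqZm mulrC.
have Csg k v w := CCkM oU (Cs k g' v w sg') (CCk_cst k U s).
have d1 v w x : dvec x (fun y => sesq (g y + s *: g' y) v w) z =
    dvec x (fun y => sesq (g y) v w) z + dvec x (fun y => sesq (g' y) v w) z * s.
  under eq_fun do rewrite E.
  by rewrite (dvecD oU Uz _ (Cs 1%N g v w sg) (Csg 1%N v w)) (dvecZr oU Uz _ _ (Cs 1%N g' v w sg')).
have d2 v w x y : U y -> dvecb x (fun y => sesq (g y + s *: g' y) v w) y =
    dvecb x (fun y => sesq (g y) v w) y + dvecb x (fun y => sesq (g' y) v w) y * s.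
  move=> Uy; under eq_fun do rewrite E.
  by rewrite (dvecbD oU Uy _ (Cs 1%N g v w sg) (Csg 1%N v w)) (dvecbZr oU Uy _ _ (Cs 1%N g' v w sg')).
rewrite /Nform d1 d2 // (eq_dvec xi oU (fun y => d2 xi xi xi y) Uz).
have Cb h : smooth_mx U h -> CCk 1 U (dvecb xi (fun y => sesq (h y) xi xi)).
  by move=> sh; exact: (CCk_dvecb xi oU (Cs 2%N h xi xi sh)).
rewrite (dvecD oU Uz _ (Cb g sg) (CCkM oU (Cb g' sg') (CCk_cst _ _ _))).
rewrite (dvecZr oU Uz _ _ (Cb g' sg')) E.
move: (dvec _ _ _) (dvec _ _ _) (dvec _ _ _) (dvec _ _ _) => *; ring.
Qed.

Lemma curvature_formZ g z xi (c : R) :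
  curvature_form g z (c%:C *: xi) = (c%:C) ^+ 4 * curvature_form g z xi.
Proof.
rewrite /curvature_form mulr_sumr; apply: eq_bigr => i _.
rewrite mulr_sumr; apply: eq_bigr => j _.
rewrite mulr_sumr; apply: eq_bigr => k _.
rewrite mulr_sumr; apply: eq_bigr => l _.
rewrite !mxE !conjcM conjc_real; move: (curvature _ _ _ _ _ _) => *; ring.
Qed.

Lemma hol_sect_curvature_gt0 g z xi : posdef_mx (g z) -> xi != 0 ->
  (0 < hol_sect_curvature g z xi) = (0 < curvature_form g z xi).
Proof.
move=> pg xi0; rewrite /hol_sect_curvature.
set d := (X in _ / X); have -> : d = sesq (g z) xi xi ^+ 2.
  rewrite expr2 {1}/sesq mulr_suml; apply: eq_bigr => i _.
  rewrite mulr_suml; apply: eq_bigr => j _.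
  rewrite mulr_sumr; apply: eq_bigr => k _.
  by rewrite mulr_sumr; apply: eq_bigr => l _; ring.
rewrite pmulr_lgt0 ?invr_gt0 ?exprn_gt0 ?pg //.
by rewrite pmulr_rgt0.
Qed.

End NformLinear.

(** * Holomorphic germs *)

Section Germs.
Variable (R : realType).

Definition holo_at n m (F : Cn R n -> Cn R m) z :=
  exists W, [/\ open W, W z & holomorphic_on W F].

Lemma holomorphic_on_sub n m (F : Cn R n -> Cn R m) (U W : set (Cn R n)) :
  W `<=` U -> holomorphic_on U F -> holomorphic_on W F.
Proof.
move=> WU hF a; have [sF dF] := hF a; split=> [k|k z /WU]; last exact: dF.
exact: CCk_sub WU (sF k).
Qed.

Lemma holomorphic_on_local n m (F : Cn R n -> Cn R m) U :
  (forall z, U z -> holo_at F z) -> holomorphic_on U F.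
Proof.
move=> hF a; split=> [k|k z /hF[W [oW Wz hW]]]; last first.
  by have [_ ->] := hW a.
apply: (CCk_local (U := U)) => z /hF[W [oW Wz hW]].
by exists (coord a \o F), W; split=> //; have [sF _] := hW a; exact: sF.
Qed.

Lemma holomorphic_on_at n m (F : Cn R n -> Cn R m) U z :
  open U -> U z -> holomorphic_on U F -> holo_at F z.
Proof. by move=> oU Uz hF; exists U. Qed.

Lemma holo_at_continuous n m (F : Cn R n -> Cn R m) z :
  holo_at F z -> {for z, continuous F}.
Proof. by move=> [W [oW Wz hF]]; exact: holomorphic_continuous hF Wz. Qed.

Lemma holo_at_clin n m (A : 'M[R[i]]_(m, n)) z : holo_at (clin A) z.
Proof. by exists setT; split=> //; [exact: openT|apply: clin_holomorphic; exact: openT]. Qed.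

Lemma open_continuous_preimage (S T : topologicalType) (f : S -> T) (A : set S)
    (B : set T) : open A -> open B -> (forall x, A x -> {for x, continuous f}) ->
  open (A `&` f @^-1` B).
Proof.
move=> oA oB cf; rewrite openE => x [Ax Bfx]; rewrite /interior.
apply: filterI; first exact: open_nbhs_nbhs.
by apply: (cf x Ax); exact: open_nbhs_nbhs.
Qed.

Lemma holo_at_comp n m p (F : Cn R n -> Cn R m) (G : Cn R m -> Cn R p) z :
  holo_at F z -> holo_at G (F z) -> holo_at (G \o F) z.
Proof.
move=> [W [oW Wz hF]] [U [oU Uz hG]].
have cF x : W x -> {for x, continuous F} by move=> Wx; apply: holo_at_continuous; exists W.
pose W' := W `&` F @^-1` U.
have oW' : open W' by exact: open_continuous_preimage.
have hF' : holomorphic_on W' F by apply: holomorphic_on_sub hF; exact: subIsetl.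
have FU y : W' y -> U (F y) by case.
exists W'; split=> // a; have [sG dG] := hG a; split=> [k|k y W'y].
  exact: (CCk_comp oU oW' FU (holomorphic_CCk hF' k) (sG k)).
rewrite (_ : coord a \o (G \o F) = fun y => coord a (G (F y))) //.
rewrite (dzbar_comp k oU oW' FU (holomorphic_CCk hF' 1) (sG 1%N) W'y).
rewrite big1 // => b _; rewrite (holomorphic_dzbar hF') // mulr0 add0r.
by rewrite (dG b (F y) (FU y W'y)) mul0r.
Qed.

Lemma near_eq_jacobian n m (F G : Cn R n -> Cn R m) z :
  (\near z, F z = G z) -> jacobian F z = jacobian G z.
Proof.
move=> FG; apply/matrixP => a k; rewrite !mxE; apply: near_eq_dz.
by apply: filterS FG => y /= ->.
Qed.

Lemma near_eq_holo_at n m (F G : Cn R n -> Cn R m) z :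
  (\near z, F z = G z) -> holo_at G z -> holo_at F z.
Proof.
move=> FG [W [oW Wz hG]].
have : nbhs z (W `&` [set y | F y = G y]).
  by apply: filterI => //; exact: open_nbhs_nbhs.
rewrite nbhsE => -[V [oV Vz] VW]; exists V; split=> // a.
have eFG : {in V, coord a \o F =1 coord a \o G}.
  by move=> y /set_mem/VW[_ /= ->].
have [sG dG] := hG a; split=> [k|k y Vy].
  apply: eq_CCk oV eFG _; apply: CCk_sub (sG k); by move=> y /VW[].
rewrite -(dG k y (VW y Vy).1); apply: near_eq_dzbar.
by apply: filterS (open_nbhs_nbhs (conj oV Vy)) => t Vt; rewrite eFG // inE.
Qed.

Lemma jacobian_comp n m p (F : Cn R n -> Cn R m) (G : Cn R m -> Cn R p) z :
  holo_at F z -> holo_at G (F z) ->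
  jacobian (G \o F) z = jacobian G (F z) *m jacobian F z.
Proof.
move=> [W [oW Wz hF]] [U [oU Uz hG]].
have cF x : W x -> {for x, continuous F} by move=> Wx; apply: holo_at_continuous; exists W.
pose W' := W `&` F @^-1` U.
have oW' : open W' by exact: open_continuous_preimage.
have hF' : holomorphic_on W' F by apply: holomorphic_on_sub hF; exact: subIsetl.
have FU y : W' y -> U (F y) by case.
have W'z : W' z by [].
apply/matrixP => a k; rewrite !mxE.
rewrite (_ : coord a \o (G \o F) = fun y => coord a (G (F y))) //.
have [sG dG] := hG a.
rewrite (dz_comp k oU oW' FU (holomorphic_CCk hF' 1) (sG 1%N) W'z).
apply: eq_bigr => b _; rewrite (holomorphic_dzbar hF') // conjc0 mulr0 addr0.
by rewrite !mxE.
Qed.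

End Germs.

(** * Charts *)

Section Charts.
Variable (R : realType).

Section OneChart.
Variables (M : topologicalType) (n : nat) (phi : chart R M n).

Lemma chart_codP p : chart_dom phi p -> chart_cod phi (chart_map phi p).
Proof. by exists p. Qed.

Lemma chart_inv_dom z : chart_cod phi z -> chart_dom phi (chart_inv phi z).
Proof. by move=> [p dp <-]; rewrite chart_mapK. Qed.

Lemma chart_invK z : chart_cod phi z -> chart_map phi (chart_inv phi z) = z.
Proof. by move=> [p dp <-]; rewrite chart_mapK. Qed.

Lemma open_chart_cod : open (chart_cod phi).
Proof. exact: chart_cod_open. Qed.

Lemma chart_map_near p (P : set (Cn R n)) : chart_dom phi p ->
  nbhs (chart_map phi p) P -> \forall q \near p, P (chart_map phi q).
Proof. by move=> dp; apply: (@chart_map_continuous _ _ _ phi _ dp). Qed.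

Lemma near_chart_dom p : chart_dom phi p -> \forall q \near p, chart_dom phi q.
Proof. by move=> dp; apply: open_nbhs_nbhs; split=> //; exact: chart_dom_open. Qed.

Lemma near_chart_cod p : chart_dom phi p ->
  \forall z \near chart_map phi p, chart_cod phi z.
Proof.
by move=> dp; apply: open_nbhs_nbhs; split; [exact: open_chart_cod|exact: chart_codP].
Qed.

End OneChart.

Section LocalMaps.
Variables (M N : topologicalType) (n m : nat).
Variables (phi : chart R M n) (psi : chart R N m) (f : M -> N).
Hypothesis cf : continuous f.

Lemma local_domE : local_dom phi psi f =
  chart_cod phi `&` (fun z => f (chart_inv phi z)) @^-1` chart_dom psi.
Proof.
apply/seteqP; split=> [_ [p [dp dfp] <-]|z [cz dfz]].
  by split; [exact: chart_codP|rewrite /= chart_mapK].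
exists (chart_inv phi z); last exact: chart_invK.
by split=> //; exact: chart_inv_dom.
Qed.

Lemma open_local_dom : open (local_dom phi psi f).
Proof.
rewrite local_domE; apply: open_continuous_preimage.
- exact: open_chart_cod.
- exact: chart_dom_open.
- move=> z cz; apply: continuous_comp; last exact: cf.
  exact: chart_inv_continuous.
Qed.

Lemma local_domP p : chart_dom phi p -> chart_dom psi (f p) ->
  local_dom phi psi f (chart_map phi p).
Proof. by move=> dp dfp; exists p. Qed.

Lemma local_mapE p : chart_dom phi p ->
  local_map phi psi f (chart_map phi p) = chart_map psi (f p).
Proof. by move=> dp; rewrite /local_map /= chart_mapK. Qed.

Definition hol_at p := holo_at (local_map phi psi f) (chart_map phi p).

Lemma holomorphic_in_at p : holomorphic_in phi psi f ->
  chart_dom phi p -> chart_dom psi (f p) -> hol_at p.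
Proof.
move=> hf dp dfp; apply: holomorphic_on_at hf; first exact: open_local_dom.
exact: local_domP.
Qed.

Lemma hol_at_holomorphic_in :
  (forall p, chart_dom phi p -> chart_dom psi (f p) -> hol_at p) ->
  holomorphic_in phi psi f.
Proof. by move=> hf; apply: holomorphic_on_local => _ [p [dp dfp] <-]; exact: hf. Qed.

End LocalMaps.

Section Composition.
Variables (M N P : topologicalType) (n m l : nat).
Variables (phi : chart R M n) (psi : chart R N m) (chi : chart R P l).
Variables (f : M -> N) (g : N -> P).
Hypothesis cf : continuous f.
Variable p : M.
Hypotheses (dp : chart_dom phi p) (dfp : chart_dom psi (f p)).

Lemma near_local_map_comp : \forall z \near chart_map phi p,
  local_map phi chi (g \o f) z = (local_map psi chi g \o local_map phi psi f) z.
Proof using cf dp dfp.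
have : nbhs (chart_map phi p) (local_dom phi psi f).
  apply: open_nbhs_nbhs; split; [exact: open_local_dom|exact: local_domP].
apply: filterS => z; rewrite local_domE => -[cz dfz].
by rewrite /local_map /= chart_mapK.
Qed.

Lemma hol_at_comp : hol_at phi psi f p -> hol_at psi chi g (f p) ->
  hol_at phi chi (g \o f) p.
Proof using cf dp dfp.
move=> hf hg; apply: near_eq_holo_at near_local_map_comp _.
by apply: holo_at_comp => //; rewrite local_mapE.
Qed.

Lemma differential_comp : hol_at phi psi f p -> hol_at psi chi g (f p) ->
  differential_in phi chi (g \o f) p =
  differential_in psi chi g (f p) *m differential_in phi psi f p.
Proof using cf dp dfp.
move=> hf hg; rewrite /differential_in (near_eq_jacobian near_local_map_comp).
by rewrite jacobian_comp ?local_mapE.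
Qed.

End Composition.

Lemma differential_id (M : topologicalType) n (phi : chart R M n) p :
  chart_dom phi p -> differential_in phi phi id p = 1%:M.
Proof.
move=> dp; rewrite /differential_in -(jacobian_clin 1%:M (chart_map phi p)).
apply: near_eq_jacobian; apply: filterS (near_chart_cod dp) => z cz.
by rewrite clin1 /local_map /= chart_invK.
Qed.

Lemma idfun_continuous (M : topologicalType) : continuous (@id M).
Proof. by move=> x; exact: cvg_id. Qed.

Section Manifold.
Variables (n : nat) (X : complexManifold R n).
Implicit Types (phi psi chi : chart R X n) (p : X).

Lemma atlas_holo_chart phi : atlas phi -> holo_chart phi.
Proof. by move=> aphi psi apsi; exact: atlas_compatible. Qed.

Lemma holo_chart_at p : exists2 phi, holo_chart phi & chart_dom phi p.
Proof.
have [phi aphi dp] := atlas_cover p; exists phi => //.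
exact: atlas_holo_chart.
Qed.

Lemma transition_hol_at phi psi p : holo_chart phi -> holo_chart psi ->
  chart_dom phi p -> chart_dom psi p -> hol_at phi psi id p.
Proof.
move=> hphi hpsi dphi dpsi; have [chi achi dchi] := atlas_cover p.
have c := @idfun_continuous X.
rewrite (_ : @id X = id \o id) //; apply: (hol_at_comp (psi := chi)) => //.
  apply: holomorphic_in_at => //; exact: (hphi chi achi).1.
apply: holomorphic_in_at => //; exact: (hpsi chi achi).2.
Qed.

Lemma transition_comp phi psi chi p :
  holo_chart phi -> holo_chart psi -> holo_chart chi ->
  chart_dom phi p -> chart_dom psi p -> chart_dom chi p ->
  differential_in psi chi id p *m differential_in phi psi id p =
  differential_in phi chi id p.
Proof.
move=> hphi hpsi hchi dphi dpsi dchi.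
rewrite -(@differential_comp _ _ _ _ _ _ phi psi chi id id) //.
- exact: idfun_continuous.
- exact: transition_hol_at.
- exact: transition_hol_at.
Qed.

Lemma transitionK phi psi p : holo_chart phi -> holo_chart psi ->
  chart_dom phi p -> chart_dom psi p ->
  differential_in psi phi id p *m differential_in phi psi id p = 1%:M.
Proof. by move=> *; rewrite transition_comp // differential_id. Qed.

End Manifold.

End Charts.

(** * Hermitian tensors as families of matrices *)

Section Tensors.
Variables (R : realType) (n : nat) (X : complexManifold R n).
Implicit Types (phi psi chi : chart R X n) (p : X).

(** A smooth field of Hermitian forms on the tangent spaces, not necessarily
    positive, given by its matrices in all charts. *)
Record herm_tensor (A : chart R X n -> X -> 'M[R[i]]_n) : Prop := HermTensor {
  tensor_smooth : forall phi, holo_chart phi ->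
    smooth_mx (chart_cod phi) (fun z => A phi (chart_inv phi z));
  tensor_hermitian : forall phi p, holo_chart phi -> chart_dom phi p ->
    hermitian_mx (A phi p);
  tensor_change : forall phi psi p, holo_chart phi -> holo_chart psi ->
    chart_dom phi p -> chart_dom psi p -> forall xi eta,
    sesq (A phi p) xi eta =
    sesq (A psi p) (differential_in phi psi id p *m xi)
                   (differential_in phi psi id p *m eta) }.

Definition tensor_mx (A : chart R X n -> X -> 'M[R[i]]_n) phi (z : Cn R n) :=
  A phi (chart_inv phi z).

Lemma tensor_change_local A phi chi : herm_tensor A ->
  holo_chart phi -> holo_chart chi ->
  forall y, local_dom phi chi id y -> forall xi eta,
  sesq (tensor_mx A phi y) xi eta =
  sesq (tensor_mx A chi (local_map phi chi id y))
    (jacobian (local_map phi chi id) y *m xi)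
    (jacobian (local_map phi chi id) y *m eta).
Proof.
move=> tA hphi hchi _ [p [dp dchip] <-] xi eta.
rewrite /tensor_mx local_mapE // !chart_mapK //.
exact: tensor_change.
Qed.

Lemma transition_holomorphic phi chi : holo_chart phi -> holo_chart chi ->
  holomorphic_on (local_dom phi chi id) (local_map phi chi id).
Proof.
move=> hphi hchi; apply: hol_at_holomorphic_in => p dp dchip.
exact: transition_hol_at.
Qed.

Lemma local_dom_cod phi chi y : local_dom phi chi id y ->
  chart_cod chi (local_map phi chi id y).
Proof. by move=> [p [dp dchip] <-]; rewrite local_mapE //; exact: chart_codP. Qed.

Lemma transition_near phi chi p U : holo_chart phi -> holo_chart chi ->
  chart_dom phi p -> chart_dom chi p -> open U -> U (chart_map chi p) ->
  exists W, [/\ open W, W (chart_map phi p), W `<=` local_dom phi chi id,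
    holomorphic_on W (local_map phi chi id) &
    forall y, W y -> U (local_map phi chi id y)].
Proof.
move=> hphi hchi dp dchi oU Up; pose F := local_map phi chi id.
have oL : open (local_dom phi chi id) by apply: open_local_dom; exact: idfun_continuous.
have hF := transition_holomorphic hphi hchi.
exists (local_dom phi chi id `&` F @^-1` U); split=> [|||| y []//].
- by apply: open_continuous_preimage => // x Lx; exact: holomorphic_continuous hF Lx.
- by split; [exact: local_domP|rewrite /= /F local_mapE].
- exact: subIsetl.
- by apply: holomorphic_on_sub hF; exact: subIsetl.
Qed.

(** The transition maps are holomorphic, so smoothness may be tested in any one
    chart around each point. *)
Lemma tensor_smooth_local (A : chart R X n -> X -> 'M[R[i]]_n) :
  (forall phi psi p, holo_chart phi -> holo_chart psi ->
    chart_dom phi p -> chart_dom psi p -> forall xi eta,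
    sesq (A phi p) xi eta =
    sesq (A psi p) (differential_in phi psi id p *m xi)
                   (differential_in phi psi id p *m eta)) ->
  (forall p, exists chi U, [/\ holo_chart chi, chart_dom chi p, open U,
     U (chart_map chi p) /\ U `<=` chart_cod chi & smooth_mx U (tensor_mx A chi)]) ->
  forall phi, holo_chart phi -> smooth_mx (chart_cod phi) (tensor_mx A phi).
Proof.
move=> Achange Aloc phi hphi i j k; apply: (CCk_local (U := chart_cod phi)).
move=> _ [p dp <-]; have [chi [U [hchi dchi oU [Up Ucod] sU]]] := Aloc p.
pose F := local_map phi chi id.
have [W [oW Wp WL hFW FU]] := transition_near hphi hchi dp dchi oU Up.
pose E (a : 'I_n) : 'cV[R[i]]_n := delta_mx a ord0.
exists (fun y => sesq (tensor_mx A chi (F y)) (pushfwd F (E i) y) (pushfwd F (E j) y)), W.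
split=> // [y /set_mem/WL[q [dq dchiq] <-]|].
  rewrite -sesq_delta /tensor_mx /F local_mapE // !chart_mapK //.
  by rewrite (Achange phi chi) // /pushfwd.
by apply: (CCk_sesq_comp oU oW FU hFW sU) => a; exact: CCk_pushfwd oW hFW _ _ _.
Qed.

(** The optimal test vector in the chart [chi], corrected by the second derivative
    of the transition map, tests the curvature in the chart [phi]. *)
Lemma curvature_gt0_chart A phi chi p : herm_tensor A ->
  holo_chart phi -> holo_chart chi -> chart_dom phi p -> chart_dom chi p ->
  posdef_mx (A phi p) -> posdef_mx (A chi p) ->
  (forall xi, xi != 0 ->
     0 < curvature_form (tensor_mx A chi) (chart_map chi p) xi) ->
  forall xi, xi != 0 ->
     0 < curvature_form (tensor_mx A phi) (chart_map phi p) xi.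
Proof.
move=> tA hphi hchi dphi dchi pphi pchi pos xi xi0.
pose F := local_map phi chi id; pose J := differential_in phi chi id p.
pose J' := differential_in chi phi id p.
have oL : open (local_dom phi chi id) by apply: open_local_dom; exact: idfun_continuous.
have oC : open (chart_cod chi) by exact: open_chart_cod.
have oCphi : open (chart_cod phi) by exact: open_chart_cod.
have Lp : local_dom phi chi id (chart_map phi p) by exact: local_domP.
have hF := transition_holomorphic hphi hchi.
have JE : jacobian F (chart_map phi p) = J by [].
have FE : F (chart_map phi p) = chart_map chi p by rewrite /F local_mapE.
have Jxi0 : J *m xi != 0.
  apply: contraNneq xi0 => E; rewrite -[xi]mul1mx.
  by rewrite -(transitionK hphi hchi dphi dchi) -mulmxA E mulmx0.
have gchi : tensor_mx A chi (chart_map chi p) = A chi p by rewrite /tensor_mx chart_mapK.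
have gphi : tensor_mx A phi (chart_map phi p) = A phi p by rewrite /tensor_mx chart_mapK.
have hermchi y : chart_cod chi y -> hermitian_mx (tensor_mx A chi y).
  by move=> cy; apply: tensor_hermitian => //; exact: chart_inv_dom.
have hermphi y : chart_cod phi y -> hermitian_mx (tensor_mx A phi y).
  by move=> cy; apply: tensor_hermitian => //; exact: chart_inv_dom.
pose kap := optimal (tensor_mx A chi) (chart_map chi p) (J *m xi).
pose eta := J' *m (kap + hessian F xi (chart_map phi p)).
have Jeta : J *m eta - hessian F xi (chart_map phi p) = kap.
  by rewrite /eta mulmxA (transitionK hchi hphi dchi dphi) mul1mx addrK.
have NE := Nform_pullback oC oL (@local_dom_cod phi chi) hF
  (tensor_smooth tA hchi) (tensor_change_local tA hphi hchi) xi eta Lp.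
have codp : chart_cod chi (chart_map chi p) by exact: chart_codP.
have codphi : chart_cod phi (chart_map phi p) by exact: chart_codP.
have uchi : tensor_mx A chi (chart_map chi p) \in unitmx.
  by rewrite gchi; exact: posdef_unitmx.
rewrite -/F JE Jeta FE in NE.
rewrite -(Nform_optimal oC codp (tensor_smooth tA hchi) hermchi _ uchi) in NE.
have /lt_le_trans := pos _ Jxi0; apply.
rewrite -NE; apply: (Nform_le_curvature_form oCphi) => //.
- exact: tensor_smooth.
- by rewrite gphi.
Qed.

Section MetricOfTensor.
Variable A : chart R X n -> X -> 'M[R[i]]_n.
Hypothesis tA : herm_tensor A.
Hypothesis pA : forall phi p, holo_chart phi -> chart_dom phi p -> posdef_mx (A phi p).

Program Definition metric_of_tensor : hermitian_metric (@tangent R n X) :=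
  @HermitianMetric _ _ _ _ (fun phi p xi eta => sesq (A phi p) xi eta) _ _ _ _ _.
Next Obligation. by move=> *; rewrite /= sesqDl sesqZl. Qed.
Next Obligation. by move=> *; apply: sesq_herm; exact: tensor_hermitian. Qed.
Next Obligation. by move=> *; apply: pA. Qed.
Next Obligation.
move=> phi psi p hphi hpsi dphi dpsi xi eta _ _ /=.
by rewrite -(tensor_change tA hphi hpsi dphi dpsi).
Qed.
Next Obligation.
move=> phi hphi U V W oU Ucod sV sW _ _ k.
apply: (CCk_sesq oU _ (fun i => sV i k) (fun i => sW i k)) => i j l.
exact: CCk_sub Ucod (tensor_smooth tA hphi i j l).
Qed.

Lemma metric_mx_of_tensor phi : metric_mx metric_of_tensor phi = tensor_mx A phi.
Proof. by apply/funext => z; apply/matrixP => i j; rewrite mxE /= sesq_delta. Qed.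

Lemma positive_hsc_of_tensor :
  (forall p, exists chi, [/\ holo_chart chi, chart_dom chi p & forall xi, xi != 0 ->
     0 < curvature_form (tensor_mx A chi) (chart_map chi p) xi]) ->
  positive_hsc metric_of_tensor.
Proof.
move=> pos phi p hphi dphi xi xi0; have [chi [hchi dchi poschi]] := pos p.
rewrite metric_mx_of_tensor hol_sect_curvature_gt0 //; last first.
  by rewrite /tensor_mx chart_mapK //; exact: pA.
by apply: (curvature_gt0_chart tA hphi hchi dphi dchi) => //; exact: pA.
Qed.

End MetricOfTensor.

Section TensorOfMetric.
Variable h : hermitian_metric (@tangent R n X).

Definition tensor_of_metric phi p : 'M[R[i]]_n :=
  \matrix_(i, j) h phi p (delta_mx i ord0) (delta_mx j ord0).

Lemma tensor_of_metricE phi p xi eta : holo_chart phi -> chart_dom phi p ->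
  sesq (tensor_of_metric phi p) xi eta = h phi p xi eta.
Proof.
move=> hphi dp.
apply: sesq_mx => [a v v' w|v w]; first exact: metric_linear.
exact: metric_hermitian.
Qed.

Lemma tensor_of_metric_herm_tensor : herm_tensor tensor_of_metric.
Proof.
split.
- move=> phi hphi i j.
  have S : smooth (chart_cod phi) (fun z => h phi (chart_inv phi z)
      (delta_mx i ord0) (delta_mx j ord0)).
    apply: (@metric_smooth _ _ _ _ h phi hphi _ (fun=> delta_mx i ord0) (fun=> delta_mx j ord0)) => //.
    - exact: open_chart_cod.
    - by move=> a k; exact: CCk_cst.
    - by move=> a k; exact: CCk_cst.
  suff E : (fun z => tensor_of_metric phi (chart_inv phi z) i j) =
    (fun z => h phi (chart_inv phi z) (delta_mx i ord0) (delta_mx j ord0)).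
    by rewrite E.
  by apply/funext => z; rewrite mxE.
- by move=> phi p hphi dp i j; rewrite !mxE; exact: metric_hermitian.
- move=> phi psi p hphi hpsi dphi dpsi xi eta.
  by rewrite !tensor_of_metricE // metric_change.
Qed.

Lemma tensor_of_metric_posdef phi p : holo_chart phi -> chart_dom phi p ->
  posdef_mx (tensor_of_metric phi p).
Proof. by move=> hphi dp v v0; rewrite tensor_of_metricE //; exact: metric_positive. Qed.

Lemma metric_mxE phi : metric_mx h phi = tensor_mx tensor_of_metric phi.
Proof. by []. Qed.

End TensorOfMetric.

End Tensors.

(** * Charts adapted to a submersion *)

Section Splitting.
Variable K0 : fieldType.

(** Complementary injections and projections for the exact sequence
    [0 -> ker J -> K0^n -> K0^m -> 0]: [B] splits [J], and [K], [L] are the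
    inclusion of the kernel and the projection onto it along the image of [B]. *)
Definition splits n m r (J : 'M[K0]_(m, n)) (B : 'M[K0]_(n, m))
    (K : 'M[K0]_(n, r)) (L : 'M[K0]_(r, n)) :=
  [/\ J *m B = 1%:M, L *m K = 1%:M, J *m K = 0, L *m B = 0 &
      B *m J + K *m L = 1%:M].

Lemma surjective_splits n m (J : 'M[K0]_(m, n)) :
  (forall eta : 'cV_m, exists xi : 'cV_n, J *m xi = eta) ->
  exists (B : 'M[K0]_(n, m)) (K : 'M[K0]_(n, (n - m)%N)) (L : 'M[K0]_((n - m)%N, n)),
    splits J B K L.
Proof.
move=> Jsurj.
have [B JB] : exists B : 'M[K0]_(n, m), J *m B = 1%:M.
  have /choice[b Jb] : forall j : 'I_m, exists xi : 'cV_n, J *m xi = delta_mx j ord0.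
    by move=> j; exact: Jsurj.
  exists (\matrix_(i, j) b j i ord0); apply/matrixP => i j.
  have := congr1 (fun v : 'cV_m => v i ord0) (Jb j); rewrite !mxE eqxx andbT => <-.
  by apply: eq_bigr => k _; rewrite mxE.
pose P := 1%:M - B *m J.
have JP : J *m P = 0 by rewrite mulmxBr mulmx1 mulmxA JB mul1mx subrr.
have PB : P *m B = 0 by rewrite mulmxBl mul1mx -mulmxA JB mulmx1 subrr.
have PP : P *m P = P by rewrite {1}/P mulmxBl mul1mx -mulmxA JP mulmx0 subr0.
(* a rank factorization of the projection onto the kernel *)
pose K := col_base P; pose L := row_base P.
have KL : K *m L = P by exact: mulmx_base.
have JK : J *m K = 0.
  by apply: (row_free_inj (row_base_free P)); rewrite -mulmxA KL JP mul0mx.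
have LB : L *m B = 0.
  by apply: (row_full_inj (col_base_full P)); rewrite mulmxA KL PB mulmx0.
have LK : L *m K = 1%:M.
  apply: (row_full_inj (col_base_full P)).
  apply: (row_free_inj (row_base_free P)).
  have E : K *m (L *m K) *m L = K *m L by rewrite mulmxA KL -mulmxA KL PP.
  by rewrite mulmx1.
have sum1 : B *m J + K *m L = 1%:M by rewrite KL /P addrC subrK.
have E1 : col_mx J L *m row_mx B K = 1%:M.
  by rewrite mul_col_row JB JK LB LK -scalar_mx_block.
have E2 : row_mx B K *m col_mx J L = 1%:M by rewrite mul_row_col.
have nE : (m + \rank P)%N = n.
  by apply/eqP; rewrite eqn_leq (mulmx1_min E1) (mulmx1_min E2).
have -> : (n - m)%N = \rank P by rewrite -{1}nE addKn.
by exists B, K, L.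
Qed.

End Splitting.

Section Affine.
Variables (R : realType) (n m : nat) (a : Cn R m) (A : 'M[R[i]]_(m, n)).

Definition caff (z : Cn R n) : Cn R m := a + clin A z.

Lemma caff_holomorphic (U : set (Cn R n)) : open U -> holomorphic_on U caff.
Proof.
move=> oU b.
have E : coord b \o caff = fun z => coord b a + coord b (clin A z).
  by apply/funext => z; rewrite /= coordD.
rewrite E; split=> [k|k z Uz].
  exact: (CCkD oU (CCk_cst k U (coord b a)) (CCk_clin A k b oU)).
rewrite (dzbarD oU Uz k (CCk_cst _ _ _) (CCk_clin A 1 b oU)) dzbar_cst add0r.
exact: dzbar_clin.
Qed.

Lemma holo_at_caff z : holo_at caff z.
Proof. by exists setT; split; [exact: openT| |apply: caff_holomorphic; exact: openT]. Qed.

Lemma jacobian_caff z : jacobian caff z = A.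
Proof.
apply/matrixP => b k; rewrite mxE.
have E : coord b \o caff = fun z => coord b a + coord b (clin A z).
  by apply/funext => y; rewrite /= coordD.
rewrite E (dzD (@openT _) (I : setT z) k (CCk_cst _ _ _) (CCk_clin A 1 b (@openT _))).
by rewrite dz_cst add0r dz_clin.
Qed.

End Affine.

Lemma clinDm (R : realType) n m (A A' : 'M[R[i]]_(m, n)) z :
  clin (A + A') z = clin A z + clin A' z.
Proof. by apply: eq_coord => a; rewrite coordD !coord_rvec mulmxDl mxE. Qed.

Lemma clin0m (R : realType) n m (z : Cn R n) : clin (0 : 'M[R[i]]_(m, n)) z = 0.
Proof. by rewrite /clin mul0mx rvec0. Qed.

Lemma continuous_clin (R : realType) n m (A : 'M[R[i]]_(m, n)) : continuous (clin A).
Proof. by move=> z; apply: holo_at_continuous; exact: holo_at_clin. Qed.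

Section Submersions.
Variables (R : realType) (n m : nat).
Variables (X : complexManifold R n) (Y : complexManifold R m) (f : X -> Y).
Hypotheses (hol_f : holomorphic f) (sub_f : submersion f).

Definition adapted (chi : chart R X n) (psi : chart R Y m) (J : 'M[R[i]]_(m, n)) :=
  [/\ holo_chart chi, holo_chart psi,
      forall q, chart_dom chi q -> chart_dom psi (f q) &
      forall q, chart_dom chi q -> chart_map psi (f q) = clin J (chart_map chi q)].

Lemma f_hol_at phi psi p : holo_chart phi -> holo_chart psi ->
  chart_dom phi p -> chart_dom psi (f p) -> hol_at phi psi f p.
Proof using hol_f.
move=> hphi hpsi dp dfp; apply: holomorphic_in_at => //; first exact: hol_f.1.
exact: hol_f.2.
Qed.

(** In any charts, with [F] the expression of [f], the map [z |-> B F(z) + K L z]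
    has derivative [B J + K L = 1] at the given point, hence is a change of
    coordinates near it, and [J] maps it to [F(z)]. *)
Lemma adapted_chart p : exists (chi : chart R X n) (psi : chart R Y m) (J : 'M[R[i]]_(m, n))
  (B : 'M[R[i]]_(n, m)) (K : 'M[R[i]]_(n, (n - m)%N)) (L : 'M[R[i]]_((n - m)%N, n)),
  [/\ chart_dom chi p, adapted chi psi J & splits J B K L].
Proof using hol_f sub_f.
have [phi hphi dp] := holo_chart_at p.
have [psi hpsi dfp] := holo_chart_at (f p).
pose F := local_map phi psi f; pose W := local_dom phi psi f.
have oW : open W by apply: open_local_dom; exact: hol_f.1.
have hF : holomorphic_on W F by exact: hol_f.2.
pose J := differential_in phi psi f p.
have [B [K [L spl]]] := surjective_splits (sub_f hphi hpsi dp dfp).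
have [JB LK JK LB sum1] := spl.
pose G z := clin B (F z) + clin (K *m L) z.
have Wp : W (chart_map phi p) by exact: local_domP.
have coordG a z : coord a (G z) = coord a (clin B (F z)) + coord a (clin (K *m L) z).
  by rewrite coordD.
have hBF : holomorphic_on W (clin B \o F).
  apply: holomorphic_on_local => z Wz; apply: holo_at_comp; last exact: holo_at_clin.
  exact: holomorphic_on_at hF.
have CBF k a : CCk k W (fun z => coord a (clin B (F z))) by have [sB _] := hBF a; exact: sB.
have CKL k a : CCk k W (fun z => coord a (clin (K *m L) z)) by exact: CCk_clin.
have GE a : coord a \o G = fun z => coord a (clin B (F z)) + coord a (clin (K *m L) z).
  by apply/funext => z; rewrite /= coordG.
have hG : holomorphic_on W G.
  move=> a; rewrite GE; split=> [k|k z Wz]; first exact: CCkD.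
  rewrite (dzbarD oW Wz k (CBF 1%N a) (CKL 1%N a)) dzbar_clin addr0.
  by have [_ dB] := hBF a; exact: dB.
have JG : jacobian G (chart_map phi p) = 1%:M.
  have JBF : jacobian (clin B \o F) (chart_map phi p) =
      B *m differential_in phi psi f p.
    rewrite jacobian_comp ?jacobian_clin //; first exact: holomorphic_on_at hF.
    exact: holo_at_clin.
  rewrite -sum1 -JBF; apply/matrixP => a k; rewrite mxE GE [RHS]mxE mxE.
  rewrite (dzD oW Wp k (CBF 1%N a) (CKL 1%N a)) dz_clin.
  by [].
have [Q [H [[oQ Qp QW oGQ] [HG cH hH]]]] := holomorphic_inverse oW Wp hG JG.
have cphi : W `<=` chart_cod phi.
  by rewrite /W local_domE => z [].
pose D : set X := chart_dom phi `&` chart_map phi @^-1` Q.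
have oD : open D.
  apply: open_continuous_preimage => //; first exact: chart_dom_open.
  by move=> q dq; exact: chart_map_continuous.
pose cm q := G (chart_map phi q); pose ci z := chart_inv phi (H z).
have imD : cm @` D = G @` Q.
  apply/seteqP; split=> [_ [q [dq Qq] <-]|_ [z Qz <-]]; first by exists (chart_map phi q).
  have cz := cphi _ (QW _ Qz).
  exists (chart_inv phi z); last by rewrite /cm chart_invK.
  by split; [exact: chart_inv_dom|rewrite /= chart_invK].
have ocod : open (cm @` D) by rewrite imD.
have cK q : D q -> ci (cm q) = q.
  by move=> [dq Qq]; rewrite /ci /cm HG // chart_mapK.
have ccm q : D q -> {for q, continuous cm}.
  move=> [dq Qq]; apply: continuous_comp; first exact: chart_map_continuous.
  apply: holo_at_continuous; apply: holomorphic_on_at hG => //; exact: QW.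
have cci z : (cm @` D) z -> {for z, continuous ci}.
  rewrite imD => GQz; apply: continuous_comp; first exact: cH.
  apply: chart_inv_continuous; have [t Qt <-] := GQz.
  by rewrite HG //; apply: cphi; exact: QW.
pose chi := Chart oD ocod cK ccm cci.
have dchi : chart_dom chi p by [].
have hG_at q : chart_dom chi q -> holo_at G (chart_map phi q).
  by move=> [dq Qq]; apply: holomorphic_on_at hG => //; exact: QW.
have hH_at q : chart_dom chi q -> holo_at H (chart_map chi q).
  by move=> [dq Qq]; apply: holomorphic_on_at hH => //; exists (chart_map phi q).
have hchi : holo_chart chi.
  move=> psi' apsi'; have hpsi' := atlas_holo_chart apsi'; split.
    apply: hol_at_holomorphic_in => q dq dq'.
    have [dphiq Qq] := dq.
    have : holo_at (local_map phi psi' id \o H) (chart_map chi q).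
      apply: holo_at_comp; first exact: hH_at.
      by rewrite [H _]HG //; apply: transition_hol_at.
    by [].
  apply: hol_at_holomorphic_in => q dq' dq.
  have [dphiq Qq] := dq.
  have : holo_at (G \o local_map psi' phi id) (chart_map psi' q).
    apply: holo_at_comp; first exact: transition_hol_at.
    by rewrite local_mapE //; exact: hG_at.
  by [].
exists chi, psi, J, B, K, L; split=> //; split=> // q [dq Qq].
  have := QW _ Qq; rewrite /W local_domE => -[_ /=].
  by rewrite chart_mapK.
rewrite -[chart_map chi q]/(G (chart_map phi q)) /G clinD !clinM JB clin1 mulmxA JK.
rewrite mul0mx clin0m addr0.
by rewrite -[F _]/(chart_map psi (f (chart_inv phi (chart_map phi q)))) chart_mapK.
Qed.

Lemma verticalP phi psi q xi : holo_chart phi -> holo_chart psi ->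
  chart_dom phi q -> chart_dom psi (f q) ->
  vertical f phi q xi <-> differential_in phi psi f q *m xi = 0.
Proof using hol_f.
move=> hphi hpsi dq dfq; split=> [/(_ psi hpsi dfq)//|E psi' hpsi' dfq'].
have -> : differential_in phi psi' f q =
    differential_in psi psi' id (f q) *m differential_in phi psi f q.
  apply: (@differential_comp _ _ _ _ _ _ _ phi psi psi' f id) => //.
  - exact: hol_f.1.
  - exact: f_hol_at.
  - exact: transition_hol_at.
by rewrite -mulmxA E mulmx0.
Qed.

Section Adapted.
Variables (chi : chart R X n) (psi : chart R Y m) (J : 'M[R[i]]_(m, n)).
Hypothesis ad : adapted chi psi J.

Lemma adapted_local_map z : chart_cod chi z -> local_map chi psi f z = clin J z.
Proof using ad.
move=> cz; have [_ _ _ lin] := ad.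
by rewrite /local_map /= lin ?chart_invK //; exact: chart_inv_dom.
Qed.

Lemma adapted_differential q : chart_dom chi q -> differential_in chi psi f q = J.
Proof using ad.
move=> dq; rewrite /differential_in -(jacobian_clin J (chart_map chi q)).
apply: near_eq_jacobian; apply: filterS (near_chart_cod dq) => z.
exact: adapted_local_map.
Qed.

Lemma adapted_vertical q xi : chart_dom chi q ->
  vertical f chi q xi <-> J *m xi = 0.
Proof using ad hol_f.
have [hchi hpsi dpsi _] := ad; move=> dq.
by have := verticalP xi hchi hpsi dq (dpsi q dq); rewrite adapted_differential.
Qed.

End Adapted.

Lemma vertical_change phi phi' q xi : holo_chart phi -> holo_chart phi' ->
  chart_dom phi q -> chart_dom phi' q -> vertical f phi q xi ->
  vertical f phi' q (differential_in phi phi' id q *m xi).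
Proof using hol_f.
move=> hphi hphi' dq dq' vxi psi hpsi dpsi.
rewrite mulmxA -(@differential_comp _ _ _ _ _ _ _ phi phi' psi id f) //.
- exact: vxi.
- exact: idfun_continuous.
- exact: transition_hol_at.
- exact: f_hol_at.
Qed.

(** * Charts of the fibers *)

Section FiberChart.
Variables (chi : chart R X n) (psi : chart R Y m) (J : 'M[R[i]]_(m, n)).
Variables (B : 'M[R[i]]_(n, m)) (K : 'M[R[i]]_(n, (n - m)%N)) (L : 'M[R[i]]_((n - m)%N, n)).
Hypotheses (ad : adapted chi psi J) (spl : splits J B K L).
Variables (t : Y) (p0 : fiber f t).
Hypothesis dp0 : chart_dom chi (fiber_incl p0).

Lemma fiber_inclP (p : fiber f t) : f (fiber_incl p) = t.
Proof. by have := set_valP p. Qed.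

Lemma continuous_fiber_incl : continuous (@fiber_incl R n m X Y f t).
Proof. exact: initial_continuous. Qed.

(** Parametrizes the part of the chart [chi] lying over [t]. *)
Definition slice := caff (clin B (chart_map psi t)) K.

Definition fiber_dom : set (fiber f t) := @fiber_incl R n m X Y f t @^-1` chart_dom chi.
Definition fiber_map (p : fiber f t) := clin L (chart_map chi (fiber_incl p)).
(** The point [p0] is a default value. *)
Definition fiber_inv w : fiber f t := insubd p0 (chart_inv chi (slice w)).

Lemma fiber_mapK_slice p : fiber_dom p ->
  slice (fiber_map p) = chart_map chi (fiber_incl p).
Proof using ad spl.
have [_ _ _ lin] := ad; have [_ _ _ _ sum1] := spl.
move=> dp; rewrite /slice /caff /fiber_map clinM -{1}(fiber_inclP p) lin // clinM.
by rewrite -clinDm sum1 clin1.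
Qed.

Lemma slice_fiber w : chart_cod chi (slice w) -> f (chart_inv chi (slice w)) = t.
Proof using ad spl dp0.
move=> cw; have [_ hpsi dpsi lin] := ad; have [JB _ JK _ _] := spl.
have dt : chart_dom psi t by rewrite -(fiber_inclP p0); exact: dpsi.
have dw := chart_inv_dom cw.
have E : chart_map psi (f (chart_inv chi (slice w))) = chart_map psi t.
  by rewrite lin // chart_invK // /slice /caff clinD !clinM JB JK clin1 clin0m addr0.
by rewrite -(chart_mapK (dpsi _ dw)) E chart_mapK.
Qed.

Lemma fiber_inv_val w : chart_cod chi (slice w) ->
  fiber_incl (fiber_inv w) = chart_inv chi (slice w).
Proof using ad spl dp0.
move=> cw; rewrite /fiber_incl /fiber_inv set_valE insubdK //.
by apply: mem_set; exact: slice_fiber.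
Qed.

Lemma fiber_codE : fiber_map @` fiber_dom = slice @^-1` chart_cod chi.
Proof using ad spl dp0.
have [_ LK _ LB _] := spl.
apply/seteqP; split=> [_ [p dp <-]|w cw].
  by rewrite /= fiber_mapK_slice //; exact: chart_codP.
exists (fiber_inv w); first by rewrite /fiber_dom /= fiber_inv_val //; exact: chart_inv_dom.
by rewrite /fiber_map fiber_inv_val // chart_invK // /slice /caff clinD !clinM LB LK
  clin1 clin0m add0r.
Qed.

Lemma continuous_slice : continuous slice.
Proof. by move=> w; apply: holo_at_continuous; exact: holo_at_caff. Qed.

Lemma fiber_dom_open : open fiber_dom.
Proof.
by apply: open_comp; [move=> ? _; exact: continuous_fiber_incl|exact: chart_dom_open].
Qed.

Lemma fiber_cod_open : open (fiber_map @` fiber_dom).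
Proof using ad spl dp0.
rewrite fiber_codE; apply: open_comp; last exact: open_chart_cod.
by move=> ? _; exact: continuous_slice.
Qed.

Lemma fiber_mapK p : fiber_dom p -> fiber_inv (fiber_map p) = p.
Proof using ad spl dp0.
move=> dp; apply: val_inj; rewrite -[val _]/(fiber_incl (fiber_inv (fiber_map p))).
rewrite fiber_inv_val fiber_mapK_slice ?chart_mapK //; exact: chart_codP.
Qed.

Lemma fiber_map_continuous p : fiber_dom p -> {for p, continuous fiber_map}.
Proof.
move=> dp; apply: continuous_comp; last exact: continuous_clin.
by apply: continuous_comp; [exact: continuous_fiber_incl|exact: chart_map_continuous].
Qed.

Lemma fiber_inv_continuous w : (fiber_map @` fiber_dom) w ->
  {for w, continuous fiber_inv}.
Proof using ad spl dp0.
rewrite fiber_codE => cw A [_ [ [V oV <-] /= Vw VA]].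
have cinv : {for w, continuous (fun w => chart_inv chi (slice w))}.
  by apply: continuous_comp; [exact: continuous_slice|exact: chart_inv_continuous].
have n1 : \forall w' \near w, V (chart_inv chi (slice w')).
  apply: cinv; apply: open_nbhs_nbhs; split=> //.
  by rewrite -fiber_inv_val.
have n2 : \forall w' \near w, chart_cod chi (slice w').
  by apply: continuous_slice; apply: open_nbhs_nbhs; split=> //; exact: open_chart_cod.
apply: filterS2 n1 n2 => w' Vw' cw'; apply: VA => /=.
by rewrite -[set_val _]/(fiber_incl (fiber_inv w')) fiber_inv_val.
Qed.

Definition slice_chart : chart R (fiber f t) (n - m)%N :=
  Chart fiber_dom_open fiber_cod_open fiber_mapK fiber_map_continuous
    fiber_inv_continuous.

Lemma slice_chart_cod w : chart_cod slice_chart w -> chart_cod chi (slice w).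
Proof using ad spl dp0.
by move=> cw; have : (fiber_map @` fiber_dom) w := cw; rewrite fiber_codE.
Qed.

Lemma slice_local_map (phi : chart R X n) w : chart_cod slice_chart w ->
  local_map slice_chart phi (@fiber_incl R n m X Y f t) w =
  (local_map chi phi id \o slice) w.
Proof using ad spl dp0.
by move=> /slice_chart_cod cw; rewrite /local_map /= fiber_inv_val.
Qed.

Lemma slice_hol_at phi p : holo_chart phi -> fiber_dom p ->
  chart_dom phi (fiber_incl p) ->
  hol_at slice_chart phi (@fiber_incl R n m X Y f t) p.
Proof using ad spl dp0.
have [hchi _ _ _] := ad.
move=> hphi dp dphi; have dp' : chart_dom slice_chart p by [].
apply: near_eq_holo_at.
  apply: filterS (near_chart_cod dp') => w; exact: slice_local_map.
apply: holo_at_comp; first exact: holo_at_caff.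
by rewrite fiber_mapK_slice //; exact: transition_hol_at.
Qed.

Lemma slice_differential phi p : holo_chart phi -> fiber_dom p ->
  chart_dom phi (fiber_incl p) ->
  differential_in slice_chart phi (@fiber_incl R n m X Y f t) p =
  differential_in chi phi id (fiber_incl p) *m K.
Proof using ad spl dp0.
have [hchi _ _ _] := ad.
move=> hphi dp dphi; have dp' : chart_dom slice_chart p by [].
rewrite /differential_in.
rewrite (near_eq_jacobian (G := local_map chi phi id \o slice)); last first.
  apply: filterS (near_chart_cod dp') => w; exact: slice_local_map.
rewrite jacobian_comp; first last.
- by rewrite fiber_mapK_slice //; exact: transition_hol_at.
- exact: holo_at_caff.
by rewrite jacobian_caff fiber_mapK_slice.
Qed.

Lemma slice_fiber_chart : fiber_chart slice_chart.
Proof using ad spl dp0.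
have [hchi _ _ _] := ad; have [_ LK _ _ _] := spl.
move=> phi hphi; split.
  by apply: hol_at_holomorphic_in => p dp dphi; exact: slice_hol_at.
move=> p dp dphi xi; rewrite slice_differential // -mulmxA => E.
have /(congr1 (mulmx (differential_in phi chi id (fiber_incl p)))) := E.
rewrite mulmxA transitionK // mul1mx mulmx0 => /(congr1 (mulmx L)).
by rewrite mulmxA LK mul1mx mulmx0.
Qed.

Variable (G : hermitian_metric (vertical f)).
Variable (A : chart R X n -> X -> 'M[R[i]]_n).
Hypothesis tA : herm_tensor A.
Hypothesis restrA : forall phi p xi eta, holo_chart phi -> chart_dom phi p ->
  vertical f phi p xi -> vertical f phi p eta -> sesq (A phi p) xi eta = G phi p xi eta.

Lemma slice_metricE w : chart_cod slice_chart w -> forall xi eta,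
  sesq (fiber_metric_mx G slice_chart chi w) xi eta =
  sesq (tensor_mx A chi (slice w)) (K *m xi) (K *m eta).
Proof using ad spl dp0 tA restrA hol_f.
have [hchi _ _ _] := ad; have [_ _ JK _ _] := spl.
move=> cw xi eta; have [p dp wE] := cw.
have cw' := slice_chart_cod cw.
have Jac : jacobian (local_map slice_chart chi (@fiber_incl R n m X Y f t)) w = K.
  rewrite -wE -[LHS]/(differential_in slice_chart chi (@fiber_incl R n m X Y f t) p).
  by rewrite slice_differential // differential_id // mul1mx.
have dq := chart_inv_dom cw'.
have vert v : vertical f chi (chart_inv chi (slice w)) (K *m v).
  by apply/(adapted_vertical ad) => //; rewrite mulmxA JK mul0mx.
pose b x y := sesq (tensor_mx A chi (slice w)) (K *m x) (K *m y).
have E : fiber_metric_mx G slice_chart chi w =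
    \matrix_(i, j) b (delta_mx i ord0) (delta_mx j ord0).
  apply/matrixP => i j; rewrite !mxE Jac /= fiber_inv_val //.
  by rewrite /b /tensor_mx restrA // -!colE.
rewrite E -[RHS]/(b xi eta); apply: sesq_mx => [c x y z|x y].
- by rewrite /b mulmxDr -scalemxAr sesqDl sesqZl.
- by apply: sesq_herm; exact: tensor_hermitian.
Qed.

Hypothesis posG : fibers_positive_hsc G.

(** The inclusion of the fiber is affine in the adapted chart, so its second
    derivative vanishes, and the optimal test vector of the fiber at [L xi] is sent by
    [K] to a vertical test vector for the extension [A] of [G]. *)
Lemma fiber_Nform_gt0 xi : J *m xi = 0 -> xi != 0 -> exists2 eta, J *m eta = 0 &
  0 < Nform (tensor_mx A chi) (chart_map chi (fiber_incl p0)) xi eta.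
Proof using ad spl dp0 tA restrA hol_f posG.
have [hchi _ _ _] := ad; have [_ LK JK _ sum1] := spl.
move=> Jxi xi0; pose v := L *m xi.
have Kv : K *m v = xi.
  by rewrite -[RHS]mul1mx -sum1 mulmxDl -mulmxA Jxi mulmx0 add0r -mulmxA.
have v0 : v != 0 by apply: contraNneq xi0 => E; rewrite -Kv E mulmx0.
pose gf := fiber_metric_mx G slice_chart chi.
pose W := chart_cod slice_chart.
have oW : open W by exact: open_chart_cod.
pose w0 := chart_map slice_chart p0.
have dp0' : chart_dom slice_chart p0 by [].
have Ww0 : W w0 by exact: chart_codP.
have oC : open (chart_cod chi) by exact: open_chart_cod.
have hsl : holomorphic_on W slice by exact: caff_holomorphic.
have gfE y : W y -> forall a b, sesq (gf y) a b =
    sesq (tensor_mx A chi (slice y)) (jacobian slice y *m a) (jacobian slice y *m b).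
  by move=> Wy a b; rewrite jacobian_caff slice_metricE.
have vert w a : W w -> vertical f chi (chart_inv chi (slice w)) (K *m a).
  move=> /slice_chart_cod cw; apply/(adapted_vertical ad); first exact: chart_inv_dom.
  by rewrite mulmxA JK mul0mx.
have gf_herm y : W y -> hermitian_mx (gf y).
  move=> Wy i j; rewrite -!sesq_delta !slice_metricE //; apply: sesq_herm.
  by apply: tensor_hermitian => //; apply: chart_inv_dom; exact: slice_chart_cod.
have gf_pos y : W y -> posdef_mx (gf y).
  move=> Wy a a0; have dy := chart_inv_dom (slice_chart_cod Wy).
  rewrite slice_metricE // /tensor_mx restrA //; try exact: vert.
  apply: metric_positive => //; first exact: vert.
  apply: contraNneq a0 => E; rewrite -[a]mul1mx -LK -mulmxA E mulmx0 //.
have gf_smooth : smooth_mx W gf.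
  move=> i j k.
  pose e (a : 'I_(n - m)%N) : 'cV[R[i]]_n := K *m delta_mx a ord0.
  have C : CCk k W (fun y => sesq (tensor_mx A chi (slice y)) (e i) (e j)).
    apply: (CCk_sesq_comp oC oW (fun y Wy => slice_chart_cod Wy) hsl) => [|a|a].
    - exact: tensor_smooth.
    - exact: CCk_cst.
    - exact: CCk_cst.
  apply: eq_CCk oW _ C => y /set_mem Wy.
  by rewrite -sesq_delta slice_metricE.
have pos : 0 < curvature_form gf w0 v.
  rewrite -hol_sect_curvature_gt0 //; last exact: gf_pos.
  exact: posG slice_fiber_chart hchi dp0' dp0 _ v0.
rewrite (Nform_optimal oW Ww0) // in pos; last exact: posdef_unitmx (gf_pos _ Ww0).
rewrite (Nform_pullback oC oW (fun y Wy => slice_chart_cod Wy) hsl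
  (tensor_smooth tA hchi) gfE) // in pos.
have h0 : hessian slice v w0 = 0.
  apply/matrixP => a b; rewrite !mxE.
  rewrite (_ : (fun y => _) = fun=> (K *m v) a ord0) ?dvec_cst //.
  by apply/funext => y; rewrite jacobian_caff.
rewrite h0 subr0 jacobian_caff Kv in pos.
set eta := optimal gf w0 v in pos.
exists (K *m eta); first by rewrite mulmxA JK mul0mx.
by rewrite -(fiber_mapK_slice dp0).
Qed.

End FiberChart.

End Submersions.

(** * Smooth bump functions *)

Section Bump.
Variable R : realType.

(** [flat 0] is the classical function exp(-1/x), extended by zero; the family
    is stable under differentiation. *)
Definition flat k (x : R) : R := if 0 < x then x^-1 ^+ k * expR (- x^-1) else 0.

Lemma flat_ge0 k x : 0 <= flat k x.
Proof.
rewrite /flat; case: ifP => // x0.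
by rewrite mulr_ge0 ?expR_ge0 // exprn_ge0 // invr_ge0 ltW.
Qed.

(** The exponential beats every power of [x^-1]; a quadratic bound is what the
    derivative at 0 needs. *)
Lemma flat_le k x : flat k x <= (k.+2)`!%:R * x ^+ 2.
Proof.
rewrite /flat; case: ifP => [x0|_]; last by rewrite mulr_ge0 // sqr_ge0.
have t0 : 0 < x^-1 by rewrite invr_gt0.
have F0 : 0 < (k.+2)`!%:R :> R by rewrite ltr0n fact_gt0.
have H := expR_ge1Dxn k.+1 (ltW t0).
have : x^-1 ^+ k.+2 <= (k.+2)`!%:R * expR x^-1.
  rewrite mulrC -ler_pdivrMr //; apply: le_trans H.
  by rewrite lerDr.
rewrite expRN ler_pdivrMr ?expR_gt0 // => E.
have x20 : 0 < x^-1 ^+ 2 by rewrite exprn_gt0.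
rewrite -(ler_pM2r x20) -exprD addn2; apply: le_trans E _.
rewrite le_eqVlt; apply/orP; left; apply/eqP.
have x0' : x != 0 by rewrite gt_eqF.
rewrite -!mulrA; congr (_ * _).
by field.
Qed.

Lemma is_derive_flat k (x : R) :
  is_derive x 1 (flat k) (flat k.+2 x - k%:R * flat k.+1 x).
Proof.
have [x0|x0|->] := ltgtP x 0.
- have n0 : {near x, cst 0 =1 flat k}.
    apply: filterS (lt_nbhsl x0) => y /= y0.
    by rewrite /flat ltNge ltW.
  apply: near_eq_is_derive n0 _.
  have z j : flat j x = 0 by rewrite /flat ltNge ltW.
  rewrite !z mulr0 subr0.
  exact: is_derive_cst.
- have n0 : {near x, (fun y => y^-1 ^+ k * expR (- y^-1)) =1 flat k}.
    by apply: filterS (lt_nbhsr x0) => y /= y0; rewrite /flat y0.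
  apply: near_eq_is_derive n0 _.
  have xn0 : x != 0 by rewrite gt_eqF.
  have d1 : is_derive x 1 (fun y : R => y^-1) (- x ^- 2).
    apply: is_derive_eq (is_deriveV xn0 (is_derive_id x 1)) _.
    by rewrite [_ *: _]mulr1.
  have d2 : is_derive x 1 (fun y : R => y^-1 ^+ k) (k%:R * x^-1 ^+ k.-1 * (- x ^- 2)).
    have := is_deriveX k d1.
    have -> : (fun y : R => y^-1) ^+ k = fun y => y^-1 ^+ k.
      by apply/funext => y; rewrite fctE.
    by [].
  have d3 : is_derive x 1 (fun y : R => expR (- y^-1)) (expR (- x^-1) * x ^- 2).
    have dN : is_derive x 1 (fun y : R => - y^-1) (x ^- 2).
      by apply: is_derive_eq (is_deriveN d1) _; rewrite opprK.
    have e1 : is_derive (- x^-1) 1 expR (expR (- x^-1)) by exact: is_derive_expR.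
    have := @is_derive1_comp R expR (fun y => - y^-1) x _ _ e1 dN.
    by [].
  apply: is_derive_eq (is_deriveM d2 d3) _.
  have ZE (a b : R) : a *: b = a * b by [].
  rewrite /flat x0 !ZE.
  case: k {d2} => [|k] /=.
    by rewrite !mul0r mulr0 addr0 subr0 expr0 mul1r mulrC -exprVn.
  rewrite -exprVn !exprS; ring.
have z j : flat j 0 = 0 by rewrite /flat ltxx.
rewrite !z mulr0 subr0.
have cvL : h^-1 *: ((flat k \o shift 0) (h *: 1) - flat k 0) @[h --> 0^'] --> (0 : R).
  apply/cvgrPdist_lt => /= e e0.
  have F0 : 0 < (k.+2)`!%:R :> R by rewrite ltr0n fact_gt0.
  near=> h; rewrite sub0r normrN addr0.
  rewrite z subr0 [h *: 1]mulr1 normrZ normfV (ger0_norm (flat_ge0 _ _)).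
  have h0 : h != 0 by near: h; exact: nbhs_dnbhs_neq.
  rewrite ltr_pdivrMl ?normr_gt0 //; apply: le_lt_trans (flat_le k h) _.
  rewrite -[h ^+ 2]ger0_norm ?sqr_ge0 // normrX expr2 mulrA [ltRHS]mulrC ltr_pM2r ?normr_gt0 //.
  rewrite mulrC -ltr_pdivlMr //; near: h; apply: dnbhs0_lt.
  by rewrite divr_gt0.
split; first by apply/cvg_ex; exists 0.
exact: cvg_lim cvL.
Unshelve. all: by end_near. Qed.

Lemma flat_continuous k : continuous (flat k).
Proof.
move=> x; apply: differentiable_continuous; apply/derivable1_diffP.
by have [] := is_derive_flat k x.
Qed.

Lemma is_derive_comp1 (V : normedModType R) (a : R -> R) (g : V -> R) x v da :
  is_derive (g x) 1 a da -> derivable g x v ->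
  is_derive x v (a \o g) (da * 'D_v g x).
Proof.
move=> [da1 <-] dg; pose p := fun s : R => g (x + s *: v).
have p0 : p 0 = g x by rewrite /p scale0r addr0.
have dp : derivable p 0 1.
  by apply: derivable_line; rewrite scale0r addr0.
have da' : derivable a (p 0) 1 by move: da1; rewrite -p0.
have dpc : derivable (a \o p) 0 1.
  apply/derivable1_diffP; apply: differentiable_comp; exact/derivable1_diffP.
have E : (fun s : R => (a \o g) (x + s *: v)) = a \o p by [].
split.
  apply/derivable1P.
  suff -> : (fun h : R => (a \o g) (h *: v + x)) = a \o p by [].
  by apply/funext => s; rewrite /p /= addrC.
have := derive1_comp dp da'.
rewrite !derive1E -E derive_line p0 derive_line scale0r addr0 => ->.
by [].
Qed.

Lemma Ck_flat (V : normedModType R) (U : set V) g i k : open U ->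
  (forall k, Ck k U g) -> Ck k U (fun y => flat i (g y)).
Proof.
move=> oU Cg; elim: k i => [|k IH] i.
  split=> // y Uy; apply: continuous_comp; first exact: Ck_continuous (Cg 0%N) Uy.
  exact: flat_continuous.
have D y v : U y -> is_derive y v (flat i \o g)
    ((flat i.+2 (g y) - i%:R * flat i.+1 (g y)) * 'D_v g y).
  move=> Uy; apply: is_derive_comp1; first exact: is_derive_flat.
  exact: Ck_derivable (Cg 1%N) Uy.
split=> [y Uy|v].
  apply: continuous_comp; first exact: Ck_continuous (Cg 0%N) Uy.
  exact: flat_continuous.
split=> [y Uy|]; first by have [] := D y v Uy.
have C : Ck k U (fun y => (flat i.+2 (g y) + - (i%:R * flat i.+1 (g y))) * 'D_v g y).
  apply: CkM => //; last exact: Ck_derive (Cg k.+1).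
  apply: CkD => //; apply: CkN => //; apply: CkM => //; exact: Ck_cst.
apply: eq_Ck oU _ C => y /set_mem Uy.
by have [_ ->] := D y v Uy.
Qed.

Definition bump n (z0 : Cn R n) (r : R) (z : Cn R n) : R :=
  flat 0 (r ^+ 2 + - \sum_i rcoord i (z - z0) * rcoord i (z - z0)).

Lemma bump_ge0 n (z0 : Cn R n) r z : 0 <= bump z0 r z.
Proof. exact: flat_ge0. Qed.

Lemma bump_center n (z0 : Cn R n) r : 0 < r -> 0 < bump z0 r z0.
Proof.
move=> r0; rewrite /bump big1 => [|i _]; last by rewrite rcoordB subrr mulr0.
by rewrite oppr0 addr0 /flat exprn_gt0 // expr0 mul1r expR_gt0.
Qed.

Lemma bump_support n (z0 : Cn R n) r z : 0 < r -> bump z0 r z != 0 -> `|z0 - z| <= r.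
Proof.
move=> r0; rewrite /bump /flat; case: ifP; rewrite ?eqxx // subr_gt0 => lt_r _.
rewrite distrC; apply: norm_le_rcoord => [|i]; first exact: ltW.
rewrite -(@ler_pXn2r _ 2) ?nnegrE // ?(ltW r0) //.
apply: le_trans (ltW lt_r); rewrite (bigD1 i) //= real_normK ?num_real // expr2.
by rewrite lerDl sumr_ge0 // => j _; rewrite -expr2 sqr_ge0.
Qed.

Lemma Ck_bump n (z0 : Cn R n) r U k : open U -> Ck k U (bump z0 r).
Proof.
move=> oU; apply: Ck_flat => // {}k; apply: CkD => //; first exact: Ck_cst.
apply: CkN => //.
have C i : Ck k U (fun z => rcoord i (z - z0)).
  under eq_fun do rewrite rcoordB.
  by apply: CkD => //; [exact: Ck_rcoord|exact: Ck_cst].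
elim: (index_enum _) => [|i s IH].
  by under eq_fun do rewrite big_nil; exact: Ck_cst.
by under eq_fun do rewrite big_cons; apply: CkD => //; exact: CkM.
Qed.

End Bump.

(** * Smooth functions on a manifold and operations on tensors *)

Section TensorOperations.
Variables (R : realType) (n : nat) (X : complexManifold R n).
Implicit Types (phi psi chi : chart R X n) (p q : X) (u : X -> R).
Implicit Types (A : chart R X n -> X -> 'M[R[i]]_n).

Definition smooth_fun u := forall phi, holo_chart phi ->
  forall k, Ck k (chart_cod phi) (fun z => u (chart_inv phi z)).

Lemma smooth_fun_local u :
  (forall p, exists chi (U : set (Cn R n)), [/\ holo_chart chi, chart_dom chi p, open U,
     U (chart_map chi p) /\ U `<=` chart_cod chi &
     forall k, Ck k U (fun z => u (chart_inv chi z))]) -> smooth_fun u.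
Proof.
move=> uloc phi hphi k; apply: (Ck_local (U := chart_cod phi)).
move=> _ [p dp <-]; have [chi [U [hchi dchi oU [Up Ucod] sU]]] := uloc p.
pose F := local_map phi chi id.
have [W [oW Wp WL hFW FU]] := transition_near hphi hchi dp dchi oU Up.
exists (fun y => u (chart_inv chi (F y))), W; split=> //.
  by move=> y /set_mem/WL[q [dq dchiq] <-]; rewrite /F local_mapE // !chart_mapK.
have Cr i : Ck k W (rcoord i \o F).
  by case: i => a; have [C1 C2] := holomorphic_CCk hFW k a.
exact: (Ck_comp oU oW FU Cr (sU k)).
Qed.

Lemma herm_tensor0 : herm_tensor (fun phi q => 0 : 'M[R[i]]_n).
Proof.
split=> [phi hphi i j k|phi p _ _ i j|phi psi p _ _ _ _ xi eta].
- have C := CCk_cst k (chart_cod phi) (0 : R[i]).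
  by apply: eq_CCk _ _ C; [exact: open_chart_cod|move=> z _; rewrite mxE].
- by rewrite !mxE conjc0.
- by rewrite !sesq0m.
Qed.

Lemma herm_tensor_add A A' : herm_tensor A -> herm_tensor A' ->
  herm_tensor (fun phi q => A phi q + A' phi q).
Proof.
move=> tA tA'; split=> [phi hphi i j k|phi p hphi dp i j|phi psi p hphi hpsi dp dp' xi eta].
- have C := CCkD (@open_chart_cod _ _ _ phi) (tensor_smooth tA hphi i j k) (tensor_smooth tA' hphi i j k).
  by apply: eq_CCk _ _ C; [exact: open_chart_cod|move=> z _; rewrite mxE].
- by rewrite !mxE conjcD -(tensor_hermitian tA) // -(tensor_hermitian tA').
- by rewrite !sesqDm (tensor_change tA hphi hpsi) // (tensor_change tA' hphi hpsi).
Qed.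

Lemma herm_tensor_scale u A : smooth_fun u -> herm_tensor A ->
  herm_tensor (fun phi q => (u q)%:C *: A phi q).
Proof.
move=> su tA; split=> [phi hphi i j k|phi p hphi dp i j|phi psi p hphi hpsi dp dp' xi eta].
- have Cu : CCk k (chart_cod phi) (fun z => (u (chart_inv phi z))%:C).
    by split; [exact: su|exact: Ck_cst].
  have C := CCkM (@open_chart_cod _ _ _ phi) Cu (tensor_smooth tA hphi i j k).
  by apply: eq_CCk _ _ C; [exact: open_chart_cod|move=> z _; rewrite mxE].
- by rewrite !mxE conjcM conjc_real -(tensor_hermitian tA).
- by rewrite !sesqZm (tensor_change tA hphi hpsi).
Qed.

Lemma smooth_funD u u' : smooth_fun u -> smooth_fun u' -> smooth_fun (fun q => u q + u' q).
Proof. by move=> su su' phi hphi k; apply: CkD; [exact: open_chart_cod|exact: su|exact: su']. Qed.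

Lemma smooth_fun_cst (c : R) : smooth_fun (fun=> c).
Proof. by move=> phi hphi k; exact: Ck_cst. Qed.

Lemma smooth_funV u : smooth_fun u -> (forall q, u q != 0) -> smooth_fun (fun q => (u q)^-1).
Proof. by move=> su u0 phi hphi k; apply: CkV => //; [exact: open_chart_cod|exact: su]. Qed.

Lemma smooth_fun_gt0_nbhs u p : smooth_fun u -> 0 < u p -> nbhs p [set q | 0 < u q].
Proof.
move=> su up; have [phi hphi dp] := holo_chart_at p.
have c := Ck_continuous (su phi hphi 0%N) (chart_codP dp).
have n1 : \forall z \near chart_map phi p, 0 < u (chart_inv phi z).
  by apply: (cvgr_gt _ c); rewrite chart_mapK.
have n2 := chart_map_near dp n1.
apply: filterS2 n2 (near_chart_dom dp) => q /= uq dq.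
by rewrite chart_mapK in uq.
Qed.

End TensorOperations.

(** Finite lists of points, ordered by inclusion, form a filter; compactness in the
    form of near-coverings is applied to it. *)
Lemma compact_finite_cover (T : topologicalType) (V : T -> set T) :
  compact [set: T] -> (forall p, nbhs p (V p)) ->
  exists s : seq T, forall q, exists2 p, p \in s & V p q.
Proof.
move=> /compact_near_coveringP cT nV.
pose F : set_system (seq T) :=
  [set A | exists s0 : seq T, forall s : seq T, {subset s0 <= s} -> A s].
have FF : Filter F.
  split; first by exists [::].
    move=> A A' [s As] [s' A's']; exists (s ++ s') => t st; split.
      by apply: As => x xs; apply: st; rewrite mem_cat xs.
    by apply: A's' => x xs; apply: st; rewrite mem_cat xs orbT.
  by move=> A A' AA' [s As]; exists s => t /As/AA'.
have [|s H] := cT (seq T) F (fun s q => exists2 p, p \in s & V p q) FF _.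
  move=> p _; exists (V p, [set s : seq T | p \in s]) => /=.
    by split; [exact: nV|exists [:: p] => s; apply; rewrite mem_head].
  by move=> [q s] /= [Vq ps]; exists p.
by exists s => q; apply: (H s).
Qed.

(** * Extending the metrics of the fibers, pulling back the metric of the base *)

Section FiberMetricExtension.
Variables (R : realType) (n m : nat).
Variables (X : complexManifold R n) (Y : complexManifold R m) (f : X -> Y).
Hypotheses (hol_f : holomorphic f) (sub_f : submersion f).
Variable G : hermitian_metric (vertical f).
Implicit Types (phi chi : chart R X n) (q : X) (xi eta : 'cV[R[i]]_n).

Lemma vertical_metric_ge0 phi q xi : holo_chart phi -> chart_dom phi q ->
  vertical f phi q xi -> 0 <= G phi q xi xi.
Proof.
move=> hphi dq vxi; have [x0|x0] := eqVneq xi 0; last by rewrite ltW // metric_positive.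
have := metric_linear G hphi dq (-1) vxi vxi vxi.
rewrite x0 scaler0 addr0 mulN1r addNr => ->; exact: lexx.
Qed.

(** An unnormalized piece of an extension of [G] to the whole tangent bundle: such
    pieces can be added, and divided by the weight [u] where it is positive. *)
Definition weighted_extension (S : chart R X n -> X -> 'M[R[i]]_n) (u : X -> R) :=
  [/\ herm_tensor S, smooth_fun u, forall q, 0 <= u q,
      forall phi q xi, holo_chart phi -> chart_dom phi q -> 0 <= sesq (S phi q) xi xi &
      forall phi q xi eta, holo_chart phi -> chart_dom phi q ->
        vertical f phi q xi -> vertical f phi q eta ->
        sesq (S phi q) xi eta = (u q)%:C * G phi q xi eta].

Section Local.
Variables (chi : chart R X n) (psi : chart R Y m) (J : 'M[R[i]]_(m, n)).
Variables (B : 'M[R[i]]_(n, m)) (K : 'M[R[i]]_(n, (n - m)%N)) (L : 'M[R[i]]_((n - m)%N, n)).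
Hypotheses (ad : adapted f chi psi J) (spl : splits J B K L).
Variables (z0 : Cn R n) (r : R).
Hypotheses (r0 : 0 < r) (ball_cod : forall z, `|z0 - z| <= r -> chart_cod chi z).

(* The metric [G] is extended by the projection [K *m L] onto the vertical vectors,
   which is constant in the adapted chart, and cut off by a bump function. *)
Let u q : R := if `[< chart_dom chi q >] then bump z0 r (chart_map chi q) else 0.
Let D phi q := (K *m L) *m differential_in phi chi id q.
Let b phi q xi eta := G chi q (D phi q *m xi) (D phi q *m eta).
Let S phi q : 'M[R[i]]_n :=
  (u q)%:C *: \matrix_(i, j) b phi q (delta_mx i ord0) (delta_mx j ord0).

Let u_dom q : u q != 0 -> chart_dom chi q.
Proof. by rewrite /u; case: asboolP; rewrite ?eqxx. Qed.

Let u_inv z : chart_cod chi z -> u (chart_inv chi z) = bump z0 r z.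
Proof.
move=> cz; rewrite /u asboolT; last exact: chart_inv_dom.
by rewrite chart_invK.
Qed.

(** Away from the chart [chi] the weight vanishes near each point, because its
    support is compact, hence closed in the Hausdorff space [X]. *)
Let u_cover p : chart_dom chi p \/ exists phi (U : set (Cn R n)),
  [/\ holo_chart phi, chart_dom phi p, open U,
      U (chart_map phi p) /\ U `<=` chart_cod phi &
      forall z, U z -> u (chart_inv phi z) = 0].
Proof.
have [dp|ndp] := pselect (chart_dom chi p); [by left|right].
pose Q := chart_inv chi @` [set z | `|z0 - z| <= r].
have cQ : compact Q.
  apply: continuous_compact; last exact: compact_ball.
  apply: continuous_in_subspaceT => z /set_mem zr; apply: chart_inv_continuous.
  exact: ball_cod.
have oQ : open (~` Q) by apply: closed_openC; apply: compact_closed cQ; exact: carrier_hausdorff.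
have uQ q : ~ Q q -> u q = 0.
  move=> nQ; apply: contrapT => /eqP uq; apply: nQ; have dq := u_dom uq.
  exists (chart_map chi q); last by rewrite chart_mapK.
  by apply: (bump_support r0); move: uq; rewrite /u asboolT.
have [phi hphi dphi] := holo_chart_at p.
exists phi, (chart_cod phi `&` chart_inv phi @^-1` (~` Q)); split=> //.
- apply: open_continuous_preimage => //; first exact: open_chart_cod.
  by move=> z cz; exact: chart_inv_continuous.
- split=> [|z []//]; split; first exact: chart_codP.
  rewrite /= chart_mapK // => -[z zr zE]; apply: ndp.
  by rewrite -zE; apply: chart_inv_dom; exact: ball_cod.
- by move=> z [_ /uQ].
Qed.

Let u_smooth : smooth_fun u.
Proof.
have [hchi _ _ _] := ad.
apply: smooth_fun_local => p; have [dp|[phi [U [hphi dp oU UU u0]]]] := u_cover p.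
  exists chi, (chart_cod chi); split=> //; first exact: open_chart_cod.
    by split=> //; exact: chart_codP.
  move=> k; apply: eq_Ck _ _ (Ck_bump z0 r k _); try exact: open_chart_cod.
  by move=> z /set_mem; exact: u_inv.
exists phi, U; split=> // k; apply: eq_Ck oU _ (Ck_cst k U 0).
by move=> z /set_mem; exact: u0.
Qed.

Let D_vertical phi q xi : chart_dom chi q -> vertical f chi q (D phi q *m xi).
Proof.
move=> dq; have [_ _ JK _ _] := spl.
by apply/(adapted_vertical hol_f ad) => //; rewrite /D !mulmxA JK !mul0mx.
Qed.

Let SE phi q xi eta : sesq (S phi q) xi eta = (u q)%:C * b phi q xi eta.
Proof.
have [hchi _ _ _] := ad; rewrite sesqZm.
have [->|/u_dom dq] := eqVneq (u q) 0; first by rewrite !mul0r.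
congr (_ * _); apply: sesq_mx => [c x y z|x y]; rewrite /b.
  rewrite mulmxDr -scalemxAr; apply: metric_linear => //; exact: D_vertical.
by apply: metric_hermitian => //; exact: D_vertical.
Qed.

Let S_herm phi q : hermitian_mx (S phi q).
Proof.
have [hchi _ _ _] := ad.
move=> i j; rewrite -!sesq_delta !SE conjcM conjc_real.
have [->|/u_dom dq] := eqVneq (u q) 0; first by rewrite !mul0r.
by congr (_ * _); apply: metric_hermitian => //; exact: D_vertical.
Qed.

Let S_change phi phi' q : holo_chart phi -> holo_chart phi' ->
  chart_dom phi q -> chart_dom phi' q -> forall xi eta,
  sesq (S phi q) xi eta = sesq (S phi' q) (differential_in phi phi' id q *m xi)
                                          (differential_in phi phi' id q *m eta).
Proof.
have [hchi _ _ _] := ad.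
move=> hphi hphi' dq dq' xi eta; rewrite [LHS]SE [RHS]SE.
have [->|/u_dom dchi] := eqVneq (u q) 0; first by rewrite !mul0r.
have assoc (P M N O : 'M[R[i]]_n) (v : 'cV_n) :
    M *m N = O -> (P *m M) *m (N *m v) = (P *m O) *m v.
  by move=> <-; rewrite !mulmxA.
have DE (v : 'cV[R[i]]_n) : D phi' q *m (differential_in phi phi' id q *m v) = D phi q *m v.
  by apply: assoc; exact: transition_comp.
have GE x x' y y' : x' = x -> y' = y -> G chi q x y = G chi q x' y'.
  by move=> -> ->.
by congr (_ * _); apply: GE; exact: DE.
Qed.

Let S_tensor : herm_tensor S.
Proof.
have [hchi _ _ _] := ad.
split=> [phi hphi|phi q _ _|]; [|exact: S_herm|exact: S_change].
apply: (tensor_smooth_local S_change) => // p.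
have [dp|[phi' [U [hphi' dp oU UU u0]]]] := u_cover p.
  exists chi, (chart_cod chi); split=> //; first exact: open_chart_cod.
    by split=> //; exact: chart_codP.
  move=> i j k; pose e (a : 'I_n) : 'cV[R[i]]_n := K *m L *m delta_mx a ord0.
  have Cu : CCk k (chart_cod chi) (fun z => (bump z0 r z)%:C).
    by split; [apply: Ck_bump; exact: open_chart_cod|exact: Ck_cst].
  have CG : CCk k (chart_cod chi) (fun z => G chi (chart_inv chi z) (e i) (e j)).
    have ve a z : chart_cod chi z -> vertical f chi (chart_inv chi z) (e a).
      move=> /chart_inv_dom dz; have [_ _ JK _ _] := spl.
      by apply/(adapted_vertical hol_f ad) => //; rewrite /e !mulmxA JK !mul0mx.
    apply: (@metric_smooth _ _ _ _ G chi hchi _ (fun=> e i) (fun=> e j)) => //.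
    - exact: open_chart_cod.
    - by move=> a l; exact: CCk_cst.
    - by move=> a l; exact: CCk_cst.
    - by move=> z; exact: ve.
    - by move=> z; exact: ve.
  have C := CCkM (@open_chart_cod _ _ _ chi) Cu CG.
  apply: eq_CCk _ _ C; first exact: open_chart_cod.
  move=> z /set_mem cz; have dz := chart_inv_dom cz.
  rewrite /tensor_mx -sesq_delta [LHS]SE u_inv //; congr (_ * _).
  by rewrite /b /D differential_id // mulmx1.
exists phi', U; split=> // i j k; have C := CCk_cst k U (0 : R[i]).
apply: eq_CCk oU _ C => z /set_mem Uz.
by rewrite /tensor_mx -sesq_delta [LHS]SE u0 // mul0r.
Qed.

Lemma local_weighted_extension : exists S u, weighted_extension S u /\
  forall q, chart_dom chi q -> u q = bump z0 r (chart_map chi q).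
Proof using hol_f ad spl r0 ball_cod.
have [hchi _ _ _] := ad; have [_ _ _ _ sum1] := spl.
have uge0 q : 0 <= u q by rewrite /u; case: asboolP => // _; exact: bump_ge0.
exists S, u; split; last by move=> q dq; rewrite /u asboolT.
split=> [|||phi q xi hphi dq|phi q xi eta hphi dq vxi veta] //.
  rewrite SE; have [->|/u_dom dchi] := eqVneq (u q) 0; first by rewrite mul0r.
  apply: mulr_ge0; first by rewrite lecR.
  by apply: vertical_metric_ge0 => //; exact: D_vertical.
rewrite SE; have [->|/u_dom dchi] := eqVneq (u q) 0; first by rewrite !mul0r.
congr (_ * _); rewrite /b.
have DE v : vertical f phi q v -> D phi q *m v = differential_in phi chi id q *m v.
  move=> vv; rewrite /D -[in RHS](mul1mx (differential_in _ _ _ _)) -sum1 -!mulmxA mulmxDl.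
  have /(adapted_vertical hol_f ad _ dchi) E := vertical_change hol_f hphi hchi dq dchi vv.
  by rewrite -!mulmxA E mulmx0 add0r.
by rewrite !DE // metric_change.
Qed.

End Local.

Lemma weighted_extension_at p : exists Su : (chart R X n -> X -> 'M[R[i]]_n) * (X -> R),
  weighted_extension Su.1 Su.2 /\ 0 < Su.2 p.
Proof using hol_f sub_f.
have [chi [psi [J [B [K [L [dp ad spl]]]]]]] := adapted_chart hol_f sub_f p.
have [e /= e0 He] := (nbhs_ballP _ _).1 (near_chart_cod dp).
have r0 : 0 < e / 2 by rewrite divr_gt0.
have bc z : `|chart_map chi p - z| <= e / 2 -> chart_cod chi z.
  move=> ze; apply: He; rewrite -ball_normE /=; apply: le_lt_trans ze _.
  by rewrite ltr_pdivrMr // ltr_pMr // ltr1n.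
have [S [u [ext uE]]] := local_weighted_extension ad spl r0 bc.
by exists (S, u); split=> //=; rewrite uE // bump_center.
Qed.

Lemma weighted_extension_sum (w : X -> (chart R X n -> X -> 'M[R[i]]_n) * (X -> R)) (s : seq X) :
  (forall p, weighted_extension (w p).1 (w p).2) ->
  exists S u, weighted_extension S u /\
    forall p q, p \in s -> 0 < (w p).2 q -> 0 < u q.
Proof.
move=> ext; elim: s => [|p s [S [u [[tS su u0 S0 SG] us]]]].
  exists (fun _ _ => 0), (fun=> 0); split=> //.
  split=> // [||phi q xi _ _|phi q xi eta _ _ _ _]; first exact: herm_tensor0.
  - exact: smooth_fun_cst.
  - by rewrite sesq0m.
  - by rewrite sesq0m mul0r.
have [tS' su' u0' S0' SG'] := ext p.
exists (fun phi q => (w p).1 phi q + S phi q), (fun q => (w p).2 q + u q); split.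
  split=> [||q|phi q xi hphi dq|phi q xi eta hphi dq vxi veta].
  - exact: herm_tensor_add.
  - exact: smooth_funD.
  - exact: addr_ge0.
  - by rewrite sesqDm addr_ge0 ?S0 ?S0'.
  - by rewrite sesqDm SG // SG' // rmorphD mulrDl.
move=> p' q; rewrite inE => /orP[/eqP->|p's] w0; first exact: ltr_wpDr.
by apply: ltr_wpDl => //; exact: us w0.
Qed.

Hypothesis compact_X : compact [set: X].

(** Average the local extensions: the sum of finitely many of them, divided by
    the sum of their weights. *)
Lemma fiber_metric_extension : exists A : chart R X n -> X -> 'M[R[i]]_n,
  [/\ herm_tensor A,
      forall phi q xi, holo_chart phi -> chart_dom phi q -> 0 <= sesq (A phi q) xi xi &
      forall phi q xi eta, holo_chart phi -> chart_dom phi q ->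
        vertical f phi q xi -> vertical f phi q eta ->
        sesq (A phi q) xi eta = G phi q xi eta].
Proof using hol_f sub_f compact_X.
have /choice[w Hw] := weighted_extension_at.
have ext p : weighted_extension (w p).1 (w p).2 by have [] := Hw p.
have [p|s cov] := @compact_finite_cover X (fun p => [set q | 0 < (w p).2 q]) compact_X.
  by have [[_ su _ _ _] wp] := Hw p; exact: smooth_fun_gt0_nbhs.
have [S [u [[tS su u0 S0 SG] us]]] := weighted_extension_sum s ext.
have upos q : 0 < u q by have [p ps wq] := cov q; exact: us ps wq.
have un0 q : u q != 0 by rewrite gt_eqF.
exists (fun phi q => ((u q)^-1)%:C *: S phi q); split.
- by apply: herm_tensor_scale => //; exact: smooth_funV.
- move=> phi q xi hphi dq; rewrite sesqZm mulr_ge0 ?S0 //.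
  by rewrite lecR invr_ge0.
- move=> phi q xi eta hphi dq vxi veta; rewrite sesqZm SG // mulrA -rmorphM mulVf //.
  by rewrite mul1r.
Qed.

End FiberMetricExtension.

Section PullbackTensor.
Variables (R : realType) (n m : nat).
Variables (X : complexManifold R n) (Y : complexManifold R m) (f : X -> Y).
Hypothesis hol_f : holomorphic f.
Variable T : chart R Y m -> Y -> 'M[R[i]]_m.
Hypothesis tT : herm_tensor T.
Implicit Types (phi : chart R X n) (psi : chart R Y m) (q : X).

(* An arbitrary choice, on which the pullback does not depend. *)
Let base_chart q : chart R Y m := sval (cid2 (holo_chart_at (f q))).
Let base_chart_holo q : holo_chart (base_chart q).
Proof. by rewrite /base_chart; case: cid2. Qed.
Let base_chart_dom q : chart_dom (base_chart q) (f q).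
Proof. by rewrite /base_chart; case: cid2. Qed.

Definition pullback_tensor phi q : 'M[R[i]]_n :=
  let D := differential_in phi (base_chart q) f q in
  \matrix_(i, j) sesq (T (base_chart q) (f q)) (D *m delta_mx i ord0) (D *m delta_mx j ord0).

Lemma pullback_tensorE phi psi q xi eta : holo_chart phi -> holo_chart psi ->
  chart_dom phi q -> chart_dom psi (f q) ->
  sesq (pullback_tensor phi q) xi eta =
  sesq (T psi (f q)) (differential_in phi psi f q *m xi) (differential_in phi psi f q *m eta).
Proof using hol_f tT.
move=> hphi hpsi dq dfq; set psi' := base_chart q.
have hpsi' : holo_chart psi' by exact: base_chart_holo.
have dfq' : chart_dom psi' (f q) by exact: base_chart_dom.
have -> : sesq (pullback_tensor phi q) xi eta =
    sesq (T psi' (f q)) (differential_in phi psi' f q *m xi) (differential_in phi psi' f q *m eta).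
  apply: (@sesq_mx _ _ (fun v w => sesq (T psi' (f q)) (differential_in phi psi' f q *m v)
    (differential_in phi psi' f q *m w))) => [c x y z|x y].
    by rewrite mulmxDr -scalemxAr sesqDl sesqZl.
  by apply: sesq_herm; exact: tensor_hermitian.
rewrite (tensor_change tT hpsi' hpsi dfq' dfq) !mulmxA.
suff -> : differential_in psi' psi id (f q) *m differential_in phi psi' f q =
    differential_in phi psi f q by [].
rewrite -(differential_comp (phi := phi) (psi := psi') (chi := psi) (g := id)) //.
- exact: hol_f.1.
- exact: f_hol_at.
- exact: transition_hol_at.
Qed.

Lemma pullback_tensor_local phi psi y : holo_chart phi -> holo_chart psi ->
  local_dom phi psi f y -> forall xi eta,
  sesq (tensor_mx pullback_tensor phi y) xi eta =
  sesq (tensor_mx T psi (local_map phi psi f y))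
    (jacobian (local_map phi psi f) y *m xi) (jacobian (local_map phi psi f) y *m eta).
Proof using hol_f tT.
move=> hphi hpsi [q [dq dfq] <-] xi eta.
by rewrite /tensor_mx local_mapE // !chart_mapK // (pullback_tensorE _ _ hphi hpsi).
Qed.

Lemma pullback_herm_tensor : herm_tensor pullback_tensor.
Proof using hol_f tT.
have change phi phi' q : holo_chart phi -> holo_chart phi' ->
    chart_dom phi q -> chart_dom phi' q -> forall xi eta,
    sesq (pullback_tensor phi q) xi eta =
    sesq (pullback_tensor phi' q) (differential_in phi phi' id q *m xi)
                                  (differential_in phi phi' id q *m eta).
  move=> hphi hphi' dq dq' xi eta; have [psi hpsi dfq] := holo_chart_at (f q).
  rewrite [LHS](pullback_tensorE _ _ hphi hpsi dq dfq).
  rewrite [RHS](pullback_tensorE _ _ hphi' hpsi dq' dfq).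
  rewrite !mulmxA; suff -> : differential_in phi' psi f q *m differential_in phi phi' id q =
      differential_in phi psi f q by [].
  rewrite -(differential_comp (phi := phi) (psi := phi') (chi := psi) (f := id) (g := f)) //.
  - exact: idfun_continuous.
  - exact: transition_hol_at.
  - exact: f_hol_at.
split=> [phi hphi|phi q hphi dq i j|//]; last first.
  have [psi hpsi dfq] := holo_chart_at (f q).
  rewrite -!sesq_delta !(pullback_tensorE _ _ hphi hpsi dq dfq).
  by apply: sesq_herm; exact: tensor_hermitian.
apply: (tensor_smooth_local change) => // q.
have [chi hchi dq] := holo_chart_at q; have [psi hpsi dfq] := holo_chart_at (f q).
have oL : open (local_dom chi psi f) by apply: open_local_dom; exact: hol_f.1.
have hF : holomorphic_on (local_dom chi psi f) (local_map chi psi f) by exact: hol_f.2.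
have Lcod y : local_dom chi psi f y -> chart_cod psi (local_map chi psi f y).
  by move=> [p [dp dfp] <-]; rewrite local_mapE //; exact: chart_codP.
exists chi, (local_dom chi psi f); split=> //.
  by split; [exact: local_domP|rewrite local_domE => z []].
move=> i j k.
have C := CCk_sesq_comp (@open_chart_cod _ _ _ psi) oL Lcod hF (tensor_smooth tT hpsi)
  (fun a => CCk_pushfwd oL hF k (delta_mx i ord0) a)
  (fun a => CCk_pushfwd oL hF k (delta_mx j ord0) a).
apply: eq_CCk oL _ C => y /set_mem Ly.
by rewrite -sesq_delta (pullback_tensor_local hchi hpsi Ly).
Qed.

End PullbackTensor.

(** * Continuity of the curvature estimate *)

Section Continuity.
Variables (R : realType) (n : nat) (V : normedModType R) (W : set V).
Variables (U : set (Cn R n)) (z : V -> Cn R n).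
Hypotheses (oW : open W) (oU : open U) (zU : forall t, W t -> U (z t)).
Hypothesis (cz : forall t, W t -> {for t, continuous z}).

Lemma CCk0_comp F : CCk 0 U F -> CCk 0 W (fun t => F (z t)).
Proof using zU cz.
move=> [[cR _] [cI _]]; split; split=> // t Wt.
  exact: (@continuous_comp _ _ _ z (fun y => complex.Re (F y)) t (cz Wt) (cR _ (zU Wt))).
exact: (@continuous_comp _ _ _ z (fun y => complex.Im (F y)) t (cz Wt) (cI _ (zU Wt))).
Qed.

Variables (g : Cn R n -> 'M[R[i]]_n) (xi eta : V -> 'cV[R[i]]_n).
Hypotheses (sg : smooth_mx U g).
Hypotheses (cxi : forall i, CCk 0 W (fun t => xi t i ord0)).

Lemma CCk0_dvec f : CCk 1 U f -> CCk 0 W (fun t => dvec (xi t) f (z t)).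
Proof using oW oU zU cz cxi.
move=> Cf; apply: CCk_sum oW _ => k; apply: CCkM oW (cxi k) _.
exact: (CCk0_comp (CCk_dz k oU Cf)).
Qed.

Lemma CCk0_dvecb f : CCk 1 U f -> CCk 0 W (fun t => dvecb (xi t) f (z t)).
Proof using oW oU zU cz cxi.
move=> Cf; apply: CCk_sum oW _ => k; apply: CCkM oW (CCkJ oW (cxi k)) _.
exact: (CCk0_comp (CCk_dzbar k oU Cf)).
Qed.

Lemma CCk0_optimal i : (forall y, U y -> g y \in unitmx) ->
  CCk 0 W (fun t => optimal g (z t) (xi t) i ord0).
Proof using oW oU zU cz sg cxi.
move=> ug.
have Cinv p q : CCk 0 W (fun t => invmx (g (z t)) p q).
  apply: CCk_invmx => // [t Wt|k l]; first exact: ug (zU Wt).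
  exact: (@CCk0_comp (fun y => g y k l) (smooth_mx_CCk 0 k l sg)).
pose d p t := \sum_i \sum_k dz k (fun y => g y i p) (z t) * xi t k ord0 * xi t i ord0.
have Cd p : CCk 0 W (d p).
  apply: CCk_sum oW _ => j; apply: CCk_sum oW _ => k.
  have C := CCk0_comp (CCk_dz k oU (smooth_mx_CCk 1 j p sg)).
  exact: (CCkM oW (CCkM oW C (cxi k)) (cxi j)).
have C : CCk 0 W (fun t => \sum_p invmx (g (z t)) p i * d p t).
  by apply: CCk_sum oW _ => p; exact: CCkM.
apply: eq_CCk oW _ C => t /set_mem Wt; rewrite mxE; apply: eq_bigr => p _.
by rewrite mxE (dmetricE oU (zU Wt)).
Qed.

Hypothesis (ceta : forall i, CCk 0 W (fun t => eta t i ord0)).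

Lemma CCk0_Nform : CCk 0 W (fun t => Nform g (z t) (xi t) (eta t)).
Proof using oW oU zU cz sg cxi ceta.
have Cg k i j : CCk k U (fun y => g y i j) by exact: smooth_mx_CCk.
have C1 : CCk 0 W (fun t => \sum_i \sum_j \sum_k \sum_l
    dz k (dzbar l (fun y => g y i j)) (z t) * xi t k ord0 * conjc (xi t l ord0)
      * xi t i ord0 * conjc (xi t j ord0)).
  apply: CCk_sum oW _ => i; apply: CCk_sum oW _ => j.
  apply: CCk_sum oW _ => k; apply: CCk_sum oW _ => l.
  have C : CCk 0 W (fun t => dz k (dzbar l (fun y => g y i j)) (z t)).
    exact: (CCk0_comp (CCk_dz k oU (CCk_dzbar l oU (Cg 2%N i j)))).
  exact: (CCkM oW (CCkM oW (CCkM oW (CCkM oW C (cxi k)) (CCkJ oW (cxi l))) (cxi i))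
    (CCkJ oW (cxi j))).
have C2 : CCk 0 W (fun t => \sum_i \sum_j
    dvec (xi t) (fun y => g y i j) (z t) * xi t i ord0 * conjc (eta t j ord0)).
  apply: CCk_sum oW _ => i; apply: CCk_sum oW _ => j.
  exact: (CCkM oW (CCkM oW (CCk0_dvec (Cg 1%N i j)) (cxi i)) (CCkJ oW (ceta j))).
have C3 : CCk 0 W (fun t => \sum_i \sum_j
    dvecb (xi t) (fun y => g y i j) (z t) * eta t i ord0 * conjc (xi t j ord0)).
  apply: CCk_sum oW _ => i; apply: CCk_sum oW _ => j.
  exact: (CCkM oW (CCkM oW (CCk0_dvecb (Cg 1%N i j)) (ceta i)) (CCkJ oW (cxi j))).
have C4 : CCk 0 W (fun t => sesq (g (z t)) (eta t) (eta t)).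
  apply: CCk_sum oW _ => i; apply: CCk_sum oW _ => j.
  exact: (CCkM oW (CCkM oW (CCk0_comp (Cg 0%N i j)) (ceta i)) (CCkJ oW (ceta j))).
apply: eq_CCk oW _ (CCkB oW (CCkD oW (CCkD oW (CCkN oW C1) C2) C3) C4) => t /set_mem Wt.
have Uz := zU Wt.
by rewrite /Nform (dvec_dvecb_sesq oU Uz) // (dvec_sesq oU Uz) // (dvecb_sesq oU Uz).
Qed.

End Continuity.

Lemma optimal0 (R : realType) n (g : Cn R n -> 'M[R[i]]_n) z : optimal g z 0 = 0.
Proof.
rewrite /optimal (_ : dmetric g z 0 = 0) ?mulmx0 //; apply/matrixP => i j.
by rewrite !mxE /dvec big1 // => k _; rewrite mxE mul0r.
Qed.

Lemma curvature_form0 (R : realType) n (g : Cn R n -> 'M[R[i]]_n) z :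
  curvature_form g z 0 = 0.
Proof.
rewrite /curvature_form big1 // => i _; rewrite big1 // => j _.
by rewrite big1 // => k _; rewrite big1 // => l _; rewrite !mxE conjc0 mulr0.
Qed.

Lemma conjc_id_real (R : realType) (c : R[i]) : conjc c = c -> c = (complex.Re c)%:C.
Proof. by case: c => a b [] /eqP; rewrite -subr_eq0 -opprD oppr_eq0 -mulr2n mulrn_eq0 => /eqP ->. Qed.

Lemma affine_gt0 (R : realType) (a0 b0 a b s : R) :
  0 < b0 -> a0 - 1 < a -> b0 / 2 < b -> 1 + (`|a0| + 1) / (b0 / 2) <= s ->
  0 < s /\ 0 < a + s * b.
Proof.
move=> b00 a0a b0b Ms; have bb : 0 < b0 / 2 by rewrite divr_gt0.
have q0 : 0 <= (`|a0| + 1) / (b0 / 2) by rewrite divr_ge0 ?addr_ge0 // ltW.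
have s0 : 0 < s by apply: lt_le_trans Ms; rewrite ltr_pwDl.
have h1 : `|a0| + 1 <= s * (b0 / 2).
  by rewrite -ler_pdivrMr //; apply: le_trans Ms; rewrite lerDr.
have h2 : s * (b0 / 2) <= s * b by rewrite ler_pM2l // ltW.
have h3 : - `|a0| <= a0 by rewrite lerNl ler_normr lexx orbT.
split=> //; lra.
Qed.

(** * Positivity of the curvature of the total space *)

Section TotalSpace.
Variables (R : realType) (n m : nat).
Variables (X : complexManifold R n) (Y : complexManifold R m) (f : X -> Y).
Hypotheses (hol_f : holomorphic f) (sub_f : submersion f).
Hypothesis compact_X : compact [set: X].
Variables (G : hermitian_metric (vertical f)) (A : chart R X n -> X -> 'M[R[i]]_n).
Hypotheses (posG : fibers_positive_hsc G) (tA : herm_tensor A).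
Hypothesis A_ge0 : forall phi q xi, holo_chart phi -> chart_dom phi q ->
  0 <= sesq (A phi q) xi xi.
Hypothesis restrA : forall phi q xi eta, holo_chart phi -> chart_dom phi q ->
  vertical f phi q xi -> vertical f phi q eta -> sesq (A phi q) xi eta = G phi q xi eta.
Variable T : chart R Y m -> Y -> 'M[R[i]]_m.
Hypothesis tT : herm_tensor T.
Hypothesis posT : forall psi q, holo_chart psi -> chart_dom psi q -> posdef_mx (T psi q).
Hypothesis curvT : forall psi q eta, holo_chart psi -> chart_dom psi q -> eta != 0 ->
  0 < curvature_form (tensor_mx T psi) (chart_map psi q) eta.

Definition total_tensor (s : R) phi q : 'M[R[i]]_n :=
  A phi q + s%:C *: pullback_tensor f T phi q.

Lemma total_herm_tensor s : herm_tensor (total_tensor s).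
Proof using hol_f tA tT.
apply: herm_tensor_add => //.
exact: (herm_tensor_scale (@smooth_fun_cst _ _ X s) (pullback_herm_tensor hol_f tT)).
Qed.

Lemma total_posdef s phi q : 0 < s -> holo_chart phi -> chart_dom phi q ->
  posdef_mx (total_tensor s phi q).
Proof using hol_f tA tT A_ge0 restrA posT.
move=> s0 hphi dq v v0; have [psi hpsi dfq] := holo_chart_at (f q).
have s0' : 0 < s%:C by rewrite ltcR.
rewrite sesqDm sesqZm (pullback_tensorE hol_f tT _ _ hphi hpsi dq dfq).
have [E|Dv] := eqVneq (differential_in phi psi f q *m v) 0.
  rewrite E sesq0l mulr0 addr0.
  have vv : vertical f phi q v by apply/(verticalP hol_f v hphi hpsi dq dfq).
  by rewrite restrA //; exact: metric_positive.
by apply: ltr_wpDl; [exact: A_ge0|rewrite mulr_gt0 // posT].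
Qed.

Section AdaptedChart.
Variables (chi : chart R X n) (psi : chart R Y m) (J : 'M[R[i]]_(m, n)).
Variables (B : 'M[R[i]]_(n, m)) (K : 'M[R[i]]_(n, (n - m)%N)) (L : 'M[R[i]]_((n - m)%N, n)).
Hypotheses (ad : adapted f chi psi J) (spl : splits J B K L).

Local Notation g := (tensor_mx A chi).
Local Notation k := (tensor_mx T psi).

Lemma adapted_base z : chart_cod chi z -> exists2 q,
  chart_dom psi q & chart_map psi q = clin J z.
Proof using ad.
have [_ _ dpsi lin] := ad; move=> cz; have dz := chart_inv_dom cz.
by exists (f (chart_inv chi z)); [exact: dpsi|rewrite lin // chart_invK].
Qed.

Lemma adapted_cod z : chart_cod chi z -> chart_cod psi (clin J z).
Proof using ad. by move=> /adapted_base[q dq <-]; exact: chart_codP. Qed.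

Lemma Nform_total s z xi eta : chart_cod chi z ->
  Nform (tensor_mx (total_tensor s) chi) z xi eta =
  Nform g z xi eta + s%:C * Nform k (clin J z) (J *m xi) (J *m eta).
Proof using hol_f tA tT ad.
have [hchi hpsi dpsi _] := ad; move=> cz.
have oC : open (chart_cod chi) by exact: open_chart_cod.
have oP : open (chart_cod psi) by exact: open_chart_cod.
have tP := pullback_herm_tensor hol_f tT.
rewrite (Nform_add xi eta s%:C oC cz (tensor_smooth tA hchi) (tensor_smooth tP hchi)).
congr (_ + _ * _).
have hJ : holomorphic_on (chart_cod chi) (clin J) by exact: clin_holomorphic.
have PE y : chart_cod chi y -> forall a b,
    sesq (tensor_mx (pullback_tensor f T) chi y) a b =
    sesq (k (clin J y)) (jacobian (clin J) y *m a) (jacobian (clin J) y *m b).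
  move=> cy a b; have dy := chart_inv_dom cy; have [_ _ _ lin] := ad.
  rewrite /tensor_mx (pullback_tensorE hol_f tT a b hchi hpsi dy (dpsi _ dy)).
  rewrite (adapted_differential ad dy) jacobian_clin.
  have -> : clin J y = chart_map psi (f (chart_inv chi y)) by rewrite lin // chart_invK.
  by rewrite chart_mapK //; exact: dpsi.
rewrite (Nform_pullback oP oC adapted_cod hJ (tensor_smooth tT hpsi) PE xi eta cz).
rewrite jacobian_clin (_ : hessian _ _ _ = 0) ?subr0 //; apply/matrixP => a b.
rewrite !mxE (_ : (fun y => _) = fun=> (J *m xi) a ord0) ?dvec_cst //.
by apply/funext => y; rewrite jacobian_clin.
Qed.

Lemma Nform_total_gt0 s z xi eta : 0 < s -> chart_cod chi z ->
  0 < complex.Re (Nform g z xi eta)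
      + s * complex.Re (Nform k (clin J z) (J *m xi) (J *m eta)) ->
  0 < curvature_form (tensor_mx (total_tensor s) chi) z xi.
Proof using hol_f tA tT ad A_ge0 restrA posT.
have [hchi hpsi dpsi _] := ad; move=> s0 cz pos.
have oC : open (chart_cod chi) by exact: open_chart_cod.
have oP : open (chart_cod psi) by exact: open_chart_cod.
have tS := total_herm_tensor s.
have hg y : chart_cod chi y -> hermitian_mx (g y).
  by move=> cy; apply: (tensor_hermitian tA hchi); exact: chart_inv_dom.
have hk y : chart_cod psi y -> hermitian_mx (k y).
  by move=> cy; apply: (tensor_hermitian tT hpsi); exact: chart_inv_dom.
have hS y : chart_cod chi y -> hermitian_mx (tensor_mx (total_tensor s) chi y).
  by move=> cy; apply: (tensor_hermitian tS hchi); exact: chart_inv_dom.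
apply: (lt_le_trans _ (Nform_le_curvature_form oC cz (tensor_smooth tS hchi) hS xi eta _)).
  rewrite Nform_total //.
  rewrite (conjc_id_real (Nform_real oC cz (tensor_smooth tA hchi) hg xi eta)).
  rewrite (conjc_id_real (Nform_real oP (adapted_cod cz) (tensor_smooth tT hpsi) hk _ _)).
  by rewrite -rmorphM -rmorphD ltcR.
by apply: total_posdef => //; exact: chart_inv_dom.
Qed.

Local Notation V := ((Cn R n * Cn R n)%type : normedModType R).

Variable p : X.
Hypothesis dp : chart_dom chi p.

(** Test the curvature on a vector [eta] whose image in the base is optimal, at the
    given direction or at all nearby ones.
    In directions [xi] that are not vertical the base contributes a positive
    multiple of [s], which dominates. Near a vertical direction the base
    contributes a nonnegative amount, and the fibers a positive one. *)
Lemma curvature_total_near x0 : x0 != 0 -> exists M : R,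
  \forall t \near (x0, chart_map chi p), forall s, M <= s ->
    0 < curvature_form (tensor_mx (total_tensor s) chi) t.2 (cvec t.1).
Proof using hol_f tA tT ad A_ge0 restrA posT curvT posG spl dp.
move=> x00; have [hchi hpsi dpsi _] := ad; have [JB LK JK LB sum1] := spl.
pose W : set V := [set t | chart_cod chi t.2].
pose t0 : V := (x0, chart_map chi p).
have oC : open (chart_cod chi) by exact: open_chart_cod.
have oP : open (chart_cod psi) by exact: open_chart_cod.
have oW : open W by apply: open_comp => // t _; exact: cvg_snd.
have Wt0 : W t0 by exact: chart_codP.
have nW : \forall t \near t0, W t by exact: open_nbhs_nbhs.
pose xi (t : V) : 'cV[R[i]]_n := cvec t.1.
have cxi i : CCk 0 W (fun t => xi t i ord0).
  have C : CCk 0 W (fun t : V => coord i t.1).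
    apply: (@CCk0_comp R n V W setT (fun t => t.1) _ _ (coord i)) => [//|t _|].
      exact: cvg_fst.
    exact: CCk_coord openT.
  by apply: (eq_CCk oW _ C) => t _; rewrite mxE.
pose y (t : V) := clin J t.2.
have Wy t : W t -> chart_cod psi (y t) by exact: adapted_cod.
have cy t : W t -> {for t, continuous y}.
  move=> _; apply: (@continuous_comp _ _ _ (fun t : V => t.2) (clin J)).
    exact: cvg_snd.
  exact: continuous_clin.
pose zeta t : 'cV[R[i]]_m := J *m xi t.
have mulC r r' (M : 'M[R[i]]_(r, r')) (v : V -> 'cV[R[i]]_r') :
    (forall i, CCk 0 W (fun t => v t i ord0)) ->
    forall i, CCk 0 W (fun t => (M *m v t) i ord0).
  move=> Cv i; have C : CCk 0 W (fun t => \sum_j M i j * v t j ord0).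
    by apply: (CCk_sum (F := fun j t => M i j * v t j ord0) _ oW) => j; exact: (CCkM oW (CCk_cst _ _ _) (Cv j)).
  by apply: (eq_CCk oW _ C) => t _; rewrite mxE.
have czeta i : CCk 0 W (fun t => zeta t i ord0) by exact: mulC.
have sA := tensor_smooth tA hchi; have sT := tensor_smooth tT hpsi.
have c2 t : W t -> {for t, continuous (fun t : V => t.2)} by move=> _; exact: cvg_snd.
have ReN (eta : V -> 'cV[R[i]]_n) : (forall i, CCk 0 W (fun t => eta t i ord0)) ->
    {for t0, continuous (fun t => complex.Re (Nform g t.2 (xi t) (eta t)))}.
  move=> Ceta.
  have [C _] := @CCk0_Nform R n V W _ _ oW oC (fun t Wt => Wt) c2 _ _ _ sA cxi Ceta.
  exact: Ck_continuous C Wt0.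
have unitT z : chart_cod psi z -> k z \in unitmx.
  by move=> cz; apply: posdef_unitmx; apply: posT => //; exact: chart_inv_dom.
have hk z : chart_cod psi z -> hermitian_mx (k z).
  by move=> cz; apply: (tensor_hermitian tT hpsi); exact: chart_inv_dom.
have curvk t b : W t -> b != 0 -> 0 < curvature_form k (y t) b.
  by move=> Wt b0; have [q dq E] := adapted_base Wt; rewrite /y -E; exact: curvT.
pose kap t := optimal k (y t) (zeta t).
have ckap i : CCk 0 W (fun t => kap t i ord0).
  exact: (@CCk0_optimal R m V W _ _ oW oP Wy cy _ _ sT czeta).
have kapE t : W t -> Nform k (y t) (zeta t) (kap t) = curvature_form k (y t) (zeta t).
  by move=> Wt; rewrite (Nform_optimal oP (Wy t Wt) sT hk) // unitT //; exact: Wy.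
have [J0|J0] := eqVneq (J *m cvec x0) 0.
  have x0' : cvec x0 != 0.
    by apply: contraNneq x00 => E; rewrite -[x0]cvecK E rvec0.
  have [p' p'E] : exists p' : fiber f (f p), fiber_incl p' = p.
    have pf : p \in f @^-1` [set f p] by exact: mem_set.
    by exists (SigSub pf); rewrite /fiber_incl set_valE.
  have dp' : chart_dom chi (fiber_incl p') by rewrite p'E.
  have [eta0 Jeta0 pos] := fiber_Nform_gt0 hol_f ad spl dp' tA restrA posG J0 x0'.
  rewrite p'E in pos.
  pose eta t := eta0 + B *m kap t.
  have Jeta t : J *m eta t = kap t by rewrite mulmxDr Jeta0 add0r mulmxA JB mul1mx.
  have mulBk i : CCk 0 W (fun t => (B *m kap t) i ord0) by exact: mulC.
  have ceta i : CCk 0 W (fun t => eta t i ord0).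
    have C := CCkD oW (CCk_cst 0 W (eta0 i ord0)) (mulBk i).
    by apply: (eq_CCk oW _ C) => t _; rewrite mxE.
  have pos0 : 0 < complex.Re (Nform g t0.2 (xi t0) (eta t0)).
    rewrite /eta /kap /zeta /xi J0 optimal0 mulmx0 addr0.
    by move: pos; rewrite ltcE => /andP[].
  have npos : \forall t \near t0, 0 < complex.Re (Nform g t.2 (xi t) (eta t)).
    exact: cvgr_gt (ReN eta ceta) _ pos0.
  exists 1; apply: filterS2 nW npos => t Wt post s s1.
  have s0 : 0 < s by exact: lt_le_trans s1.
  apply: (Nform_total_gt0 (eta := eta t)) => //; rewrite Jeta.
  apply: ltr_pwDl => //; apply: mulr_ge0; first exact: ltW.
  rewrite [Nform _ _ _ _]kapE //; have [->|z0] := eqVneq (zeta t) 0.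
    by rewrite curvature_form0.
  by have := curvk t _ Wt z0; rewrite ltcE => /andP[_ /ltW].
pose eta (t : V) := B *m kap t0.
have Jeta t : J *m eta t = kap t0 by rewrite mulmxA JB mul1mx.
have ceta i : CCk 0 W (fun t => eta t i ord0) by exact: CCk_cst.
pose a t := complex.Re (Nform g t.2 (xi t) (eta t)).
pose b t := complex.Re (Nform k (y t) (zeta t) (kap t0)).
have ca : {for t0, continuous a} by exact: ReN.
have cb : {for t0, continuous b}.
  have [C _] := @CCk0_Nform R m V W _ _ oW oP Wy cy _ _ (fun=> kap t0) sT czeta
    (fun i => CCk_cst _ _ _).
  exact: Ck_continuous C Wt0.
have b0 : 0 < b t0.
  rewrite /b kapE //; have := curvk t0 _ Wt0 J0.
  by rewrite ltcE => /andP[].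
have na : \forall t \near t0, a t0 - 1 < a t.
  by apply: (cvgr_gt _ ca); rewrite ltrBlDr ltrDl.
have nb : \forall t \near t0, b t0 / 2 < b t.
  by apply: (cvgr_gt _ cb); rewrite ltr_pdivrMr // ltr_pMr // ltr1n.
exists (1 + (`|a t0| + 1) / (b t0 / 2)); apply: filterS3 nW na nb => t Wt at_ bt s Ms.
have [s0 pos] := affine_gt0 b0 at_ bt Ms.
by apply: (Nform_total_gt0 (eta := eta t)) => //; rewrite Jeta.
Qed.

End AdaptedChart.

Lemma compact_sphere : compact [set x : Cn R n | `|x| = 1].
Proof.
apply: (@subclosed_compact _ _ [set x : Cn R n | `|0 - x| <= 1]).
- apply: (@closed_comp _ _ (fun x : Cn R n => `|x|) [set 1 : R]); last exact: closed_eq.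
  by move=> x _; exact: norm_continuous.
- exact: compact_ball.
- by move=> x /= x1; rewrite sub0r normrN x1.
Qed.

(** Compactness of the unit sphere makes the bound on [s] uniform in the
    direction, compactness of [X] makes it uniform in the point. *)
Lemma curvature_total_gt0 : exists2 s, 0 < s & forall q, exists chi,
  [/\ holo_chart chi, chart_dom chi q & forall xi, xi != 0 ->
    0 < curvature_form (tensor_mx (total_tensor s) chi) (chart_map chi q) xi].
Proof using hol_f sub_f compact_X posG tA A_ge0 restrA tT posT curvT.
pose P s q := exists chi, [/\ holo_chart chi, chart_dom chi q & forall xi, xi != 0 ->
    0 < curvature_form (tensor_mx (total_tensor s) chi) (chart_map chi q) xi].
have near_P : \forall s \near +oo, forall q, P s q.
  have /compact_near_coveringP cX := compact_X.
  suff H : \forall s \near +oo, [set: X] `<=` P s by apply: filterS H => s H q; exact: H.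
  apply: cX => p _.
  have [chi [psi [J [B [K [L [dp ad spl]]]]]]] := adapted_chart hol_f sub_f p.
  have /compact_near_coveringP cS := compact_sphere.
  have nS : \forall sz \near (+oo%R, nbhs (chart_map chi p)),
      [set x : Cn R n | `|x| = 1] `<=`
      [set x | 0 < curvature_form (tensor_mx (total_tensor sz.1) chi) sz.2 (cvec x)].
    pose Q (sz : R * Cn R n) x :=
      0 < curvature_form (tensor_mx (total_tensor sz.1) chi) sz.2 (cvec x).
    have F : Filter (filter_prod (+oo%R : set_system R) (nbhs (chart_map chi p))).
      exact: filter_prod_filter.
    apply: (cS _ _ Q F) => x0 x01.
    have x00 : x0 != 0 by rewrite -normr_gt0 x01.
    have [M [[N1 N2] [/= nN1 nN2] H]] := curvature_total_near ad spl dp x00.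
    exists (N1, [set sz | M <= sz.1 /\ N2 sz.2]) => /=.
      split=> //; exists ([set s | M <= s], N2) => //=; split=> //.
      by apply: nbhs_pinfty_ge; exact: num_real.
    by move=> [x [s z]] /= [N1x [Ms N2z]]; exact: (H (x, z)).
  have [[S N] [/= nS1 nN] HSN] := nS.
  exists (chart_dom chi `&` [set q | N (chart_map chi q)], S) => /=.
    split=> //; apply: filterI; first exact: near_chart_dom.
    exact: chart_map_near.
  move=> [q s] /= [[dq Nq] Ss]; have [hchi _ _ _] := ad.
  exists chi; split=> // xi xi0; pose x := rvec xi; pose r := `|x|.
  have r0 : 0 < r.
    rewrite normr_gt0; apply: contraNneq xi0 => E.
    by rewrite -[xi]rvecK -/x E -[X in cvec X](@rvec0 R n) rvecK.
  have xE : xi = r%:C *: cvec (r^-1 *: x).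
    by rewrite -cvecZ scalerA mulfV ?gt_eqF // scale1r rvecK.
  rewrite xE curvature_formZ; apply: mulr_gt0; first by rewrite exprn_gt0 // ltcR.
  apply: (HSN (s, chart_map chi q)) => //=.
  by rewrite normrZ normfV normr_id mulVf // gt_eqF.
have near_gt0 : \forall s \near (+oo : set_system R), 0 < s by exact: nbhs_pinfty_gt.
have [s [s0 Ps]] : exists s, 0 < s /\ forall q, P s q.
  apply: (@filter_ex _ (+oo%R : set_system R)).
  exact: filterI near_gt0 near_P.
by exists s.
Qed.

End TotalSpace.

Theorem theorem1p1 (R : realType) (n m : nat)
    (X : complexManifold R n) (Y : complexManifold R m) (pi : X -> Y)
    (compact_X : compact [set: X]%classic)
    (surjective_pi : forall t : Y, exists x : X, pi x = t)
    (holomorphic_pi : holomorphic pi)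
    (submersion_pi : submersion pi) :
  (exists h : hermitian_metric (@tangent R m Y), positive_hsc h) ->
  (exists G : hermitian_metric (vertical pi), fibers_positive_hsc G) ->
  exists H : hermitian_metric (@tangent R n X), positive_hsc H.
Proof.
move=> [h pos_h] [G pos_G].
have [A [tA A_ge0 restrA]] := fiber_metric_extension holomorphic_pi submersion_pi G compact_X.
have tT := tensor_of_metric_herm_tensor h.
have posT := @tensor_of_metric_posdef _ _ _ h.
have curvT psi q eta : holo_chart psi -> chart_dom psi q -> eta != 0 ->
    0 < curvature_form (tensor_mx (tensor_of_metric h) psi) (chart_map psi q) eta.
  move=> hpsi dq eta0; have := pos_h psi q hpsi dq eta eta0.
  rewrite metric_mxE hol_sect_curvature_gt0 //.
  by rewrite /tensor_mx chart_mapK //; exact: posT.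
have [s s0 pos] := curvature_total_gt0 holomorphic_pi submersion_pi compact_X pos_G tA A_ge0
  restrA tT posT curvT.
exists (metric_of_tensor (total_herm_tensor holomorphic_pi tA tT s)
  (fun phi q hphi dq => total_posdef holomorphic_pi tA A_ge0 restrA tT posT s0 hphi dq)).
exact: positive_hsc_of_tensor pos.
Qed.
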